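(* Ramanujan's formula states that for $0\le\alpha\le1$, $$\sum_{n=1}^\infty\frac{h_n}{n^2}\alpha^{2n}=\frac12\log\alpha\,\log^2\frac{1-\alpha}{1+\alpha}+\left[\mathrm{Li}_2\left(\frac{1-\alpha}{1+\alpha}\right)-\mathrm{Li}_2\left(\frac{\alpha-1}{1+\alpha}\right)\right]\log\frac{1-\alpha}{1+\alpha}-\mathrm{Li}_3\left(\frac{1-\alpha}{1+\alpha}\right)+\mathrm{Li}_3\left(\frac{\alpha-1}{1+\alpha}\right)+\frac74\zeta(3).$$ With the principal branch of the logarithm, this formula extends by analytic continuation in the disc $|\alpha|<1$ where its right-hand side is defined. In particular, $\alpha$ can be replaced by $i\alpha$ there, which gives the closed form evaluation $$\sum_{n=1}^\infty(-1)^{n-1}\frac{h_n}{n^2}\alpha^{2n}=2\int_0^1\frac{(\arctan \alpha x)^2}{x}\,dx$$ $$=\mathrm{Li}_3\left(\frac{1-i\alpha}{1+i\alpha}\right)-\mathrm{Li}_3\left(\frac{i\alpha-1}{1+i\alpha}\right)-2i\arctan(\alpha)\left[\mathrm{Li}_2(i\alpha)-\mathrm{Li}_2(-i\alpha)-\frac{\pi^2}{4}\right]-2\left(\frac{\pi}{2}i+\log\alpha\right)(\arctan\alpha)^2-\frac74\zeta(3).$$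
   Context: For $n\ge1$, $h_n=1+\frac13+\frac15+\dots+\frac1{2n-1}$. For $p\in\{2,3\}$, $\mathrm{Li}_p(z)=\sum_{n=1}^\infty\frac{z^n}{n^p}$ for $|z|\le1$, understood by analytic continuation for other arguments. $\zeta(3)=\sum_{n=1}^\infty\frac1{n^3}$, $i$ is the imaginary unit, $\log$ denotes the principal branch of the logarithm, and $\arctan$ is the function with Taylor series $\arctan z=\sum_{n=1}^\infty\frac{(-1)^{n-1}z^{2n-1}}{2n-1}$. The series and the integral in the second formula are the ones for which it is known that $\int_0^1\frac{(\arctan\alpha x)^2}{x}\,dx=\frac12\sum_{n=1}^\infty(-1)^{n-1}\frac{h_n}{n^2}\alpha^{2n}$ for any $|\alpha|\le1$.
   Formalization: The closed form is proved for 0<|α|<1 with -π < arg α < π/2; for π/2 < arg α ≤ π the printed formula fails with the principal logarithm, since log(iα) = πi/2 + log α - 2πi there, and for arg α = π/2 the argument of Li_3 lies on its cut. *)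

(* Defs.v *)
From Stdlib Require Import Reals Lra ClassicalEpsilon.
From Coquelicot Require Import Coquelicot.

Open Scope R_scope.

Definition h (n : nat) : R := sum_f_R0 (fun k => 1 / INR (2 * k + 1)) (n - 1).

Definition zeta3 : R := Series (fun n => 1 / INR (n + 1) ^ 3).

(** Principal argument, in (-PI, PI] for [z <> 0] (see [Arg_spec]). *)
Definition Arg (z : C) : R :=
  if Rle_dec 0 (Im z) then acos (Re z / Cmod z) else - acos (Re z / Cmod z).

(** Principal logarithm.  At [0] the value is irrelevant: it only ever occurs
    multiplied by [0], and there the endpoint limits are stated separately. *)
Definition Clog (z : C) : C := (ln (Cmod z), Arg z).

Lemma Arg_spec (z : C) : z <> 0 ->
  - PI < Arg z <= PI /\ z = (Cmod z * (cos (Arg z), sin (Arg z)))%C.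
Proof.
intros Hz.
assert (Hm : 0 < Cmod z) by now apply Cmod_gt_0.
assert (H2 := Cmod2_alt z).
destruct z as [x y]; unfold Arg; simpl Re in *; simpl Im in *.
set (m := Cmod (x, y)) in *.
assert (Hq : (x / m)² + (y / m)² = 1).
{ unfold Rsqr; apply (Rmult_eq_reg_l (m ^ 2)); [|nra].
  replace (m ^ 2 * (x / m * (x / m) + y / m * (y / m))) with (x ^ 2 + y ^ 2)
    by (field; lra).
  rewrite <- H2; ring. }
assert (Hx : -1 <= x / m <= 1) by (unfold Rsqr in Hq; nra).
assert (Hb := acos_bound (x / m)).
assert (Hs : sqrt (1 - (x / m)²) = Rabs (y / m)).
{ replace (1 - (x / m)²) with ((y / m)²) by lra; apply sqrt_Rsqr_abs. }
assert (Hpi := PI_RGT_0).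
destruct (Rle_dec 0 y) as [Hy|Hy].
- assert (Hym : 0 <= y / m) by now apply Rdiv_le_0_compat.
  split; [lra|].
  rewrite cos_acos, sin_acos, Hs, Rabs_pos_eq by assumption.
  unfold Cmult; simpl; f_equal; field; lra.
- assert (Hym : y / m < 0).
  { unfold Rdiv; apply Rlt_le_trans with (0 * / m); [|lra].
    apply Rmult_lt_compat_r; [now apply Rinv_0_lt_compat|lra]. }
  split.
  + split; [|lra].
    destruct (Rle_lt_or_eq_dec _ _ (proj2 Hb)) as [|E]; [lra|exfalso].
    assert (E2 : sin (acos (x / m)) = 0) by (rewrite E; apply sin_PI).
    rewrite sin_acos, Hs, Rabs_left in E2 by assumption; lra.
  + rewrite cos_neg, sin_neg, cos_acos, sin_acos, Hs, Rabs_left by assumption.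
    unfold Cmult; simpl; f_equal; field; lra.
Qed.

Definition CSeries (a : nat -> C) : C :=
  (Series (fun n => Re (a n)), Series (fun n => Im (a n))).

(** The Taylor series; meaningful where it converges, in particular for
    [Cmod z < 1]. *)
Definition Carctan (z : C) : C :=
  CSeries (fun n => (-1) ^ n * z ^ (2 * n + 1) / INR (2 * n + 1))%C.

Definition analytic_on (U : C -> Prop) (f : C -> C) : Prop :=
  forall z0, U z0 -> exists r : R, 0 < r /\ exists a : nat -> C,
    forall z, Cmod (z - z0) < r ->
      @is_pseries C_AbsRing C_NormedModule a (z - z0)%C (f z).

(** [L] is the polylogarithm of order [p]: the power series on the closed unit
    disc, continued analytically to the plane cut along [1, +oo).  The cut plane
    is connected, so [L] is unique except at real [z > 1], where it is
    unconstrained. *)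
Definition is_polylog (p : nat) (L : C -> C) : Prop :=
  (forall z, Cmod z <= 1 ->
     @is_series C_AbsRing C_NormedModule
       (fun n => z ^ (n + 1) / INR (n + 1) ^ p)%C (L z)) /\
  analytic_on (fun z => ~ (Im z = 0 /\ 1 <= Re z)) L.

Definition Li (p : nat) : C -> C :=
  epsilon (inhabits (fun _ => RtoC 0)) (is_polylog p).

Definition log_defined (z : C) : Prop := ~ (Im z = 0 /\ Re z <= 0).

Definition Li_defined (z : C) : Prop := ~ (Im z = 0 /\ 1 < Re z).

Definition ramanujan_rhs (a : C) : C :=
  let w := ((1 - a) / (1 + a))%C in
  let w' := ((a - 1) / (1 + a))%C in
  (1 / 2 * Clog a * Clog w ^ 2
   + (Li 2 w - Li 2 w') * Clog w
   - Li 3 w + Li 3 w' + 7 / 4 * zeta3)%C.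

(** The part of the disc where every function in [ramanujan_rhs] is evaluated
    off its branch cut. *)
Definition ramanujan_domain (a : C) : Prop :=
  Cmod a < 1 /\
  log_defined a /\ log_defined ((1 - a) / (1 + a)) /\
  Li_defined ((1 - a) / (1 + a)) /\ Li_defined ((a - 1) / (1 + a)).

Definition closed_form (a : C) : C :=
  let w := ((1 - Ci * a) / (1 + Ci * a))%C in
  let w' := ((Ci * a - 1) / (1 + Ci * a))%C in
  (Li 3 w - Li 3 w'
   - 2 * Ci * Carctan a * (Li 2 (Ci * a) - Li 2 (- (Ci * a)) - PI ^ 2 / 4)
   - 2 * (PI / 2 * Ci + Clog a) * Carctan a ^ 2
   - 7 / 4 * zeta3)%C.

(** The points [a] of the disc such that [Ci * a] is in [ramanujan_domain] and
    [Clog (Ci * a) = PI / 2 * Ci + Clog a], i.e. [-PI < Arg a < PI / 2].  For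
    [PI / 2 < Arg a <= PI] the principal [Clog (Ci * a)] differs from
    [PI / 2 * Ci + Clog a] by [2 * PI * Ci] and the closed form fails; for
    [Arg a = PI / 2] the argument of [Li 3] lies on the cut. *)
Definition closed_form_domain (a : C) : Prop :=
  Cmod a < 1 /\ a <> 0 /\ Arg a < PI / 2.

(* Main.v *)
Require Import Defs.
From Stdlib Require Import Reals Lra Lia ClassicalEpsilon.
From Coquelicot Require Import Coquelicot.

Open Scope R_scope.

(** Both sides of Ramanujan's formula have the derivative [(log w)^2 / (2 a)], where
    [w = (1 - a) / (1 + a)]: for the series because [sum h_n a^(2n) / n = artanh(a)^2]
    and [log w = - 2 artanh a], for the right-hand side because [1 + w = 2 / (1 + a)] and
    [1 - w = 2 a / (1 + a)].  Hence they differ by a constant on the slit disc, which is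
    star-shaped about [1/2]; the constant vanishes by letting [a] tend to [0] along the
    reals, and the value at [a = 1] follows by continuity of the series.

    In the slit disc [w] leaves the unit disc, so the polylogarithms are needed off their
    cut: they are represented there by integrals, and the continuation chosen in the
    definition of [Li] agrees with these by the identity theorem.

    The closed form is minus the right-hand side at [i a], rewritten by the reflection
    formula [X(z) + X(w) + log z log w = pi^2 / 4] for [X(z) = Li_2(z) - Li_2(-z)]. *)

Lemma C_eq (z w : C) : Re z = Re w -> Im z = Im w -> z = w.
Proof.
destruct z as [x y], w as [x' y']; simpl; intros -> ->; reflexivity.
Qed.

Lemma im_le_Cmod (z : C) : Rabs (Im z) <= Cmod z.
Proof.
eapply Rle_trans; [apply Rmax_r|apply (Rmax_Cmod z)].
Qed.

Lemma Cmod_le_Re_Im (z : C) : Cmod z <= Rabs (Re z) + Rabs (Im z).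
Proof.
assert (H := Cmod2_alt z); assert (H0 := Cmod_ge_0 z).
assert (H1 := Rabs_pos (Re z)); assert (H2 := Rabs_pos (Im z)).
rewrite <- (pow2_abs (Re z)), <- (pow2_abs (Im z)) in H; nra.
Qed.

Lemma Cmod_minus_ge (z w : C) : Cmod z - Cmod w <= Cmod (z - w).
Proof.
assert (H := Cmod_triangle (z - w) w).
replace (z - w + w)%C with z in H by ring; lra.
Qed.

Lemma Cmod_minus_le (z w : C) : Cmod (z - w) <= Cmod z + Cmod w.
Proof.
unfold Cminus; eapply Rle_trans; [apply Cmod_triangle|]; rewrite Cmod_opp; lra.
Qed.

Lemma Cmod_R_pos (x : R) : 0 <= x -> Cmod x = x.
Proof.
intros Hx; rewrite Cmod_R; now apply Rabs_pos_eq.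
Qed.

(** * Derivatives along curves *)

Definition curve_derive (g : R -> C) (t : R) (v : C) : Prop :=
  is_derive (fun s => Re (g s)) t (Re v) /\ is_derive (fun s => Im (g s)) t (Im v).

(** Complex differentiability is tested on differentiable real curves only: the
    chain rule is then built in, and every computation becomes a real one. *)
Definition cdiff (f : C -> C) (z l : C) : Prop :=
  forall (g : R -> C) (t : R) (v : C),
    g t = z -> curve_derive g t v -> curve_derive (fun s => f (g s)) t (l * v)%C.

Lemma curve_derive_eq (g : R -> C) (t : R) (v w : C) :
  curve_derive g t v -> v = w -> curve_derive g t w.
Proof. now intros H <-. Qed.

Lemma curve_derive_ext_loc (f g : R -> C) (t : R) (v : C) :
  locally t (fun s => f s = g s) -> curve_derive f t v -> curve_derive g t v.
Proof.
intros H [H1 H2]; split.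
- refine (is_derive_ext_loc _ _ _ _ _ H1).
  revert H; apply filter_imp; now intros s ->.
- refine (is_derive_ext_loc _ _ _ _ _ H2).
  revert H; apply filter_imp; now intros s ->.
Qed.

Lemma curve_derive_ext (f g : R -> C) (t : R) (v : C) :
  (forall s, f s = g s) -> curve_derive f t v -> curve_derive g t v.
Proof.
intros H; apply curve_derive_ext_loc, filter_forall, H.
Qed.

Lemma curve_derive_const (c : C) (t : R) : curve_derive (fun _ => c) t 0.
Proof. split; simpl; auto_derive; auto. Qed.

Lemma curve_derive_line (p q : C) (t : R) :
  curve_derive (fun s => p + s * q)%C t q.
Proof. split; simpl; auto_derive; auto; unfold Re, Im; ring. Qed.

Lemma curve_derive_RtoC (f : R -> R) (t l : R) :
  is_derive f t l -> curve_derive (fun s => RtoC (f s)) t l.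
Proof. intros H; split; simpl; [exact H|]. auto_derive; auto. Qed.

Lemma curve_derive_plus (f g : R -> C) (t : R) (v w : C) :
  curve_derive f t v -> curve_derive g t w ->
  curve_derive (fun s => f s + g s)%C t (v + w)%C.
Proof.
intros [H1 H2] [H3 H4]; split.
- apply (is_derive_plus _ _ _ _ _ H1 H3).
- apply (is_derive_plus _ _ _ _ _ H2 H4).
Qed.

Lemma curve_derive_mult (f g : R -> C) (t : R) (v w : C) :
  curve_derive f t v -> curve_derive g t w ->
  curve_derive (fun s => f s * g s)%C t (v * g t + f t * w)%C.
Proof.
intros [H1 H2] [H3 H4]; split.
- eapply (is_derive_ext (fun s => Re (f s) * Re (g s) - Im (f s) * Im (g s)));
    [reflexivity|].
  evar_last; [apply @is_derive_minus; apply @is_derive_mult; eauto; exact Rmult_comm|].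
  unfold minus, plus, opp, mult; simpl; unfold Re, Im; ring.
- eapply (is_derive_ext (fun s => Re (f s) * Im (g s) + Im (f s) * Re (g s)));
    [reflexivity|].
  evar_last; [apply @is_derive_plus; apply @is_derive_mult; eauto; exact Rmult_comm|].
  unfold minus, plus, opp, mult; simpl; unfold Re, Im; ring.
Qed.

Lemma sum_sq_neq_0 (z : C) : z <> 0 -> Re z ^ 2 + Im z ^ 2 <> 0.
Proof.
intros Hz; rewrite <- Cmod2_alt; apply pow_nonzero.
now intros E; apply Hz, Cmod_eq_0.
Qed.

Lemma is_derive_div_sum_sq (x y : R -> R) (t x' y' : R) :
  x t ^ 2 + y t ^ 2 <> 0 -> is_derive x t x' -> is_derive y t y' ->
  is_derive (fun s => x s / (x s ^ 2 + y s ^ 2)) t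
    ((x' * (y t ^ 2 - x t ^ 2) - 2 * x t * y t * y') / (x t ^ 2 + y t ^ 2) ^ 2).
Proof.
intros Hn H1 H2; auto_derive.
- repeat split; try (eexists; eassumption).
  now replace (x t * (x t * 1) + y t * (y t * 1)) with (x t ^ 2 + y t ^ 2) by ring.
- rewrite (is_derive_unique x t x' H1 : Derive (fun s : R => x s) t = x').
  rewrite (is_derive_unique y t y' H2 : Derive (fun s : R => y s) t = y').
  field; intros E; apply Hn; rewrite <- E; ring.
Qed.

Lemma curve_derive_inv (f : R -> C) (t : R) (v : C) :
  f t <> 0 -> curve_derive f t v ->
  curve_derive (fun s => / f s)%C t (- (/ f t * / f t) * v)%C.
Proof.
intros Hz [H1 H2]; assert (Hn := sum_sq_neq_0 _ Hz).
split.
- evar_last;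
    [apply (is_derive_div_sum_sq (fun s => Re (f s)) (fun s => Im (f s))); eassumption|].
  destruct (f t) as [x y]; destruct v as [x' y']; simpl in *; field.
  intros E; apply Hn; rewrite <- E; ring.
- eapply (is_derive_ext (fun s => - (Im (f s) / (Im (f s) ^ 2 + Re (f s) ^ 2)))).
  { intros s; unfold Re, Im; simpl; unfold Rdiv.
    rewrite (Rplus_comm (snd (f s) * _)); ring. }
  rewrite Rplus_comm in Hn.
  evar_last;
    [apply @is_derive_opp, (is_derive_div_sum_sq (fun s => Im (f s)) (fun s => Re (f s)));
     eassumption|].
  destruct (f t) as [x y]; destruct v as [x' y']; unfold opp; simpl in *; field.
  intros E; apply Hn; rewrite <- E; ring.
Qed.

Lemma is_derive_ln_modulus (x y : R -> R) (t x' y' : R) :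
  0 < x t ^ 2 + y t ^ 2 -> is_derive x t x' -> is_derive y t y' ->
  is_derive (fun s => ln (sqrt (x s ^ 2 + y s ^ 2))) t
    ((x t * x' + y t * y') / (x t ^ 2 + y t ^ 2)).
Proof.
intros Hn H1 H2; auto_derive.
- replace (x t * (x t * 1) + y t * (y t * 1)) with (x t ^ 2 + y t ^ 2) by ring.
  repeat split; try (eexists; eassumption); auto using sqrt_lt_R0.
- rewrite (is_derive_unique x t x' H1 : Derive (fun s : R => x s) t = x').
  rewrite (is_derive_unique y t y' H2 : Derive (fun s : R => y s) t = y').
  replace (x t * (x t * 1) + y t * (y t * 1)) with (x t ^ 2 + y t ^ 2) by ring.
  assert (H := sqrt_sqrt _ (Rlt_le _ _ Hn)).
  assert (H0 := sqrt_lt_R0 _ Hn).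
  rewrite <- H at 3; field; lra.
Qed.

Lemma is_derive_half_angle (x y : R -> R) (t x' y' : R) :
  0 < x t ^ 2 + y t ^ 2 -> 0 < sqrt (x t ^ 2 + y t ^ 2) + x t ->
  is_derive x t x' -> is_derive y t y' ->
  is_derive (fun s => 2 * atan (y s / (sqrt (x s ^ 2 + y s ^ 2) + x s))) t
    ((x t * y' - y t * x') / (x t ^ 2 + y t ^ 2)).
Proof.
intros Hn Hp H1 H2; auto_derive.
- replace (x t * (x t * 1) + y t * (y t * 1)) with (x t ^ 2 + y t ^ 2) by ring.
  repeat split; try (eexists; eassumption); auto; lra.
- rewrite (is_derive_unique x t x' H1 : Derive (fun s : R => x s) t = x').
  rewrite (is_derive_unique y t y' H2 : Derive (fun s : R => y s) t = y').
  replace (x t * (x t * 1) + y t * (y t * 1)) with (x t ^ 2 + y t ^ 2) by ring.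
  assert (H := sqrt_sqrt _ (Rlt_le _ _ Hn)).
  assert (H0 := sqrt_lt_R0 _ Hn).
  set (m := sqrt (x t ^ 2 + y t ^ 2)) in *.
  rewrite <- H.
  set (a := x t) in *; set (b := y t) in *.
  assert (Ey : b * b = m * m - a * a) by lra.
  replace (1 + b * / (m + a) * (b * / (m + a) * 1)) with (2 * m / (m + a)).
  2:{ replace (b * / (m + a) * (b * / (m + a) * 1)) with (b * b / ((m + a) * (m + a)))
        by (field; lra).
      rewrite Ey; field; lra. }
  apply (Rmult_eq_reg_r (m * m * (m + a))).
  2:{ apply Rmult_integral_contrapositive; split; nra. }

  transitivity (2 * (m * m * (m + a)) * ((y' * (m + a) - b * (x' + (a * x' + b * y') / m))
    / (2 * m * (m + a)))); [field; lra|].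
  transitivity (m * (y' * (m + a)) - m * b * x' - b * a * x' - b * b * y');
    [field; lra|].
  rewrite Ey; field; nra.
Qed.

Lemma Arg_polar (m t : R) : 0 < m -> - PI < t <= PI ->
  Arg (m * cos t, m * sin t) = t.
Proof.
intros Hm Ht; unfold Arg; simpl.
assert (E : Cmod (m * cos t, m * sin t) = m).
{ assert (H := Cmod2_alt (m * cos t, m * sin t)); simpl in H.
  assert (H0 := Cmod_ge_0 (m * cos t, m * sin t)).
  assert (H1 := sin2_cos2 t); unfold Rsqr in H1.
  set (k := Cmod _) in *.
  assert (k ^ 2 = m ^ 2) by (simpl; rewrite H; nra).
  nra. }
rewrite E; replace (m * cos t / m) with (cos t) by (field; lra).
destruct (Rle_dec 0 (m * sin t)) as [H|H].
- destruct (Rle_lt_dec 0 t) as [H0|H0]; [apply acos_cos; lra|].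
  exfalso; assert (sin t < 0) by (apply sin_lt_0_var; lra); nra.
- destruct (Rle_lt_dec 0 t) as [H0|H0].
  + exfalso; apply H; assert (0 <= sin t) by (apply sin_ge_0; lra); nra.
  + rewrite <- cos_neg, acos_cos; lra.
Qed.

Lemma log_defined_pos (z : C) : log_defined z <-> 0 < Cmod z + Re z.
Proof.
assert (H := Cmod2_alt z); assert (H0 := Cmod_ge_0 z); unfold log_defined.
destruct z as [x y]; simpl in *; set (m := Cmod (x, y)) in *.
split; intros H1.
- destruct (Rlt_le_dec 0 (m + x)) as [|H2]; auto; exfalso; apply H1.
  assert (y * y = 0) by nra; split; nra.
- intros [-> H2]; nra.
Qed.

Lemma log_defined_neq_0 (z : C) : log_defined z -> z <> 0.
Proof. intros H ->; apply H; simpl; lra. Qed.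

Lemma Arg_half_angle (z : C) : log_defined z ->
  Arg z = 2 * atan (Im z / (Cmod z + Re z)).
Proof.
intros Hz; assert (H0 := log_defined_neq_0 z Hz).
apply log_defined_pos in Hz.
destruct (Arg_spec z H0) as [H1 H2].
assert (Hm := proj1 (Cmod_gt_0 z) H0).
assert (Hx : Re z = Cmod z * cos (Arg z)) by (rewrite H2 at 1; simpl; ring).
assert (Hy : Im z = Cmod z * sin (Arg z)) by (rewrite H2 at 1; simpl; ring).
set (t := Arg z) in *; set (m := Cmod z) in *.
assert (Hc : 0 < 1 + cos t) by nra.
assert (H3 : t <> PI) by (intros E; rewrite E, cos_PI in Hc; lra).
assert (Ht : - (PI / 2) < t / 2 < PI / 2) by lra.
assert (Hc2 : 0 < cos (t / 2)) by (apply cos_gt_0; lra).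
transitivity (2 * atan (tan (t / 2))); [rewrite atan_tan; lra|].
assert (Es : sin t = 2 * sin (t / 2) * cos (t / 2)) by (rewrite <- sin_2a; f_equal; field).
assert (Ec : cos t = 2 * cos (t / 2) * cos (t / 2) - 1)
  by (rewrite <- cos_2a_cos; f_equal; field).
rewrite Hx, Hy; do 2 f_equal; unfold tan; rewrite Es, Ec; field; split; [|lra].
rewrite <- Ec; nra.
Qed.

Lemma curve_derive_Clog (g : R -> C) (t : R) (v : C) :
  log_defined (g t) -> curve_derive g t v ->
  curve_derive (fun s => Clog (g s)) t (/ g t * v)%C.
Proof.
intros Hz Hg; assert (H0 := sum_sq_neq_0 _ (log_defined_neq_0 _ Hz)).
assert (Hn : 0 < Re (g t) ^ 2 + Im (g t) ^ 2) by nra.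
destruct Hg as [H1 H2]; split.
- eapply (is_derive_ext (fun s => ln (sqrt (Re (g s) ^ 2 + Im (g s) ^ 2))));
    [reflexivity|].
  evar_last;
    [apply (is_derive_ln_modulus (fun s => Re (g s)) (fun s => Im (g s))); eassumption|].
  destruct (g t) as [x y]; destruct v as [x' y']; simpl in *; field.
  intros E; apply H0; rewrite <- E; ring.
- assert (Hp := proj1 (log_defined_pos _) Hz).
  eapply (is_derive_ext_loc (fun s =>
    2 * atan (Im (g s) / (sqrt (Re (g s) ^ 2 + Im (g s) ^ 2) + Re (g s))))).
  + assert (Hc : continuous (fun s => sqrt (Re (g s) ^ 2 + Im (g s) ^ 2) + Re (g s)) t).
    { assert (H : forall x y : R -> R, ex_derive x t -> ex_derive y t ->
        0 < x t ^ 2 + y t ^ 2 -> ex_derive (fun s => sqrt (x s ^ 2 + y s ^ 2) + x s) t).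
      { intros x y Hx Hy Hxy; auto_derive; repeat split; auto. }
      apply (ex_derive_continuous (fun s => sqrt (Re (g s) ^ 2 + Im (g s) ^ 2) + Re (g s))).
      apply (H (fun s => Re (g s)) (fun s => Im (g s))); auto; eexists; eassumption. }
    assert (Hl := Hc _ (open_gt 0 _ Hp)).
    unfold filtermap in Hl; revert Hl; apply filter_imp; intros s Hs.
    symmetry; apply (Arg_half_angle (g s)), log_defined_pos, Hs.
  + evar_last;
      [apply (is_derive_half_angle (fun s => Re (g s)) (fun s => Im (g s))); eassumption|].
    destruct (g t) as [x y]; destruct v as [x' y']; simpl in *; field.
    intros E; apply H0; rewrite <- E; ring.
Qed.

Lemma cdiff_eq (f : C -> C) (z l l' : C) : cdiff f z l -> l = l' -> cdiff f z l'.
Proof. now intros H <-. Qed.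

Lemma cdiff_id (z : C) : cdiff (fun z => z) z 1.
Proof.
intros g t v _ Hv; eapply curve_derive_eq; [exact Hv|ring].
Qed.

Lemma cdiff_const (c z : C) : cdiff (fun _ => c) z 0.
Proof.
intros g t v _ Hv; eapply curve_derive_eq; [apply curve_derive_const|ring].
Qed.

Lemma cdiff_plus (f g : C -> C) (z l m : C) :
  cdiff f z l -> cdiff g z m -> cdiff (fun z => f z + g z)%C z (l + m)%C.
Proof.
intros Hf Hg c t v E Hv.
eapply curve_derive_eq; [apply curve_derive_plus; [apply (Hf c t v E Hv)|apply (Hg c t v E Hv)]|ring].
Qed.

Lemma cdiff_mult (f g : C -> C) (z l m : C) :
  cdiff f z l -> cdiff g z m ->
  cdiff (fun z => f z * g z)%C z (l * g z + f z * m)%C.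
Proof.
intros Hf Hg c t v E Hv.
eapply curve_derive_eq; [apply curve_derive_mult; [apply (Hf c t v E Hv)|apply (Hg c t v E Hv)]|].
simpl; rewrite E; ring.
Qed.

Lemma cdiff_opp (f : C -> C) (z l : C) :
  cdiff f z l -> cdiff (fun z => - f z)%C z (- l)%C.
Proof.
intros Hf c t v E Hv.
apply (curve_derive_ext (fun s => -(1) * f (c s))%C); [intros s; ring|].
eapply curve_derive_eq; [apply curve_derive_mult;
  [apply curve_derive_const|apply (Hf c t v E Hv)]|simpl; ring].
Qed.

Lemma cdiff_minus (f g : C -> C) (z l m : C) :
  cdiff f z l -> cdiff g z m -> cdiff (fun z => f z - g z)%C z (l - m)%C.
Proof.
intros Hf Hg; apply cdiff_plus; [exact Hf|apply cdiff_opp, Hg].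
Qed.

Lemma cdiff_inv (f : C -> C) (z l : C) :
  f z <> 0 -> cdiff f z l -> cdiff (fun z => / f z)%C z (- l / (f z * f z))%C.
Proof.
intros Hz Hf c t v E Hv.
eapply curve_derive_eq; [apply curve_derive_inv;
  [rewrite E; exact Hz|apply (Hf c t v E Hv)]|].
simpl; rewrite E; field; exact Hz.
Qed.

Lemma cdiff_comp (f g : C -> C) (z l m : C) :
  cdiff f (g z) l -> cdiff g z m -> cdiff (fun z => f (g z)) z (l * m)%C.
Proof.
intros Hf Hg c t v E Hv.
eapply curve_derive_eq; [apply (Hf (fun s => g (c s)) t (m * v)%C)|ring].
- now rewrite E.
- apply (Hg c t v E Hv).
Qed.

Lemma cdiff_Clog (z : C) : log_defined z -> cdiff Clog z (/ z).
Proof.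
intros Hz c t v E Hv; rewrite <- E; apply curve_derive_Clog; [now rewrite E|exact Hv].
Qed.

Lemma is_derive_quadratic (r x y : R -> R) (t x' y' K : R) :
  is_derive x t x' -> is_derive y t y' ->
  locally t (fun s => Rabs (r s) <= K * ((x s - x t) ^ 2 + (y s - y t) ^ 2)) ->
  is_derive r t 0.
Proof.
intros Hx Hy Hr.
assert (H0 : r t = 0).
{ apply locally_singleton in Hr.
  replace (K * ((x t - x t) ^ 2 + (y t - y t) ^ 2)) with 0 in Hr by ring.
  assert (H := Rabs_pos (r t)); apply Rabs_eq_0; lra. }
assert (Hphi : is_derive (fun s => (x s - x t) ^ 2 + (y s - y t) ^ 2) t 0).
{ auto_derive; [repeat split; eexists; eassumption|ring]. }
apply is_derive_Reals in Hphi; apply is_derive_Reals; intros eps Heps.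
assert (HK : 0 < Rabs K + 1) by (assert (H := Rabs_pos K); lra).
destruct (Hphi _ (Rdiv_lt_0_compat _ _ Heps HK)) as [d1 H1].
destruct Hr as [d2 H2].
assert (Hd : 0 < Rmin d1 d2) by (apply Rmin_pos; apply cond_pos).
exists (mkposreal _ Hd); intros h Hh Hhd; simpl in Hhd.
assert (H3 := Rmin_l d1 d2); assert (H4 := Rmin_r d1 d2).
specialize (H1 h Hh (Rlt_le_trans _ _ _ Hhd H3)).
assert (Hb : ball t d2 (t + h)).
{ unfold ball; simpl; unfold AbsRing_ball, abs, minus, plus, opp; simpl.
  replace (t + h + - t) with h by ring; exact (Rlt_le_trans _ _ _ Hhd H4). }
specialize (H2 _ Hb).
rewrite H0; rewrite !Rminus_0_r.
set (q := (x (t + h) - x t) ^ 2 + (y (t + h) - y t) ^ 2) in *.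
assert (Hq : 0 <= q) by (apply Rplus_le_le_0_compat; apply pow2_ge_0).
replace ((x t - x t) ^ 2 + (y t - y t) ^ 2) with 0 in H1 by ring.
rewrite !Rminus_0_r in H1.
assert (Hh' : 0 < / Rabs h) by (apply Rinv_0_lt_compat, Rabs_pos_lt, Hh).
unfold Rdiv in *; rewrite Rabs_mult, Rabs_inv in *.
rewrite (Rabs_pos_eq q Hq) in H1.
apply Rle_lt_trans with ((Rabs K + 1) * (q * / Rabs h)).
- rewrite <- Rmult_assoc; apply Rmult_le_compat_r; [lra|].
  assert (H5 := Rle_abs K); nra.
- apply Rmult_lt_compat_l with (1 := HK) in H1.
  replace ((Rabs K + 1) * (eps * / (Rabs K + 1))) with eps in H1 by (field; lra).
  exact H1.
Qed.

Lemma curve_derive_locally (c : R -> C) (t d : R) (v : C) :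
  curve_derive c t v -> 0 < d -> locally t (fun s => Cmod (c s - c t) < d).
Proof.
intros [H1 H2] Hd.
assert (Hx : continuous (fun s => Re (c s)) t)
  by (apply (ex_derive_continuous (fun s => Re (c s))); eexists; eassumption).
assert (Hy : continuous (fun s => Im (c s)) t)
  by (apply (ex_derive_continuous (fun s => Im (c s))); eexists; eassumption).
assert (Hd2 : 0 < d / 2) by lra.
assert (H3 := Hx _ (locally_ball (Re (c t)) (mkposreal _ Hd2))).
assert (H4 := Hy _ (locally_ball (Im (c t)) (mkposreal _ Hd2))).
unfold filtermap in H3, H4.
generalize (filter_and _ _ H3 H4); apply filter_imp; intros s [Hs1 Hs2].
eapply Rle_lt_trans; [apply Cmod_le_Re_Im|].
unfold ball in Hs1, Hs2; simpl in *.
unfold AbsRing_ball, abs, minus, plus, opp in *; simpl in *.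
unfold Re, Im, Rminus in *; simpl; lra.
Qed.

Lemma cdiff_quadratic (f : C -> C) (z l : C) (d K : R) : 0 < d ->
  (forall z', Cmod (z' - z) < d ->
     Cmod (f z' - f z - l * (z' - z)) <= K * Cmod (z' - z) ^ 2) ->
  cdiff f z l.
Proof.
intros Hd Hf c t v E Hv.
pose (r := fun s => (f (c s) - f z - l * (c s - z))%C).
assert (Hloc : locally t (fun s => Cmod (c s - z) < d))
  by (rewrite <- E; apply (curve_derive_locally _ _ _ _ Hv Hd)).
assert (Hr : forall s, Cmod (c s - z) < d ->
  Cmod (r s) <= K * ((Re (c s) - Re (c t)) ^ 2 + (Im (c s) - Im (c t)) ^ 2)).
{ intros s Hs; apply Rle_trans with (1 := Hf _ Hs).
  rewrite Cmod2_alt, <- E; apply Req_le; unfold Re, Im; simpl; ring. }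
assert (Hr0 : curve_derive r t 0).
{ destruct Hv as [H1 H2]; split; simpl.
  - apply (is_derive_quadratic _ (fun s => Re (c s)) (fun s => Im (c s)) t _ _ K H1 H2).
    revert Hloc; apply filter_imp; intros s Hs.
    apply Rle_trans with (2 := Hr _ Hs), (re_le_Cmod (r s)).
  - apply (is_derive_quadratic _ (fun s => Re (c s)) (fun s => Im (c s)) t _ _ K H1 H2).
    revert Hloc; apply filter_imp; intros s Hs.
    apply Rle_trans with (2 := Hr _ Hs), (im_le_Cmod (r s)). }
apply (curve_derive_ext (fun s => (f z - l * z) + l * c s + r s)%C).
{ intros s; unfold r; ring. }
eapply curve_derive_eq.
- apply curve_derive_plus; [apply curve_derive_plus;
    [apply curve_derive_const|apply curve_derive_mult; [apply curve_derive_const|exact Hv]]|exact Hr0].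
- simpl; ring.
Qed.

Lemma curve_derive_0_eq (g : R -> C) (a b : R) : a < b ->
  (forall t, a <= t <= b -> curve_derive g t 0) -> g a = g b.
Proof.
intros Hab H; apply C_eq.
- apply (eq_is_derive (fun s => Re (g s))); [|exact Hab].
  intros t Ht; apply (H t Ht).
- apply (eq_is_derive (fun s => Im (g s))); [|exact Hab].
  intros t Ht; apply (H t Ht).
Qed.

Lemma cdiff_0_segment (f : C -> C) (p q : C) :
  (forall t : R, 0 <= t <= 1 -> cdiff f (p + t * (q - p))%C 0) -> f q = f p.
Proof.
intros H; symmetry.
assert (E := curve_derive_0_eq (fun t : R => f (p + t * (q - p))%C) 0 1 Rlt_0_1).
simpl in E.
replace (p + 0 * (q - p))%C with p in E by ring.
replace (p + 1 * (q - p))%C with q in E by ring.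
apply E; intros t Ht; eapply curve_derive_eq;
  [apply (H t Ht (fun t : R => p + t * (q - p))%C t (q - p)%C)|ring].
- reflexivity.
- apply curve_derive_line.
Qed.

(** * Complex series *)

Lemma filterlim_C {T : Type} (F : (T -> Prop) -> Prop) {FF : Filter F} (f : T -> C) (l : C) :
  filterlim f F (@locally C_UniformSpace l) <->
  filterlim (fun x => Re (f x)) F (locally (Re l)) /\
  filterlim (fun x => Im (f x)) F (locally (Im l)).
Proof.
split.
- intros H; split; intros P [eps HP];
    refine (filter_imp _ _ _ (H _ (locally_ball l eps)));
    intros x [H1 H2]; apply HP; first [exact H1|exact H2].
- intros [H1 H2] P [eps HP].
  assert (H3 := H1 _ (locally_ball (Re l) eps)).
  assert (H4 := H2 _ (locally_ball (Im l) eps)).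
  unfold filtermap in *; generalize (filter_and _ _ H3 H4); clear H3 H4.
  apply filter_imp; intros x [H3 H4]; apply HP; split; [exact H3|exact H4].
Qed.

Definition csum (u : nat -> C) (l : C) : Prop :=
  is_series (fun n => Re (u n)) (Re l) /\ is_series (fun n => Im (u n)) (Im l).

Lemma Re_Im_sum_n (u : nat -> C) (n : nat) :
  Re (@sum_n C_AbsRing u n) = sum_n (fun k => Re (u k)) n /\
  Im (@sum_n C_AbsRing u n) = sum_n (fun k => Im (u k)) n.
Proof.
induction n as [|n [IH1 IH2]]; [now rewrite !sum_O|].
rewrite !sum_Sn, <- IH1, <- IH2; split; reflexivity.
Qed.

Lemma csum_is_series (u : nat -> C) (l : C) :
  csum u l <-> @is_series C_AbsRing C_NormedModule u l.
Proof.
unfold csum, is_series; split.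
- intros [H1 H2]; apply (filterlim_C eventually); split.
  + refine (filterlim_ext _ _ _ H1); intros n; symmetry; apply (Re_Im_sum_n u n).
  + refine (filterlim_ext _ _ _ H2); intros n; symmetry; apply (Re_Im_sum_n u n).
- intros H; apply (filterlim_C eventually) in H; destruct H as [H1 H2]; split.
  + refine (filterlim_ext _ _ _ H1); intros n; apply (Re_Im_sum_n u n).
  + refine (filterlim_ext _ _ _ H2); intros n; apply (Re_Im_sum_n u n).
Qed.

Lemma csum_unique (u : nat -> C) (l m : C) : csum u l -> csum u m -> l = m.
Proof.
intros [H1 H2] [H3 H4]; apply C_eq.
- now rewrite <- (is_series_unique _ _ H1), <- (is_series_unique _ _ H3).
- now rewrite <- (is_series_unique _ _ H2), <- (is_series_unique _ _ H4).
Qed.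

Lemma csum_CSeries (u : nat -> C) (l : C) : csum u l -> CSeries u = l.
Proof.
intros [H1 H2]; apply C_eq; simpl; now apply is_series_unique.
Qed.

Lemma csum_ext (u v : nat -> C) (l : C) : (forall n, u n = v n) -> csum u l -> csum v l.
Proof.
intros H [H1 H2]; split; [refine (is_series_ext _ _ _ _ H1)|refine (is_series_ext _ _ _ _ H2)];
  intros n; now rewrite H.
Qed.

Lemma csum_plus (u v : nat -> C) (l m : C) :
  csum u l -> csum v m -> csum (fun n => u n + v n)%C (l + m)%C.
Proof.
intros [H1 H2] [H3 H4]; split.
- apply (is_series_plus _ _ _ _ H1 H3).
- apply (is_series_plus _ _ _ _ H2 H4).
Qed.

Lemma csum_scal (c : C) (u : nat -> C) (l : C) :
  csum u l -> csum (fun n => c * u n)%C (c * l)%C.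
Proof.
intros [H1 H2]; split.
- apply (is_series_minus _ _ _ _ (is_series_scal (Re c) _ _ H1) (is_series_scal (Im c) _ _ H2)).
- apply (is_series_plus _ _ _ _ (is_series_scal (Re c) _ _ H2) (is_series_scal (Im c) _ _ H1)).
Qed.

Lemma csum_minus (u v : nat -> C) (l m : C) :
  csum u l -> csum v m -> csum (fun n => u n - v n)%C (l - m)%C.
Proof.
intros Hu Hv.
replace (l - m)%C with (l + - (1) * m)%C by ring.
apply (csum_ext (fun n => u n + - (1) * v n)%C); [intros n; ring|].
apply csum_plus, csum_scal; assumption.
Qed.

Lemma csum_RtoC (u : nat -> R) (l : R) : is_series u l -> csum (fun n => RtoC (u n)) l.
Proof.
intros H; split; [exact H|].
apply (is_series_ext (fun n => scal 0 (u n))); [intros n; apply Rmult_0_l|].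
evar_last; [apply (is_series_scal 0 u l H)|apply Rmult_0_l].
Qed.

Lemma is_series_le_bound (u b : nat -> R) (l B : R) :
  (forall n, Rabs (u n) <= b n) -> is_series b B -> is_series u l -> Rabs l <= B.
Proof.
intros H Hb Hu.
rewrite <- (is_series_unique _ _ Hb), <- (is_series_unique _ _ Hu).
assert (Ha : ex_series (fun n => Rabs (u n))).
{ apply (ex_series_le (K := R_AbsRing) (V := R_CompleteNormedModule) _ b).
  - intros n; unfold norm; simpl; unfold abs; simpl; rewrite Rabs_Rabsolu; apply H.
  - now exists B. }
eapply Rle_trans; [apply Series_Rabs, Ha|].
apply Series_le; [|now exists B].
intros n; split; [apply Rabs_pos|apply H].
Qed.

Lemma csum_bound (u : nat -> C) (b : nat -> R) (l : C) (B : R) :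
  (forall n, Cmod (u n) <= b n) -> is_series b B -> csum u l -> Cmod l <= 2 * B.
Proof.
intros H Hb [H1 H2].
assert (H3 := is_series_le_bound _ _ _ _
  (fun n => Rle_trans _ _ _ (re_le_Cmod (u n)) (H n)) Hb H1).
assert (H4 := is_series_le_bound _ _ _ _
  (fun n => Rle_trans _ _ _ (im_le_Cmod (u n)) (H n)) Hb H2).
assert (H5 := Cmod_le_Re_Im l); lra.
Qed.

Lemma csum_dominated (u : nat -> C) (b : nat -> R) :
  (forall n, Cmod (u n) <= b n) -> ex_series b -> csum u (CSeries u).
Proof.
intros H Hb; split; apply Series_correct;
  apply (ex_series_le (K := R_AbsRing) (V := R_CompleteNormedModule) _ b); auto;
  intros n; refine (Rle_trans _ _ _ _ (H n)); [apply (re_le_Cmod (u n))|apply (im_le_Cmod (u n))].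
Qed.

(** * Power series in the unit disc *)

Lemma ex_series_square_geom (r : R) : 0 < r < 1 -> ex_series (fun n => INR n ^ 2 * r ^ n).
Proof.
intros Hr.
pose (x := (1 - r) / 8); assert (Hx : 0 < x < 1 / 8) by (unfold x; lra).
pose (t := / (1 + x)).
assert (Ht : 0 < t < 1).
{ unfold t; split; [apply Rinv_0_lt_compat; lra|].
  rewrite <- Rinv_1; apply Rinv_lt_contravar; lra. }
(* [x] is small enough for [r <= t ^ 3]; one factor [t ^ n] is kept, and Bernoulli's
   inequality [n x <= (1 + x) ^ n] absorbs each factor [n] into one of the others *)
assert (Hrt : r <= t ^ 3).
{ unfold t; rewrite pow_inv.
  apply (Rmult_le_reg_r ((1 + x) ^ 3)); [apply pow_lt; lra|].
  rewrite Rinv_l by (apply pow_nonzero; lra).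
  replace r with (1 - 8 * x) by (unfold x; field).
  assert (0 <= x * x) by nra; assert (0 <= x * x * x) by nra.
  assert (0 <= x * (1 - 8 * x)) by nra; nra. }
assert (Hn : forall n, INR n * t ^ n <= / x).
{ intros n; unfold t; rewrite pow_inv.
  assert (H : 0 < (1 + x) ^ n) by (apply pow_lt; lra).
  assert (HB := poly n x (proj1 Hx)).
  apply (Rmult_le_reg_r ((1 + x) ^ n * x)); [nra|].
  replace (INR n * / (1 + x) ^ n * ((1 + x) ^ n * x)) with (INR n * x) by (field; lra).
  replace (/ x * ((1 + x) ^ n * x)) with ((1 + x) ^ n) by (field; lra).
  lra. }
apply (ex_series_le (K := R_AbsRing) (V := R_CompleteNormedModule) _
  (fun n => (/ x) ^ 2 * t ^ n)).
- intros n; unfold norm; simpl norm; unfold abs; simpl abs.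
  assert (H0 : 0 <= INR n) by apply pos_INR.
  assert (H1 : 0 < t ^ n) by (apply pow_lt; lra).
  assert (H2 : 0 <= r ^ n <= (t ^ 3) ^ n)
    by (split; [apply pow_le; lra|apply pow_incr; lra]).
  rewrite Rabs_pos_eq by (apply Rmult_le_pos; [nra|lra]).
  apply Rle_trans with ((INR n * t ^ n) ^ 2 * t ^ n).
  + replace ((t ^ 3) ^ n) with (t ^ n * t ^ n * t ^ n) in H2
      by (rewrite <- !Rpow_mult_distr; f_equal; ring).
    replace ((INR n * t ^ n) ^ 2 * t ^ n) with (INR n ^ 2 * (t ^ n * t ^ n * t ^ n)) by ring.
    apply Rmult_le_compat_l; [nra|lra].
  + apply Rmult_le_compat_r; [lra|]; apply pow_incr; split; [nra|apply Hn].
- apply (ex_series_scal (K := R_AbsRing) (V := R_NormedModule)).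
  apply ex_series_geom; rewrite Rabs_pos_eq; lra.
Qed.

Lemma Cpow_taylor_bound (z z0 : C) (r : R) (n : nat) : 0 < r < 1 ->
  Cmod z <= r -> Cmod z0 <= r ->
  r ^ 2 * Cmod (z ^ n - z0 ^ n - INR n * z0 ^ pred n * (z - z0))
    <= INR n ^ 2 * r ^ n * Cmod (z - z0) ^ 2.
Proof.
intros Hr Hz Hz0.
assert (Hd := Cmod_ge_0 (z - z0)); set (d := Cmod (z - z0)) in *.
induction n as [|n IH].
{ simpl pred; simpl (INR 0); simpl Cpow.
  replace (1 - 1 - 0 * 1 * (z - z0))%C with (RtoC 0) by ring.
  rewrite Cmod_0; nra. }
set (e := (z ^ n - z0 ^ n - INR n * z0 ^ pred n * (z - z0))%C) in *.
replace (z ^ S n - z0 ^ S n - INR (S n) * z0 ^ pred (S n) * (z - z0))%C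
  with (z * e + INR n * z0 ^ pred n * ((z - z0) * (z - z0)))%C.
2:{ unfold e; rewrite S_INR, RtoC_plus; simpl pred; rewrite !Cpow_S.
    destruct n; [simpl; ring|simpl pred; rewrite !Cpow_S; ring]. }
assert (Hrn : 0 < r ^ n) by (apply pow_lt; lra).
assert (Hn := pos_INR n).
apply Rle_trans with (r ^ 2 * (r * Cmod e + INR n * Cmod z0 ^ pred n * (d * d))).
{ apply Rmult_le_compat_l; [nra|].
  eapply Rle_trans; [apply Cmod_triangle|].
  rewrite !Cmod_mult, Cmod_pow, (Cmod_R_pos (INR n)) by exact Hn.
  fold d; apply Rplus_le_compat_r, Rmult_le_compat_r; [apply Cmod_ge_0|exact Hz]. }
assert (Hp : r ^ 2 * (INR n * Cmod z0 ^ pred n) <= INR n * r ^ S n).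
{ destruct n as [|n]; [simpl; nra|].
  replace (INR (S n) * r ^ S (S n)) with (r ^ 2 * (INR (S n) * r ^ n)) by (simpl; ring).
  simpl pred; apply Rmult_le_compat_l; [nra|].
  apply Rmult_le_compat_l; [exact Hn|].
  apply pow_incr; split; [apply Cmod_ge_0|exact Hz0]. }
rewrite S_INR; simpl (r ^ S n) in *.
assert (Hd2 : 0 <= d * d) by nra.
apply Rle_trans with (r * (INR n ^ 2 * r ^ n * d ^ 2) + INR n * (r * r ^ n) * (d * d)).
{ apply (Rmult_le_compat_l r) in IH; [|lra].
  apply (Rmult_le_compat_r (d * d)) in Hp; [|exact Hd2]; nra. }
assert (0 <= r * r ^ n * (d * d)) by (apply Rmult_le_pos; nra).
nra.
Qed.

Definition power_sum (a : nat -> C) (z : C) : C := CSeries (fun n => a n * z ^ n)%C.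

Definition power_sum_derive (a : nat -> C) (z : C) : C :=
  CSeries (fun n => a n * (INR n * z ^ pred n))%C.

Lemma csum_power_sum (a : nat -> C) (z : C) : (forall n, Cmod (a n) <= 1) ->
  Cmod z < 1 -> csum (fun n => a n * z ^ n)%C (power_sum a z).
Proof.
intros Ha Hz; apply (csum_dominated _ (fun n => Cmod z ^ n)).
- intros n; rewrite Cmod_mult, Cmod_pow.
  rewrite <- (Rmult_1_l (Cmod z ^ n)) at 2.
  apply Rmult_le_compat_r; [apply pow_le, Cmod_ge_0|apply Ha].
- apply ex_series_geom; rewrite Rabs_pos_eq; [exact Hz|apply Cmod_ge_0].
Qed.

Lemma csum_power_sum_derive (a : nat -> C) (z : C) : (forall n, Cmod (a n) <= 1) ->
  Cmod z < 1 -> csum (fun n => a n * (INR n * z ^ pred n))%C (power_sum_derive a z).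
Proof.
intros Ha Hz; assert (Hz0 := Cmod_ge_0 z).
pose (r := (1 + Cmod z) / 2); assert (Hr : 0 < r < 1) by (unfold r; lra).
apply (csum_dominated _ (fun n => / r * (INR n ^ 2 * r ^ n))).
- intros n; rewrite !Cmod_mult, Cmod_pow, (Cmod_R_pos (INR n)) by apply pos_INR.
  assert (Hn := pos_INR n).
  apply Rle_trans with (1 * (INR n * Cmod z ^ pred n)).
  { apply Rmult_le_compat_r; [|apply Ha].
    apply Rmult_le_pos; [exact Hn|apply pow_le, Hz0]. }
  destruct n as [|n]; [simpl; lra|]; simpl pred.
  replace (/ r * (INR (S n) ^ 2 * r ^ S n)) with (INR (S n) * INR (S n) * r ^ n)
    by (simpl; field; lra).
  assert (H1 : 1 <= INR (S n)) by (rewrite S_INR; assert (H := pos_INR n); lra).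
  assert (H2 : 0 <= Cmod z ^ n <= r ^ n).
  { split; [apply pow_le, Hz0|apply pow_incr; unfold r; lra]. }
  rewrite Rmult_1_l; apply Rmult_le_compat; nra.
- apply (ex_series_scal (K := R_AbsRing) (V := R_NormedModule)), ex_series_square_geom, Hr.
Qed.

Lemma cdiff_power_sum (a : nat -> C) (z : C) : (forall n, Cmod (a n) <= 1) ->
  Cmod z < 1 -> cdiff (power_sum a) z (power_sum_derive a z).
Proof.
intros Ha Hz; assert (Hz0 := Cmod_ge_0 z).
pose (r := (1 + Cmod z) / 2); assert (Hr : 0 < r < 1) by (unfold r; lra).
destruct (ex_series_square_geom r Hr) as [B HB].
apply (cdiff_quadratic _ _ _ (r - Cmod z) (2 * (/ r ^ 2 * B))); [unfold r; lra|].
intros z' Hz'.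
assert (Hz'r : Cmod z' <= r) by (assert (H := Cmod_minus_ge z' z); lra).
rewrite Rmult_assoc; apply (csum_bound
  (fun n => a n * (z' ^ n - z ^ n - INR n * z ^ pred n * (z' - z)))%C
  (fun n => (/ r ^ 2 * Cmod (z' - z) ^ 2) * (INR n ^ 2 * r ^ n))).
- intros n; rewrite Cmod_mult.
  assert (H := Cpow_taylor_bound z' z r n Hr Hz'r ltac:(unfold r; lra)).
  assert (Hr2 : 0 < r ^ 2) by (apply pow_lt; lra).
  apply Rle_trans with (1 * Cmod (z' ^ n - z ^ n - INR n * z ^ pred n * (z' - z))).
  { apply Rmult_le_compat_r; [apply Cmod_ge_0|apply Ha]. }
  apply (Rmult_le_reg_l (r ^ 2) _ _ Hr2); rewrite Rmult_1_l.
  apply Rle_trans with (1 := H); apply Req_le; field; lra.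
- replace (/ r ^ 2 * B * Cmod (z' - z) ^ 2) with (/ r ^ 2 * Cmod (z' - z) ^ 2 * B) by ring.
  apply (is_series_scal (/ r ^ 2 * Cmod (z' - z) ^ 2) (fun n => INR n ^ 2 * r ^ n) B HB).
- apply (csum_ext (fun n => a n * z' ^ n - a n * z ^ n
      - (z' - z) * (a n * (INR n * z ^ pred n)))%C); [intros n; ring|].
  replace (power_sum_derive a z * (z' - z))%C with ((z' - z) * power_sum_derive a z)%C by ring.
  apply csum_minus; [apply csum_minus; apply csum_power_sum; try assumption; lra|].
  apply csum_scal, csum_power_sum_derive; assumption.
Qed.

Lemma is_series_finite (b : nat -> R) (N : nat) :
  is_series (fun n => if Nat.leb n N then b n else 0) (sum_n b N).
Proof.
assert (H1 : forall n, (n <= N)%nat ->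
  sum_n (fun n => if Nat.leb n N then b n else 0) n = sum_n b n).
{ intros n Hn; apply sum_n_ext_loc; intros k Hk.
  destruct (Nat.leb_spec k N); [reflexivity|lia]. }
unfold is_series.
apply (filterlim_ext_loc (fun _ => sum_n b N)); [|apply filterlim_const].
exists N; intros n Hn; induction Hn as [|n Hn IH]; [symmetry; apply H1; lia|].
rewrite sum_Sn, <- IH.
destruct (Nat.leb_spec (S n) N); [lia|exact (eq_sym (Rplus_0_r _))].
Qed.

Lemma Cmod_Cpow_minus_le (z w : C) (n : nat) : Cmod z <= 1 -> Cmod w <= 1 ->
  Cmod (z ^ n - w ^ n) <= INR n * Cmod (z - w).
Proof.
intros Hz Hw; induction n as [|n IH].
{ simpl; replace (1 - 1)%C with (RtoC 0) by ring; rewrite Cmod_0; lra. }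
replace (z ^ S n - w ^ S n)%C with (z * (z ^ n - w ^ n) + w ^ n * (z - w))%C
  by (rewrite !Cpow_S; ring).
eapply Rle_trans; [apply Cmod_triangle|]; rewrite !Cmod_mult, Cmod_pow, S_INR.
assert (H1 := Cmod_ge_0 (z ^ n - w ^ n)); assert (H2 := Cmod_ge_0 (z - w)).
assert (H3 : 0 <= Cmod w ^ n <= 1).
{ split; [apply pow_le, Cmod_ge_0|].
  rewrite <- (pow1 n); apply pow_incr; split; [apply Cmod_ge_0|exact Hw]. }
assert (H4 := Cmod_ge_0 z); nra.
Qed.

Lemma csum_power_sum_closed (a : nat -> C) (z : C) :
  ex_series (fun n => Cmod (a n)) -> Cmod z <= 1 ->
  csum (fun n => a n * z ^ n)%C (power_sum a z).
Proof.
intros Ha Hz; apply (csum_dominated _ (fun n => Cmod (a n))); [|exact Ha].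
intros n; rewrite Cmod_mult, Cmod_pow.
assert (H : Cmod z ^ n <= 1)
  by (rewrite <- (pow1 n); apply pow_incr; split; [apply Cmod_ge_0|exact Hz]).
assert (H1 := Cmod_ge_0 (a n)); nra.
Qed.

Lemma power_sum_uniformly_continuous (a : nat -> C) (eps : R) :
  ex_series (fun n => Cmod (a n)) -> 0 < eps ->
  exists d, 0 < d /\ forall z w, Cmod z <= 1 -> Cmod w <= 1 -> Cmod (z - w) < d ->
    Cmod (power_sum a z - power_sum a w) < eps.
Proof.
intros [A HA] Heps.
pose (b := fun n => Cmod (a n)); change (is_series b A) in HA.
assert (HA0 : 0 <= A).
{ rewrite <- (is_series_unique _ _ HA).
  replace 0 with (Series (fun _ => 0 * 0)) by (rewrite Series_scal_l; apply Rmult_0_l).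
  apply Series_le; [|now exists A].
  intros n; rewrite Rmult_0_l; split; [lra|apply Cmod_ge_0]. }
assert (Heps8 : 0 < eps / 8) by lra.
destruct (HA _ (locally_ball A (mkposreal _ Heps8))) as [N HN].
specialize (HN N (le_n N)).
unfold ball in HN; simpl in HN; unfold AbsRing_ball, abs, minus, plus, opp in HN; simpl in HN.
apply Rabs_def2, proj2 in HN; change (- (eps / 8) < sum_n b N + - A) in HN.
pose (d := eps / (4 * (INR N * A + 1))).
assert (HN0 := pos_INR N).
assert (HNA : 0 <= INR N * A) by now apply Rmult_le_pos.
assert (Hd : 0 < d) by (unfold d; apply Rdiv_lt_0_compat; lra).
exists d; split; [exact Hd|]; intros z w Hz Hw Hzw.
assert (HB : 2 * (INR N * d * A + 2 * (A - sum_n b N)) < eps).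
{ assert (INR N * d * A < eps / 4); [|lra].
  replace (eps / 4) with (d * (INR N * A + 1)) by (unfold d; field; lra).
  nra. }
refine (Rle_lt_trans _ _ _ (csum_bound (fun n => a n * z ^ n - a n * w ^ n)%C
  (fun n => INR N * d * b n + 2 * (b n - if Nat.leb n N then b n else 0)) _ _ _ _ _) HB).
- intros n; replace (a n * z ^ n - a n * w ^ n)%C with (a n * (z ^ n - w ^ n))%C by ring.
  rewrite Cmod_mult; fold (b n).
  assert (H0 : 0 <= b n) by apply Cmod_ge_0.
  destruct (Nat.leb_spec n N) as [Hn|Hn].
  + assert (H1 := Cmod_Cpow_minus_le z w n Hz Hw).
    assert (H2 : INR n * Cmod (z - w) <= INR N * d).
    { apply Rmult_le_compat; [apply pos_INR|apply Cmod_ge_0|now apply le_INR|lra]. }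
    nra.
  + assert (H1 : Cmod (z ^ n - w ^ n) <= 2).
    { eapply Rle_trans; [apply Cmod_minus_le|]; rewrite !Cmod_pow.
      assert (forall x, Cmod x <= 1 -> Cmod x ^ n <= 1)
        by (intros x Hx; rewrite <- (pow1 n); apply pow_incr; split; [apply Cmod_ge_0|exact Hx]).
      assert (H1 := H z Hz); assert (H2 := H w Hw); lra. }
    assert (0 <= INR N * d * b n) by (apply Rmult_le_pos; [apply Rmult_le_pos; [lra|exact (Rlt_le _ _ Hd)]|lra]); nra.
- apply (is_series_plus (K := R_AbsRing) (V := R_NormedModule)).
  + apply (is_series_scal (K := R_AbsRing) (V := R_NormedModule) (INR N * d) b A HA).
  + apply (is_series_scal (K := R_AbsRing) (V := R_NormedModule) 2).
    apply (is_series_minus (K := R_AbsRing) (V := R_NormedModule)); [exact HA|apply is_series_finite].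
- apply csum_minus; apply csum_power_sum_closed; auto; now exists A.
Qed.

Lemma csum_shift (u : nat -> C) (l : C) : csum u l -> csum (fun n => u (S n)) (l - u O)%C.
Proof.
intros [H1 H2]; split.
- apply (is_series_incr_1 (fun n => Re (u n))).
  replace (plus _ _) with (Re l); [exact H1|].
  unfold plus; simpl; unfold Re; ring.
- apply (is_series_incr_1 (fun n => Im (u n))).
  replace (plus _ _) with (Im l); [exact H2|].
  unfold plus; simpl; unfold Im; ring.
Qed.

Lemma csum_euler (a : nat -> C) (y : C) : (forall n, Cmod (a n) <= 1) -> Cmod y < 1 ->
  csum (fun n => INR n * a n * y ^ n)%C (y * power_sum_derive a y).
Proof.
intros Ha Hy.
refine (csum_ext _ _ _ _ (csum_scal y _ _ (csum_power_sum_derive a y Ha Hy))).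
intros [|n]; [simpl; ring|]; simpl pred; rewrite Cpow_S; ring.
Qed.

(** * The odd harmonic numbers *)

Definition odd_inv (n : nat) : C := / INR (2 * n + 1).
Definition harm1 (n : nat) : C := (h (n + 1) / INR (n + 1))%C.
Definition harm2 (n : nat) : C := (h (n + 1) / INR (n + 1) ^ 2)%C.

Lemma INR_neq_0_C (n : nat) : RtoC (INR (n + 1)) <> 0.
Proof. intros E; apply RtoC_inj in E; revert E; apply not_0_INR; lia. Qed.

Lemma h_1 : h 1 = 1.
Proof. unfold h; simpl; field. Qed.

Lemma h_S (n : nat) : h (S n + 1) = h (n + 1) + / INR (2 * S n + 1).
Proof.
unfold h; replace (S n + 1 - 1)%nat with (S n) by lia.
replace (n + 1 - 1)%nat with n by lia.
rewrite tech5; unfold Rdiv; now rewrite Rmult_1_l.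
Qed.

Lemma h_bounds (n : nat) : 0 < h (n + 1) <= INR (n + 1).
Proof.
induction n as [|n IH]; [simpl (0 + 1)%nat; rewrite h_1; simpl; lra|].
rewrite h_S.
assert (H : 0 < / INR (2 * S n + 1) <= 1).
{ assert (H : 1 <= INR (2 * S n + 1)) by (apply (le_INR 1); lia).
  split; [apply Rinv_0_lt_compat; lra|].
  rewrite <- Rinv_1; apply Rinv_le_contravar; lra. }
replace (INR (S n + 1)) with (INR (n + 1) + 1) by (rewrite !plus_INR, (S_INR n); simpl; ring).
lra.
Qed.

Lemma Cmod_odd_inv (n : nat) : Cmod (odd_inv n) <= 1.
Proof.
unfold odd_inv.
assert (H : 1 <= INR (2 * n + 1)) by (apply (le_INR 1); lia).
rewrite <- RtoC_inv, Cmod_R_pos by (try apply Rlt_le, Rinv_0_lt_compat; lra).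
rewrite <- Rinv_1; apply Rinv_le_contravar; lra.
Qed.

Lemma harm1_RtoC (n : nat) : harm1 n = RtoC (h (n + 1) / INR (n + 1)).
Proof.
unfold harm1; rewrite RtoC_div; [reflexivity|apply not_0_INR; lia].
Qed.

Lemma harm2_RtoC (n : nat) : harm2 n = RtoC (h (n + 1) / INR (n + 1) ^ 2).
Proof.
unfold harm2; rewrite RtoC_div, RtoC_pow; [reflexivity|].
apply pow_nonzero, not_0_INR; lia.
Qed.

Lemma Cmod_harm1 (n : nat) : Cmod (harm1 n) <= 1.
Proof.
rewrite harm1_RtoC; assert (H := h_bounds n).
rewrite Cmod_R_pos by (apply Rlt_le, Rdiv_lt_0_compat; lra).
apply (Rmult_le_reg_r (INR (n + 1))); [lra|].
unfold Rdiv; rewrite Rmult_assoc, Rinv_l; lra.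
Qed.

Lemma Cmod_harm2 (n : nat) : Cmod (harm2 n) <= 1.
Proof.
replace (harm2 n) with (harm1 n * / INR (n + 1))%C
  by (unfold harm1, harm2; field; apply INR_neq_0_C).
assert (H : 1 <= INR (n + 1)) by (apply (le_INR 1); lia).
rewrite Cmod_mult, <- RtoC_inv, (Cmod_R_pos (/ _))
  by (try apply Rlt_le, Rinv_0_lt_compat; lra).
assert (H1 := Cmod_harm1 n); assert (H2 := Cmod_ge_0 (harm1 n)).
assert (H3 : 0 < / INR (n + 1) <= 1).
{ split; [apply Rinv_0_lt_compat; lra|].
  rewrite <- Rinv_1; apply Rinv_le_contravar; lra. }
nra.
Qed.

(* Telescoping: [h n / n ^ 2] is at most twice the decrement of [(h n + 1 / 2) / n]. *)
Lemma sum_harm2_le (n : nat) :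
  sum_n (fun k => Cmod (harm2 k)) n + 2 * ((h (S n + 1) + / 2) / INR (S n + 1)) <= 3.
Proof.
assert (Hstep : forall n, Cmod (harm2 n) + 2 * ((h (S n + 1) + / 2) / INR (S n + 1))
  <= 2 * ((h (n + 1) + / 2) / INR (n + 1))).
{ clear n; intros n; rewrite harm2_RtoC, h_S.
  assert (H0 := h_bounds n); assert (H1 : 1 <= INR (n + 1)) by (apply (le_INR 1); lia).
  replace (INR (S n + 1)) with (INR (n + 1) + 1) by (rewrite !plus_INR, (S_INR n); simpl; ring).
  replace (INR (2 * S n + 1)) with (2 * INR (n + 1) + 1)
    by (rewrite !plus_INR, mult_INR, (S_INR n); simpl; ring).
  set (x := INR (n + 1)) in *; set (y := h (n + 1)) in *.
  assert (Hx2 : 0 < x ^ 2) by (apply pow_lt; lra).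
  rewrite Cmod_R_pos by (apply Rlt_le, Rdiv_lt_0_compat; lra).
  apply Rminus_le_0.
  replace (_ - _) with (((2 * x + 1) * (x - 1) * y + x) / (x ^ 2 * (x + 1) * (2 * x + 1)))
    by (field; lra).
  assert (0 <= (2 * x + 1) * (x - 1) * y) by (apply Rmult_le_pos; [nra|lra]).
  apply Rlt_le, Rdiv_lt_0_compat; [lra|repeat apply Rmult_lt_0_compat; lra]. }
induction n as [|n IH].
- rewrite sum_O; apply Rle_trans with (1 := Hstep 0%nat); simpl (0 + 1)%nat.
  rewrite h_1; simpl; lra.
- rewrite sum_Sn; specialize (Hstep (S n)).
  match goal with |- context [plus ?a ?b] => change (plus a b) with (a + b) end; lra.
Qed.

Lemma ex_series_bounded (a : nat -> R) (M : R) :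
  (forall n, 0 <= a n) -> (forall n, sum_n a n <= M) -> ex_series a.
Proof.
intros Ha HM.
destruct (ex_finite_lim_seq_incr (sum_n a) M) as [l Hl]; auto.
- intros n; rewrite sum_Sn.
  match goal with |- context [plus ?a ?b] => change (plus a b) with (a + b) end.
  specialize (Ha (S n)); lra.
- now exists l.
Qed.

Lemma ex_series_harm2 : ex_series (fun n => Cmod (harm2 n)).
Proof.
apply (ex_series_bounded _ 3); [intros n; apply Cmod_ge_0|].
intros n; assert (H := sum_harm2_le n); assert (H0 := h_bounds (S n)).
assert (0 < (h (S n + 1) + / 2) / INR (S n + 1)) by (apply Rdiv_lt_0_compat; lra).
lra.
Qed.

Lemma h_ge_1 (n : nat) : 1 <= h (n + 1).
Proof.
induction n as [|n IH]; [simpl (0 + 1)%nat; rewrite h_1; lra|].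
rewrite h_S; assert (0 < / INR (2 * S n + 1))
  by (apply Rinv_0_lt_compat, lt_0_INR; lia); lra.
Qed.

Lemma ex_series_inv_square : ex_series (fun n => / INR (n + 1) ^ 2).
Proof.
apply (ex_series_le (K := R_AbsRing) (V := R_CompleteNormedModule) _
  (fun n => Cmod (harm2 n))); [|exact ex_series_harm2].
intros n; assert (H := h_ge_1 n).
assert (Hn : 0 < INR (n + 1)) by (apply lt_0_INR; lia).
assert (Hi : 0 < / INR (n + 1) ^ 2) by (apply Rinv_0_lt_compat, pow_lt, Hn).
unfold norm; simpl norm; unfold abs; simpl abs.
rewrite harm2_RtoC, Cmod_R_pos; unfold Rdiv; rewrite ?Rabs_pos_eq; nra.
Qed.

Lemma cdiff_div (f g : C -> C) (z l m : C) : g z <> 0 ->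
  cdiff f z l -> cdiff g z m ->
  cdiff (fun z => f z / g z)%C z ((l * g z - f z * m) / (g z * g z))%C.
Proof.
intros Hz Hf Hg; eapply cdiff_eq; [apply cdiff_mult; [exact Hf|apply cdiff_inv; eassumption]|].
cbv beta; field; exact Hz.
Qed.

Lemma Cmod_sqr_lt_1 (z : C) : Cmod z < 1 -> Cmod (z * z) < 1.
Proof.
intros Hz; rewrite Cmod_mult; assert (H := Cmod_ge_0 z); nra.
Qed.

Lemma Cminus_1_neq_0 (z : C) : Cmod z < 1 -> (1 - z)%C <> 0.
Proof.
intros Hz E; assert (z = 1) by (replace z with (1 - (1 - z))%C by ring; rewrite E; ring).
subst z; rewrite Cmod_1 in Hz; lra.
Qed.

Lemma Cplus_1_neq_0 (z : C) : Cmod z < 1 -> (1 + z)%C <> 0.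
Proof.
intros Hz; replace (1 + z)%C with (1 - - z)%C by ring.
apply Cminus_1_neq_0; now rewrite Cmod_opp.
Qed.

Definition arctanh (z : C) : C := (z * power_sum odd_inv (z * z))%C.
Definition ramanujan_sum (z : C) : C := (z * z * power_sum harm2 (z * z))%C.

Lemma cdiff_power_sum_sqr (a : nat -> C) (z : C) : (forall n, Cmod (a n) <= 1) ->
  Cmod z < 1 ->
  cdiff (fun z => power_sum a (z * z)) z (power_sum_derive a (z * z) * (2 * z))%C.
Proof.
intros Ha Hz; eapply cdiff_eq.
- apply (cdiff_comp (power_sum a) (fun z => z * z)%C).
  + apply cdiff_power_sum; [exact Ha|apply Cmod_sqr_lt_1, Hz].
  + apply cdiff_mult; apply cdiff_id.
- cbv beta; ring.
Qed.

Lemma power_sum_odd_inv_ode (y : C) : Cmod y < 1 ->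
  ((power_sum odd_inv y + 2 * (y * power_sum_derive odd_inv y)) * (1 - y) = 1)%C.
Proof.
intros Hy.
assert (H1 := csum_plus _ _ _ _ (csum_power_sum _ y Cmod_odd_inv Hy)
  (csum_scal 2 _ _ (csum_euler _ y Cmod_odd_inv Hy))).
set (l := (_ + _)%C) in *.
assert (H2 : csum (fun n => y ^ n)%C l).
{ refine (csum_ext _ _ _ _ H1); intros n; unfold odd_inv.
  replace (RtoC (INR (2 * n + 1))) with (2 * INR n + 1)%C
    by (rewrite plus_INR, mult_INR, RtoC_plus, RtoC_mult; reflexivity).
  field; intros E.
  assert (E' : RtoC (2 * INR n + 1) = 0) by (rewrite RtoC_plus, RtoC_mult; exact E).
  apply RtoC_inj in E'; assert (H := pos_INR n); lra. }
assert (H3 := csum_shift _ _ H2); simpl Cpow in H3.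
assert (H4 := csum_unique _ _ _ (csum_scal y _ _ H2) H3).
replace (l * (1 - y))%C with (l - y * l)%C by ring; rewrite H4; ring.
Qed.

Lemma power_sum_harm1_ode (y : C) : Cmod y < 1 ->
  ((power_sum harm1 y + y * power_sum_derive harm1 y) * (1 - y) = power_sum odd_inv y)%C.
Proof.
intros Hy.
assert (H1 := csum_plus _ _ _ _ (csum_power_sum _ y Cmod_harm1 Hy)
  (csum_euler _ y Cmod_harm1 Hy)).
set (l := (_ + _)%C) in *.
assert (H2 : csum (fun n => h (n + 1) * y ^ n)%C l).
{ refine (csum_ext _ _ _ _ H1); intros n; unfold harm1.
  replace (RtoC (INR n)) with (INR (n + 1) - 1)%C
    by (rewrite plus_INR, RtoC_plus; simpl; ring).
  field; apply INR_neq_0_C. }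
assert (H3 := csum_minus _ _ _ _ (csum_shift _ _ H2) (csum_scal y _ _ H2)).
assert (H4 := csum_shift _ _ (csum_power_sum _ y Cmod_odd_inv Hy)).
assert (H5 : csum (fun n => odd_inv (S n) * y ^ S n)%C
  (l - h (0 + 1) * y ^ 0 - y * l)%C).
{ refine (csum_ext _ _ _ _ H3); intros n; rewrite h_S, RtoC_plus, RtoC_inv, Cpow_S.
  - unfold odd_inv; ring.
  - apply not_0_INR; lia. }
assert (E := csum_unique _ _ _ H5 H4).
simpl (0 + 1)%nat in E; rewrite h_1 in E.
replace (odd_inv 0) with (RtoC 1) in E by (unfold odd_inv; simpl; field; exact C1_nz).
simpl Cpow in E.
replace (l * (1 - y))%C with (l - 1 * 1 - y * l + 1)%C by ring.
rewrite E; ring.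
Qed.

Lemma power_sum_harm2_ode (y : C) : Cmod y < 1 ->
  (power_sum harm2 y + y * power_sum_derive harm2 y)%C = power_sum harm1 y.
Proof.
intros Hy.
refine (csum_unique _ _ _ (csum_plus _ _ _ _ (csum_power_sum _ y Cmod_harm2 Hy)
  (csum_euler _ y Cmod_harm2 Hy)) _).
refine (csum_ext _ _ _ _ (csum_power_sum _ y Cmod_harm1 Hy)).
intros n; unfold harm1, harm2.
replace (RtoC (INR n)) with (INR (n + 1) - 1)%C
  by (rewrite plus_INR, RtoC_plus; simpl; ring).
field; apply INR_neq_0_C.
Qed.

Lemma cdiff_arctanh (z : C) : Cmod z < 1 -> cdiff arctanh z (/ (1 - z * z)).
Proof.
intros Hz; eapply cdiff_eq.
- apply cdiff_mult; [apply cdiff_id|].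
  apply cdiff_power_sum_sqr; [exact Cmod_odd_inv|exact Hz].
- assert (H := power_sum_odd_inv_ode _ (Cmod_sqr_lt_1 z Hz)).
  assert (H0 := Cminus_1_neq_0 _ (Cmod_sqr_lt_1 z Hz)).
  transitivity ((power_sum odd_inv (z * z)
    + 2 * (z * z * power_sum_derive odd_inv (z * z))) * (1 - z * z) * / (1 - z * z))%C.
  + cbv beta; field; exact H0.
  + rewrite H; ring.
Qed.

Lemma cdiff_ramanujan_sum (z : C) : Cmod z < 1 ->
  cdiff ramanujan_sum z (2 * z * power_sum harm1 (z * z))%C.
Proof.
intros Hz; eapply cdiff_eq.
- apply cdiff_mult; [apply cdiff_mult; apply cdiff_id|].
  apply cdiff_power_sum_sqr; [exact Cmod_harm2|exact Hz].
- rewrite <- power_sum_harm2_ode by (apply Cmod_sqr_lt_1, Hz); cbv beta; ring.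
Qed.

Lemma Cmod_segment_0 (z : C) (t : R) : 0 <= t <= 1 -> Cmod z < 1 -> Cmod (0 + t * (z - 0)) < 1.
Proof.
intros Ht Hz; replace (0 + t * (z - 0))%C with (t * z)%C by ring.
rewrite Cmod_mult, Cmod_R_pos by lra; assert (H := Cmod_ge_0 z); nra.
Qed.

Lemma arctanh_sqr (z : C) : Cmod z < 1 ->
  (arctanh z * arctanh z = z * z * power_sum harm1 (z * z))%C.
Proof.
intros Hz.
assert (E := cdiff_0_segment
  (fun z => arctanh z * arctanh z - z * z * power_sum harm1 (z * z))%C 0 z).
assert (E0 : (arctanh z * arctanh z - z * z * power_sum harm1 (z * z) = 0)%C).
{ simpl in E; rewrite E; [unfold arctanh; ring|].
  intros t Ht; assert (Hw := Cmod_segment_0 z t Ht Hz); revert Hw.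
  generalize (0 + t * (z - 0))%C; clear; intros z Hz.
  eapply cdiff_eq.
  - apply cdiff_minus; [apply cdiff_mult; apply cdiff_arctanh, Hz|].
    apply cdiff_mult; [apply cdiff_mult; apply cdiff_id|].
    apply cdiff_power_sum_sqr; [exact Cmod_harm1|exact Hz].
  - assert (H := power_sum_harm1_ode _ (Cmod_sqr_lt_1 z Hz)).
    assert (H0 := Cminus_1_neq_0 _ (Cmod_sqr_lt_1 z Hz)).
    simpl; unfold arctanh; rewrite <- H; field; exact H0. }
replace (arctanh z * arctanh z)%C with
  (arctanh z * arctanh z - z * z * power_sum harm1 (z * z) + z * z * power_sum harm1 (z * z))%C
  by ring.
rewrite E0; ring.
Qed.

(** * The involution [z |-> (1 - z) / (1 + z)] *)

Definition cayley (z : C) : C := ((1 - z) / (1 + z))%C.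

Lemma Im_Re_cayley (z : C) : (1 + z)%C <> 0 ->
  Im (cayley z) * Cmod (1 + z) ^ 2 = - 2 * Im z /\
  Re (cayley z) * Cmod (1 + z) ^ 2 = 1 - Cmod z ^ 2.
Proof.
intros Hz; assert (Hn := sum_sq_neq_0 _ Hz).
rewrite !Cmod2_alt; destruct z as [x y]; unfold cayley; simpl in *.
split; field; intros E; apply Hn; (etransitivity; [|exact E]); ring.
Qed.

Lemma Re_cayley_pos (z : C) : Cmod z < 1 -> 0 < Re (cayley z).
Proof.
intros Hz; assert (H0 := Cplus_1_neq_0 _ Hz).
destruct (Im_Re_cayley z H0) as [_ H].
assert (H1 : 0 < Cmod (1 + z) ^ 2) by (apply pow_lt; now apply Cmod_gt_0).
assert (H2 := Cmod_ge_0 z).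
apply (Rmult_lt_reg_r (Cmod (1 + z) ^ 2)); [exact H1|rewrite H; nra].
Qed.

Lemma cdiff_cayley (z : C) : (1 + z)%C <> 0 ->
  cdiff cayley z (- (2) / ((1 + z) * (1 + z)))%C.
Proof.
intros Hz; eapply cdiff_eq.
- apply cdiff_div; [exact Hz|apply cdiff_minus; [apply cdiff_const|apply cdiff_id]|].
  apply cdiff_plus; [apply cdiff_const|apply cdiff_id].
- cbv beta; field; exact Hz.
Qed.

Lemma Clog_R (x : R) : 0 < x -> Clog x = RtoC (ln x).
Proof.
intros Hx; apply C_eq; unfold Clog; simpl.
- now rewrite Cmod_R_pos by lra.
- unfold Arg; simpl; destruct (Rle_dec 0 0); [|lra].
  rewrite Cmod_R_pos by lra; replace (x / x) with 1 by (field; lra); apply acos_1.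
Qed.

Lemma Clog_cayley_arctanh (z : C) : Cmod z < 1 -> Clog (cayley z) = (- (2) * arctanh z)%C.
Proof.
intros Hz.
assert (E := cdiff_0_segment (fun z => Clog (cayley z) + 2 * arctanh z)%C 0 z).
assert (E0 : (Clog (cayley z) + 2 * arctanh z = 0)%C).
{ simpl in E; rewrite E.
  - unfold arctanh, cayley; replace ((1 - 0) / (1 + 0))%C with (RtoC 1)
      by (field; rewrite Cplus_0_r; exact C1_nz).
    rewrite Clog_R, ln_1 by lra; ring.
  - intros t Ht; assert (Hw := Cmod_segment_0 z t Ht Hz); revert Hw.
    generalize (0 + t * (z - 0))%C; clear; intros z Hz.
    assert (H1 := Cminus_1_neq_0 _ Hz); assert (H2 := Cplus_1_neq_0 _ Hz).
    eapply cdiff_eq.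
    + apply cdiff_plus.
      * apply (cdiff_comp Clog cayley); [apply cdiff_Clog|apply cdiff_cayley, H2].
        intros [_ H]; assert (H0 := Re_cayley_pos z Hz); lra.
      * apply cdiff_mult; [apply cdiff_const|apply cdiff_arctanh, Hz].
    + simpl; unfold cayley; field; repeat split; try assumption.
      replace (1 - z * z)%C with ((1 - z) * (1 + z))%C by ring.
      apply Cmult_neq_0; assumption. }
replace (Clog (cayley z)) with (Clog (cayley z) + 2 * arctanh z - 2 * arctanh z)%C by ring.
rewrite E0; ring.
Qed.

Lemma cdiff_ramanujan_sum_log (z : C) : Cmod z < 1 -> z <> 0 ->
  cdiff ramanujan_sum z (Clog (cayley z) * Clog (cayley z) / (2 * z))%C.
Proof.
intros Hz Hz0; eapply cdiff_eq; [apply cdiff_ramanujan_sum, Hz|].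
rewrite Clog_cayley_arctanh by exact Hz.
replace (- (2) * arctanh z * (- (2) * arctanh z))%C with (4 * (arctanh z * arctanh z))%C by ring.
rewrite arctanh_sqr by exact Hz; field; exact Hz0.
Qed.

Lemma csum_ramanujan_sum (z : C) : Cmod z <= 1 ->
  csum (fun n => h (n + 1) / INR (n + 1) ^ 2 * z ^ (2 * (n + 1)))%C (ramanujan_sum z).
Proof.
intros Hz.
assert (Hz2 : Cmod (z * z) <= 1)
  by (rewrite Cmod_mult; assert (H := Cmod_ge_0 z); nra).
refine (csum_ext _ _ _ _ (csum_scal (z * z) _ _
  (csum_power_sum_closed _ (z * z) ex_series_harm2 Hz2))).
intros n; unfold harm2; rewrite Cpow_mult_r.
replace (z ^ 2)%C with (z * z)%C by (simpl; ring).
rewrite Nat.add_1_r, (Cpow_S (z * z)); ring.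
Qed.

(** * Complex integrals over [[0, 1]] *)

Definition cint (f : R -> C) (l : C) : Prop :=
  is_RInt (fun u => Re (f u)) 0 1 (Re l) /\ is_RInt (fun u => Im (f u)) 0 1 (Im l).

Definition CRInt (f : R -> C) : C :=
  (RInt (fun u => Re (f u)) 0 1, RInt (fun u => Im (f u)) 0 1).

Definition ccontinuous (f : R -> C) (u : R) : Prop :=
  continuous (fun s => Re (f s)) u /\ continuous (fun s => Im (f s)) u.

Lemma cint_CRInt (f : R -> C) :
  (forall u, 0 <= u <= 1 -> ccontinuous f u) -> cint f (CRInt f).
Proof.
intros H; split; apply (RInt_correct (V := R_CompleteNormedModule)),
  (ex_RInt_continuous (V := R_CompleteNormedModule));
  rewrite Rmin_left, Rmax_right by lra; apply H.
Qed.

Lemma cint_unique (f : R -> C) (l m : C) : cint f l -> cint f m -> l = m.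
Proof.
intros [H1 H2] [H3 H4]; apply C_eq.
- now rewrite <- (is_RInt_unique _ _ _ _ H1), <- (is_RInt_unique _ _ _ _ H3).
- now rewrite <- (is_RInt_unique _ _ _ _ H2), <- (is_RInt_unique _ _ _ _ H4).
Qed.

Lemma cint_ext (f g : R -> C) (l : C) :
  (forall u, 0 < u < 1 -> f u = g u) -> cint f l -> cint g l.
Proof.
intros H [H1 H2]; split; [refine (is_RInt_ext _ _ _ _ _ _ H1)|refine (is_RInt_ext _ _ _ _ _ _ H2)];
  rewrite Rmin_left, Rmax_right by lra; intros u Hu; now rewrite H.
Qed.

Lemma cint_plus (f g : R -> C) (l m : C) :
  cint f l -> cint g m -> cint (fun u => f u + g u)%C (l + m)%C.
Proof.
intros [H1 H2] [H3 H4]; split.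
- apply (is_RInt_plus _ _ _ _ _ _ H1 H3).
- apply (is_RInt_plus _ _ _ _ _ _ H2 H4).
Qed.

Lemma cint_scal (c : C) (f : R -> C) (l : C) :
  cint f l -> cint (fun u => c * f u)%C (c * l)%C.
Proof.
intros [H1 H2]; split.
- apply (is_RInt_minus _ _ _ _ _ _ (is_RInt_scal _ _ _ (Re c) _ H1)
    (is_RInt_scal _ _ _ (Im c) _ H2)).
- apply (is_RInt_plus _ _ _ _ _ _ (is_RInt_scal _ _ _ (Re c) _ H2)
    (is_RInt_scal _ _ _ (Im c) _ H1)).
Qed.

Lemma cint_RtoC (f : R -> R) (l : R) : is_RInt f 0 1 l -> cint (fun u => RtoC (f u)) l.
Proof.
intros H; split; [exact H|].
simpl; evar_last; [apply (is_RInt_const 0 1 0)|apply Rmult_0_r].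
Qed.

Lemma cint_bound (f : R -> C) (g : R -> R) (l : C) (B : R) :
  (forall u, 0 <= u <= 1 -> Cmod (f u) <= g u) -> is_RInt g 0 1 B -> cint f l ->
  Cmod l <= 2 * B.
Proof.
intros H Hg [H1 H2].
assert (Hre : Rabs (Re l) <= B).
{ apply (norm_RInt_le (V := R_NormedModule) (fun u => Re (f u)) g 0 1); try assumption; [lra|].
  intros u Hu; exact (Rle_trans _ _ _ (re_le_Cmod (f u)) (H u Hu)). }
assert (Him : Rabs (Im l) <= B).
{ apply (norm_RInt_le (V := R_NormedModule) (fun u => Im (f u)) g 0 1); try assumption; [lra|].
  intros u Hu; exact (Rle_trans _ _ _ (im_le_Cmod (f u)) (H u Hu)). }
assert (H3 := Cmod_le_Re_Im l); lra.
Qed.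

Lemma cint_derive (F f : R -> C) :
  (forall u, 0 <= u <= 1 -> curve_derive F u (f u)) ->
  (forall u, 0 <= u <= 1 -> ccontinuous f u) -> cint f (F 1 - F 0)%C.
Proof.
intros H Hc; split.
- apply (is_RInt_derive (fun u => Re (F u)) (fun u => Re (f u)));
    rewrite Rmin_left, Rmax_right by lra; intros u Hu; [apply (H u Hu)|apply (Hc u Hu)].
- apply (is_RInt_derive (fun u => Im (F u)) (fun u => Im (f u)));
    rewrite Rmin_left, Rmax_right by lra; intros u Hu; [apply (H u Hu)|apply (Hc u Hu)].
Qed.

Definition ex_curve_derive (f : R -> C) (u : R) : Prop := exists v, curve_derive f u v.

Lemma ex_curve_derive_const (c : C) (u : R) : ex_curve_derive (fun _ => c) u.
Proof. eexists; apply curve_derive_const. Qed.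

Lemma ex_curve_derive_id (u : R) : ex_curve_derive (fun s => RtoC s) u.
Proof. eexists; apply (curve_derive_RtoC (fun s => s)), is_derive_id. Qed.

Lemma ex_curve_derive_plus (f g : R -> C) (u : R) :
  ex_curve_derive f u -> ex_curve_derive g u -> ex_curve_derive (fun s => f s + g s)%C u.
Proof. intros [v Hv] [w Hw]; eexists; apply curve_derive_plus; eassumption. Qed.

Lemma ex_curve_derive_mult (f g : R -> C) (u : R) :
  ex_curve_derive f u -> ex_curve_derive g u -> ex_curve_derive (fun s => f s * g s)%C u.
Proof. intros [v Hv] [w Hw]; eexists; apply curve_derive_mult; eassumption. Qed.

Lemma ex_curve_derive_inv (f : R -> C) (u : R) : f u <> 0 ->
  ex_curve_derive f u -> ex_curve_derive (fun s => / f s)%C u.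
Proof. intros H [v Hv]; eexists; apply curve_derive_inv; eassumption. Qed.

Lemma ex_curve_derive_pow (f : R -> C) (n : nat) (u : R) :
  ex_curve_derive f u -> ex_curve_derive (fun s => f s ^ n)%C u.
Proof.
intros H; induction n as [|n IH]; [exact (ex_curve_derive_const 1 u)|].
exact (ex_curve_derive_mult f (fun s => f s ^ n)%C u H IH).
Qed.

Lemma ccontinuous_derive (f : R -> C) (u : R) : ex_curve_derive f u -> ccontinuous f u.
Proof.
intros [v [H1 H2]]; split.
- apply (ex_derive_continuous (fun s => Re (f s))); eexists; eassumption.
- apply (ex_derive_continuous (fun s => Im (f s))); eexists; eassumption.
Qed.

Lemma ccontinuous_plus (f g : R -> C) (u : R) :
  ccontinuous f u -> ccontinuous g u -> ccontinuous (fun s => f s + g s)%C u.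
Proof.
intros [H1 H2] [H3 H4]; split.
- apply (continuous_plus (V := R_NormedModule) (fun s => Re (f s)) (fun s => Re (g s)));
    assumption.
- apply (continuous_plus (V := R_NormedModule) (fun s => Im (f s)) (fun s => Im (g s)));
    assumption.
Qed.

Lemma ccontinuous_weight (rho : R -> R) (k : R -> C) (u : R) :
  continuous rho u -> ex_curve_derive k u -> ccontinuous (fun s => rho s * k s)%C u.
Proof.
intros Hr Hk; apply ccontinuous_derive in Hk; destruct Hk as [H1 H2]; split.
- apply (continuous_ext (fun s => rho s * Re (k s))); [intros s; simpl; unfold Re; ring|].
  apply (continuous_mult (K := R_AbsRing) rho (fun s => Re (k s))); assumption.
- apply (continuous_ext (fun s => rho s * Im (k s))); [intros s; simpl; unfold Im; ring|].
  apply (continuous_mult (K := R_AbsRing) rho (fun s => Im (k s))); assumption.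
Qed.

Lemma ex_curve_derive_minus (f g : R -> C) (u : R) :
  ex_curve_derive f u -> ex_curve_derive g u -> ex_curve_derive (fun s => f s - g s)%C u.
Proof.
intros Hf [w Hw]; apply (ex_curve_derive_plus f (fun s => - g s)%C); [exact Hf|].
exists (- w)%C; apply (curve_derive_ext (fun s => - (1) * g s)%C); [intros s; ring|].
eapply curve_derive_eq; [apply curve_derive_mult; [apply curve_derive_const|exact Hw]|].
cbv beta; ring.
Qed.

Lemma ex_curve_derive_div (f g : R -> C) (u : R) : g u <> 0 ->
  ex_curve_derive f u -> ex_curve_derive g u -> ex_curve_derive (fun s => f s / g s)%C u.
Proof.
intros H Hf Hg; apply (ex_curve_derive_mult f (fun s => / g s)%C); [exact Hf|].
apply ex_curve_derive_inv; assumption.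
Qed.

(** * The polylogarithm as an integral over [[0, 1]] *)

Definition off_cut (z : C) : Prop := ~ (Im z = 0 /\ 1 <= Re z).

Lemma off_cut_lower_bound (z : C) : off_cut z ->
  exists d, 0 < d /\ forall u : R, 0 <= u <= 1 -> d <= Cmod (1 - u * u * z).
Proof.
intros Hz.
pose (q := fun u : R => (1 - u * u * Re z) ^ 2 + (u * u * Im z) ^ 2).
assert (Hq : forall u : R, Cmod (1 - u * u * z) ^ 2 = q u).
{ intros u; rewrite Cmod2_alt; unfold q; simpl; unfold Re, Im; ring. }
destruct (continuity_ab_min q 0 1) as [m [Hm Hm1]]; [lra| |].
{ intros c _; apply continuity_pt_filterlim.
  apply (ex_derive_continuous (V := R_NormedModule) q); unfold q; auto_derive; auto. }
exists (Cmod (1 - m * m * z)); split.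
- apply Cmod_gt_0; intros E; apply Hz.
  assert (E1 : Re (1 - m * m * z) = 0) by now rewrite E.
  assert (E2 : Im (1 - m * m * z) = 0) by now rewrite E.
  destruct z as [x y]; simpl in *.
  assert (E3 : m * m * x = 1) by lra.
  assert (E4 : m * m * y = 0) by lra.
  assert (Hm0 : m <> 0) by (intros ->; lra).
  assert (Hmm : 0 < m * m <= 1) by (split; nra).
  split; [apply (Rmult_eq_reg_l (m * m)); lra|apply (Rmult_le_reg_l (m * m)); lra].
- intros u Hu; specialize (Hm u Hu); rewrite <- !Hq in Hm.
  assert (H0 := Cmod_ge_0 (1 - u * u * z)); assert (H1 := Cmod_ge_0 (1 - m * m * z)).
  nra.
Qed.

Definition polylog_weight (p : nat) (rho : R -> R) : Prop :=
  (forall u, 0 <= u <= 1 -> continuous rho u) /\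
  (forall u, 0 <= u <= 1 -> 0 <= rho u) /\
  (forall n, is_RInt (fun u => rho u * u ^ (2 * n)) 0 1 (/ INR (n + 1) ^ p)).

Definition polylog_kernel (rho : R -> R) (z : C) : C :=
  CRInt (fun u => rho u * (z / (1 - u * u * z)))%C.

Definition polylog_kernel_coef (rho : R -> R) (z : C) (n : nat) : C :=
  match n with
  | O => polylog_kernel rho z
  | S k => CRInt (fun u => rho u * ((u * u) ^ k / (1 - u * u * z) ^ (k + 2)))%C
  end.

Definition polylog_kernel_remainder (rho : R -> R) (z w : C) (n : nat) : C :=
  CRInt (fun u => rho u * ((w - z) ^ S n * (u * u) ^ n /
    ((1 - u * u * z) ^ S n * (1 - u * u * w))))%C.

Lemma off_cut_neq_0 (z : C) (u : R) : off_cut z -> 0 <= u <= 1 -> (1 - u * u * z)%C <> 0.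
Proof.
intros Hz Hu; destruct (off_cut_lower_bound z Hz) as [d [Hd H]].
apply Cmod_gt_0; specialize (H u Hu); lra.
Qed.

Ltac smooth :=
  match goal with
  | |- ex_curve_derive (fun _ => ?c) _ => apply (ex_curve_derive_const c)
  | |- ex_curve_derive (fun s => RtoC s) _ => apply ex_curve_derive_id
  | |- ex_curve_derive (fun s => Cplus (@?f s) (@?g s)) _ =>
      apply (ex_curve_derive_plus f g); smooth
  | |- ex_curve_derive (fun s => Cminus (@?f s) (@?g s)) _ =>
      apply (ex_curve_derive_minus f g); smooth
  | |- ex_curve_derive (fun s => Cmult (@?f s) (@?g s)) _ =>
      apply (ex_curve_derive_mult f g); smooth
  | |- ex_curve_derive (fun s => Cpow (@?f s) ?n) _ =>
      apply (ex_curve_derive_pow f n); smooth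
  | |- ex_curve_derive (fun s => Cdiv (@?f s) (@?g s)) _ =>
      apply (ex_curve_derive_div f g); [|smooth|smooth]
  | _ => idtac
  end.

Lemma cint_weight (rho : R -> R) (k : R -> C) :
  (forall u, 0 <= u <= 1 -> continuous rho u) ->
  (forall u, 0 <= u <= 1 -> ex_curve_derive k u) ->
  cint (fun u => rho u * k u)%C (CRInt (fun u => rho u * k u)%C).
Proof.
intros Hrho Hk; apply cint_CRInt; intros u Hu.
apply ccontinuous_weight; [apply Hrho, Hu|apply Hk, Hu].
Qed.

(* One finite geometric expansion serves three purposes: [n -> infinity] gives the local
   power series, [n = 1] the derivative, and [z = 0] the series on the closed disc. *)
Lemma polylog_kernel_expansion (rho : R -> R) (z w : C) (n : nat) :
  (forall u, 0 <= u <= 1 -> continuous rho u) -> off_cut z -> off_cut w ->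
  polylog_kernel rho w =
    (@sum_n C_AbsRing (fun k => (w - z) ^ k * polylog_kernel_coef rho z k)%C n
     + polylog_kernel_remainder rho z w n)%C.
Proof.
intros Hrho Hz Hw.
assert (Hz' := fun u Hu => off_cut_neq_0 z u Hz Hu).
assert (Hw' := fun u Hu => off_cut_neq_0 w u Hw Hu).
induction n as [|n IH].
- rewrite sum_O; apply (cint_unique (fun u => rho u * (w / (1 - u * u * w)))%C).
  + apply cint_weight; [exact Hrho|]; intros u Hu; smooth; auto.
  + replace ((w - z) ^ 0 * polylog_kernel_coef rho z 0)%C with (polylog_kernel rho z)
      by (simpl; ring).
    refine (cint_ext _ _ _ _ (cint_plus _ _ _ _ (cint_weight rho _ Hrho _)
      (cint_weight rho _ Hrho _))); cycle 1.
    * intros u Hu; smooth; auto.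
    * intros u Hu; smooth; auto using Cmult_neq_0, Cpow_nz.
    * intros u Hu; assert (Hu' : 0 <= u <= 1) by lra; simpl; field; auto.
- rewrite IH, sum_Sn.
  match goal with |- context [plus ?a ?b] => change (plus a b) with (a + b)%C end.
  rewrite <- Cplus_assoc; f_equal.
  apply (cint_unique (fun u => rho u * ((w - z) ^ S n * (u * u) ^ n /
    ((1 - u * u * z) ^ S n * (1 - u * u * w))))%C).
  + apply cint_weight; [exact Hrho|]; intros u Hu; smooth; auto using Cmult_neq_0, Cpow_nz.
  + refine (cint_ext _ _ _ _ (cint_plus _ _ _ _ (cint_scal _ _ _ (cint_weight rho _ Hrho _))
      (cint_weight rho _ Hrho _))); cycle 1.
    * intros u Hu; smooth; auto using Cmult_neq_0, Cpow_nz.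
    * intros u Hu; smooth; auto using Cmult_neq_0, Cpow_nz.
    * intros u Hu; assert (Hu' : 0 <= u <= 1) by lra.
      replace (n + 2)%nat with (S (S n)) by lia; rewrite !Cpow_S.
      field; repeat split; auto using Cpow_nz.
Qed.

Lemma csum_remainder (u : nat -> C) (l : C) (e : nat -> R) :
  (forall n, Cmod (l - @sum_n C_AbsRing u n) <= e n) -> is_lim_seq e 0 -> csum u l.
Proof.
intros H He; split.
- change (is_lim_seq (sum_n (fun n => Re (u n))) (Re l)).
  apply (is_lim_seq_ext (fun n => Re (@sum_n C_AbsRing u n)));
    [intros n; apply (Re_Im_sum_n u n)|].
  apply is_lim_seq_spec; intros eps; apply is_lim_seq_spec in He.
  generalize (He eps); apply filter_imp; intros n Hn.
  rewrite Rminus_0_r in Hn.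
  rewrite <- Rabs_Ropp; refine (Rle_lt_trans _ _ _ _ (Rle_lt_trans _ _ _ (Rle_abs _) Hn)).
  refine (Rle_trans _ _ _ _ (Rle_trans _ _ _ (re_le_Cmod _) (H n))).
  apply Req_le; f_equal; unfold Re; simpl; ring.
- change (is_lim_seq (sum_n (fun n => Im (u n))) (Im l)).
  apply (is_lim_seq_ext (fun n => Im (@sum_n C_AbsRing u n)));
    [intros n; apply (Re_Im_sum_n u n)|].
  apply is_lim_seq_spec; intros eps; apply is_lim_seq_spec in He.
  generalize (He eps); apply filter_imp; intros n Hn.
  rewrite Rminus_0_r in Hn.
  rewrite <- Rabs_Ropp; refine (Rle_lt_trans _ _ _ _ (Rle_lt_trans _ _ _ (Rle_abs _) Hn)).
  refine (Rle_trans _ _ _ _ (Rle_trans _ _ _ (im_le_Cmod _) (H n))).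
  apply Req_le; f_equal; unfold Im; simpl; ring.
Qed.

Lemma Cmod_1_sub_near (z w : C) (d u : R) : 0 <= u <= 1 -> d <= Cmod (1 - u * u * z) ->
  d - Cmod (w - z) <= Cmod (1 - u * u * w).
Proof.
intros Hu Hd.
replace (1 - u * u * w)%C with (1 - u * u * z - (u * u) * (w - z))%C by ring.
eapply Rle_trans; [|apply Cmod_minus_ge].
rewrite !Cmod_mult, Cmod_R_pos by lra.
assert (H := Cmod_ge_0 (w - z)).
assert (H1 : u * u * Cmod (w - z) <= 1 * Cmod (w - z)) by (apply Rmult_le_compat_r; nra).
lra.
Qed.

Lemma off_cut_near (z w : C) (d : R) :
  (forall u : R, 0 <= u <= 1 -> d <= Cmod (1 - u * u * z)) -> Cmod (w - z) < d -> off_cut w.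
Proof.
intros Hd Hw [Hy Hx].
assert (Hu : 0 <= sqrt (/ Re w) <= 1).
{ split; [apply sqrt_pos|rewrite <- sqrt_1].
  apply sqrt_le_1_alt; rewrite <- Rinv_1; apply Rinv_le_contravar; lra. }
assert (H := Cmod_1_sub_near z w d _ Hu (Hd _ Hu)).
replace (1 - sqrt (/ Re w) * sqrt (/ Re w) * w)%C with (RtoC 0) in H;
  [rewrite Cmod_0 in H; lra|].
assert (Hi : 0 < / Re w) by (apply Rinv_0_lt_compat; lra).
rewrite <- RtoC_mult, sqrt_sqrt by lra.
apply C_eq; destruct w as [x y]; simpl in *; subst; [field; lra|ring].
Qed.

Lemma polylog_weight_total (p : nat) (rho : R -> R) (c : R) :
  polylog_weight p rho -> is_RInt (fun u => rho u * c) 0 1 c.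
Proof.
intros [_ [_ H]]; specialize (H O); simpl in H; rewrite pow1, Rinv_1 in H.
apply (is_RInt_ext (fun u => scal c (rho u * 1))).
- intros u _; unfold scal; simpl; unfold mult; simpl; ring.
- evar_last; [apply (is_RInt_scal _ 0 1 c _ H)|apply Rmult_1_r].
Qed.

Lemma cint_remainder (p : nat) (rho : R -> R) (z w : C) (n : nat) :
  polylog_weight p rho -> off_cut z -> off_cut w ->
  cint (fun u => rho u * ((w - z) ^ S n * (u * u) ^ n /
    ((1 - u * u * z) ^ S n * (1 - u * u * w))))%C (polylog_kernel_remainder rho z w n).
Proof.
intros [Hrho _] Hz Hw; apply cint_weight; [exact Hrho|]; intros u Hu; smooth.
apply Cmult_neq_0; [apply Cpow_nz|]; apply off_cut_neq_0; assumption.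
Qed.

Lemma polylog_kernel_remainder_bound (p : nat) (rho : R -> R) (z w : C) (d : R) (n : nat) :
  polylog_weight p rho -> off_cut z -> 0 < d ->
  (forall u : R, 0 <= u <= 1 -> d <= Cmod (1 - u * u * z)) -> Cmod (w - z) < d ->
  Cmod (polylog_kernel_remainder rho z w n)
    <= 2 * (Cmod (w - z) ^ S n / (d ^ S n * (d - Cmod (w - z)))).
Proof.
intros Hrho Hz Hd Hdz Hw.
assert (Hw' := off_cut_near z w d Hdz Hw).
refine (cint_bound _ (fun u => rho u * (Cmod (w - z) ^ S n / (d ^ S n * (d - Cmod (w - z)))))
  _ _ _ (polylog_weight_total p rho _ Hrho) (cint_remainder p rho z w n Hrho Hz Hw')).
intros u Hu.
assert (H1 := Cmod_1_sub_near z w d u Hu (Hdz u Hu)).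
assert (Hr : 0 <= rho u) by (apply Hrho, Hu).
assert (H0 := Cmod_ge_0 (w - z)).
assert (Hzn := off_cut_neq_0 z u Hz Hu); assert (Hwn := off_cut_neq_0 w u Hw' Hu).
rewrite Cmod_mult, (Cmod_R_pos _ Hr); apply Rmult_le_compat_l; [exact Hr|].
rewrite Cmod_div by (apply Cmult_neq_0; [apply Cpow_nz|]; assumption).
rewrite !Cmod_mult, !Cmod_pow, Cmod_mult, Cmod_R_pos by lra.
assert (Hdn : 0 < d ^ S n) by (apply pow_lt, Hd).
apply Rmult_le_compat.
- apply Rmult_le_pos; apply pow_le; [exact H0|nra].
- apply Rlt_le, Rinv_0_lt_compat, Rmult_lt_0_compat; [apply pow_lt|]; now apply Cmod_gt_0.
- rewrite <- (Rmult_1_r (Cmod (w - z) ^ S n)) at 2.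
  apply Rmult_le_compat_l; [apply pow_le, H0|].
  rewrite <- (pow1 n); apply pow_incr; nra.
- apply Rinv_le_contravar; [apply Rmult_lt_0_compat; lra|].
  apply Rmult_le_compat; [lra|lra|apply pow_incr; split; [lra|apply Hdz, Hu]|exact H1].
Qed.

Lemma pow_n_Cpow (z : C) (n : nat) : @pow_n C_AbsRing z n = (z ^ n)%C.
Proof.
induction n as [|n IH]; [reflexivity|simpl; rewrite IH; reflexivity].
Qed.

Lemma csum_is_pseries (a : nat -> C) (z l : C) :
  csum (fun n => z ^ n * a n)%C l <-> @is_pseries C_AbsRing C_NormedModule a z l.
Proof.
assert (E : forall n, @scal C_AbsRing C_NormedModule (pow_n z n) (a n) = (z ^ n * a n)%C)
  by (intros n; exact (f_equal (fun x => (x * a n)%C) (pow_n_Cpow z n))).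
unfold is_pseries; rewrite <- csum_is_series; split; apply csum_ext; intros n;
  [symmetry|]; apply E.
Qed.

Lemma polylog_kernel_analytic (p : nat) (rho : R -> R) :
  polylog_weight p rho -> analytic_on off_cut (polylog_kernel rho).
Proof.
intros Hrho z Hz; destruct (off_cut_lower_bound z Hz) as [d [Hd Hdz]].
exists d; split; [exact Hd|]; exists (polylog_kernel_coef rho z); intros w Hw.
apply csum_is_pseries.
assert (Hw' := off_cut_near z w d Hdz Hw).
assert (H0 := Cmod_ge_0 (w - z)).
pose (q := Cmod (w - z) / d).
apply (csum_remainder _ _ (fun n => 2 * (q / (d - Cmod (w - z))) * q ^ n)).
- intros n; rewrite (polylog_kernel_expansion rho z w n) by (assumption || apply Hrho).
  replace (_ + _ - _)%C with (polylog_kernel_remainder rho z w n) by ring.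
  apply Rle_trans with (1 := polylog_kernel_remainder_bound p rho z w d n Hrho Hz Hd Hdz Hw).
  assert (Eq : q ^ n = Cmod (w - z) ^ n / d ^ n)
    by (unfold q, Rdiv; now rewrite Rpow_mult_distr, pow_inv).
  apply Req_le; rewrite Eq; unfold q; simpl.
  field; repeat split; try lra; apply pow_nonzero; lra.
- replace (Finite 0) with (Rbar_mult (2 * (q / (d - Cmod (w - z)))) 0)
    by (simpl; f_equal; ring).
  apply is_lim_seq_scal_l, is_lim_seq_geom.
  assert (Hq : 0 <= q < 1).
  { unfold q; split; [apply Rmult_le_pos; [lra|apply Rlt_le, Rinv_0_lt_compat, Hd]|].
    apply (Rmult_lt_reg_r d); [exact Hd|].
    unfold Rdiv; rewrite Rmult_assoc, Rinv_l; lra. }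
  rewrite Rabs_pos_eq; lra.
Qed.

Lemma cdiff_polylog_kernel (p : nat) (rho : R -> R) (z : C) :
  polylog_weight p rho -> off_cut z ->
  cdiff (polylog_kernel rho) z (polylog_kernel_coef rho z 1).
Proof.
intros Hrho Hz; destruct (off_cut_lower_bound z Hz) as [d [Hd Hdz]].
apply (cdiff_quadratic _ _ _ (d / 2) (4 / d ^ 3)); [lra|]; intros w Hw.
assert (Hw' : Cmod (w - z) < d) by lra.
rewrite (polylog_kernel_expansion rho z w 1)
  by (assumption || apply Hrho || apply (off_cut_near z w d Hdz Hw')).
rewrite sum_Sn, sum_O.
match goal with |- context [plus ?a ?b] => change (plus a b) with (a + b)%C end.
replace (_ - _ - _)%C with (polylog_kernel_remainder rho z w 1)
  by (simpl polylog_kernel_coef; simpl Cpow; ring).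
apply Rle_trans with (1 := polylog_kernel_remainder_bound p rho z w d 1 Hrho Hz Hd Hdz Hw').
assert (H0 := Cmod_ge_0 (w - z)); set (x := Cmod (w - z)) in *.
apply Rle_trans with (2 * (x ^ 2 / (d ^ 2 * (d / 2)))); [|apply Req_le; field; lra].
apply Rmult_le_compat_l; [lra|]; apply Rmult_le_compat_l; [nra|].
assert (0 < d ^ 2) by nra.
apply Rinv_le_contravar; [nra|apply Rmult_le_compat_l; lra].
Qed.

Lemma is_lim_seq_inv_S : is_lim_seq (fun n => / INR (n + 1)) 0.
Proof.
apply (is_lim_seq_ext (fun n => / INR (S n))); [intros n; now rewrite Nat.add_1_r|].
apply (is_lim_seq_incr_1 (fun n => / INR n)).
replace (Finite 0) with (Rbar_inv p_infty) by reflexivity.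
apply is_lim_seq_inv; [apply is_lim_seq_INR|discriminate].
Qed.

Lemma off_cut_0 : off_cut 0.
Proof. intros [_ H]; simpl in H; lra. Qed.

Lemma inv_pow_le (n p q : nat) : (p <= q)%nat -> / INR (n + 1) ^ q <= / INR (n + 1) ^ p.
Proof.
intros H; assert (H1 : 1 <= INR (n + 1)) by (apply (le_INR 1); lia).
apply Rinv_le_contravar; [apply pow_lt; lra|apply Rle_pow; assumption].
Qed.

Lemma csum_polylog_kernel (p : nat) (rho : R -> R) (z : C) : (1 <= p)%nat ->
  polylog_weight p rho -> off_cut z -> Cmod z <= 1 ->
  csum (fun n => z ^ (n + 1) / INR (n + 1) ^ p)%C (polylog_kernel rho z).
Proof.
intros Hp Hrho Hz Hz1; destruct (off_cut_lower_bound z Hz) as [d [Hd Hdz]].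
assert (Hd1 : 0 < / d) by now apply Rinv_0_lt_compat.
assert (Hcoef : forall n, polylog_kernel_coef rho 0 (S n) = RtoC (/ INR (n + 1) ^ p)).
{ intros n; apply (cint_unique (fun u => rho u * ((u * u) ^ n / (1 - u * u * 0) ^ (n + 2)))%C).
  - apply cint_weight; [apply Hrho|]; intros u Hu; smooth.
    apply Cpow_nz, off_cut_neq_0; [exact off_cut_0|exact Hu].
  - refine (cint_ext _ _ _ _ (cint_RtoC _ _ (proj2 (proj2 Hrho) n))).
    intros u Hu; rewrite RtoC_mult; f_equal.
    replace (1 - u * u * 0)%C with (RtoC 1) by ring; rewrite Cpow_1_l.
    rewrite pow_mult, !RtoC_pow; replace (RtoC u ^ 2)%C with (u * u)%C by (simpl; ring).
    field; exact C1_nz. }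
assert (Hcoef0 : polylog_kernel_coef rho 0 0 = 0).
{ apply (cint_unique (fun u => rho u * (0 / (1 - u * u * 0)))%C).
  - apply cint_weight; [apply Hrho|]; intros u Hu; smooth.
    apply off_cut_neq_0; [exact off_cut_0|exact Hu].
  - apply (cint_ext (fun _ => RtoC 0)); [intros u Hu; unfold Cdiv; ring|].
    apply cint_RtoC; evar_last; [apply (is_RInt_const 0 1 0)|apply Rmult_0_r]. }
assert (H : csum (fun k => z ^ k * polylog_kernel_coef rho 0 k)%C (polylog_kernel rho z)).
{ apply (csum_remainder _ _ (fun n => 2 * / d * / INR (n + 1))).
  - intros n; rewrite (polylog_kernel_expansion rho 0 z n)
      by (assumption || apply Hrho || apply off_cut_0).
    replace (z - 0)%C with z by ring.
    replace (_ + _ - _)%C with (polylog_kernel_remainder rho 0 z n) by ring.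
    apply Rle_trans with (2 * (/ d * / INR (n + 1) ^ p)).
    2:{ assert (H1 := inv_pow_le n 1 p Hp); rewrite pow_1 in H1; nra. }
    refine (cint_bound _ (fun u => / d * (rho u * u ^ (2 * n))) _ _ _
      (is_RInt_scal _ _ _ (/ d) _ (proj2 (proj2 Hrho) n))
      (cint_remainder p rho 0 z n Hrho off_cut_0 Hz)).
    intros u Hu; assert (Hr : 0 <= rho u) by (apply Hrho, Hu).
    assert (Hzn := off_cut_neq_0 z u Hz Hu).
    replace (1 - u * u * 0)%C with (RtoC 1) by ring; rewrite Cpow_1_l, Cmult_1_l.
    replace (z - 0)%C with z by ring.
    rewrite Cmod_mult, (Cmod_R_pos _ Hr), Cmod_div, Cmod_mult, !Cmod_pow, Cmod_mult,
      Cmod_R_pos by (lra || assumption).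
    replace ((u * u) ^ n) with (u ^ (2 * n)) by (rewrite pow_mult; f_equal; ring).
    assert (Hun : 0 <= u ^ (2 * n)) by (apply pow_le; lra).
    replace (/ d * (rho u * u ^ (2 * n))) with (rho u * (1 * u ^ (2 * n) * / d)) by ring.
    apply Rmult_le_compat_l; [exact Hr|]; apply Rmult_le_compat.
    + apply Rmult_le_pos; [apply pow_le, Cmod_ge_0|exact Hun].
    + now apply Rlt_le, Rinv_0_lt_compat, Cmod_gt_0.
    + apply Rmult_le_compat_r; [exact Hun|].
      rewrite <- (pow1 (S n)); apply pow_incr; split; [apply Cmod_ge_0|exact Hz1].
    + apply Rinv_le_contravar; [exact Hd|apply Hdz, Hu].
  - replace (Finite 0) with (Rbar_mult (2 * / d) 0) by (simpl; f_equal; ring).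
    apply is_lim_seq_scal_l, is_lim_seq_inv_S. }
apply csum_shift in H.
replace (polylog_kernel rho z - _)%C with (polylog_kernel rho z) in H
  by (rewrite Hcoef0; ring).
refine (csum_ext _ _ _ _ H); intros n; rewrite Hcoef.
rewrite RtoC_inv, RtoC_pow, Nat.add_1_r; [reflexivity|].
apply pow_nonzero, not_0_INR; lia.
Qed.

Lemma csum_polylog (p : nat) (z : C) : (2 <= p)%nat -> Cmod z <= 1 ->
  csum (fun n => z ^ (n + 1) / INR (n + 1) ^ p)%C
    (CSeries (fun n => z ^ (n + 1) / INR (n + 1) ^ p)%C).
Proof.
intros Hp Hz; apply (csum_dominated _ (fun n => / INR (n + 1) ^ 2));
  [|exact ex_series_inv_square].
intros n; assert (Hn : 0 < INR (n + 1)) by (apply lt_0_INR; lia).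
rewrite <- RtoC_pow, Cmod_div, Cmod_pow, Cmod_R_pos.
- apply Rle_trans with (1 * / INR (n + 1) ^ p).
  + apply Rmult_le_compat_r; [apply Rlt_le, Rinv_0_lt_compat, pow_lt, Hn|].
    rewrite <- (pow1 (n + 1)); apply pow_incr; split; [apply Cmod_ge_0|exact Hz].
  + rewrite Rmult_1_l; apply inv_pow_le, Hp.
- apply Rlt_le, pow_lt, Hn.
- rewrite RtoC_pow; apply Cpow_nz, INR_neq_0_C.
Qed.

Lemma polylog_exists (p : nat) (rho : R -> R) : (2 <= p)%nat -> polylog_weight p rho ->
  exists L, is_polylog p L /\ forall z, off_cut z -> L z = polylog_kernel rho z.
Proof.
intros Hp Hrho.
pose (L := fun z => if Rle_dec (Cmod z) 1
  then CSeries (fun n => z ^ (n + 1) / INR (n + 1) ^ p)%C else polylog_kernel rho z).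
assert (HL : forall z, off_cut z -> L z = polylog_kernel rho z).
{ intros z Hz; unfold L; destruct (Rle_dec (Cmod z) 1) as [H|H]; [|reflexivity].
  apply csum_CSeries, csum_polylog_kernel; auto; lia. }
exists L; split; [split|exact HL].
- intros z Hz; apply csum_is_series; unfold L.
  destruct (Rle_dec (Cmod z) 1); [now apply csum_polylog|contradiction].
- intros z Hz; destruct (polylog_kernel_analytic p rho Hrho z Hz) as [r [Hr [a Ha]]].
  destruct (off_cut_lower_bound z Hz) as [d [Hd Hdz]].
  exists (Rmin r d); split; [now apply Rmin_pos|]; exists a; intros w Hw.
  rewrite HL; [apply Ha|apply (off_cut_near z w d Hdz)].
  + apply Rlt_le_trans with (1 := Hw), Rmin_l.
  + apply Rlt_le_trans with (1 := Hw), Rmin_r.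
Qed.

(** * Uniqueness of analytic continuation *)

Lemma csum_terms_bounded (u : nat -> C) (l : C) : csum u l ->
  exists M, forall n, Cmod (u n) <= M.
Proof.
intros [H1 H2].
assert (Hb : forall a l, is_series a l -> exists M, forall n, Rabs (a n) <= M).
{ clear; intros a l H.
  destruct (filterlim_bounded (V := R_NormedModule) a) as [M HM]; [|now exists M].
  exists 0; apply (ex_series_lim_0 a); now exists l. }
destruct (Hb _ _ H1) as [M1 HM1]; destruct (Hb _ _ H2) as [M2 HM2].
exists (M1 + M2); intros n; specialize (HM1 n); specialize (HM2 n).
assert (H := Cmod_le_Re_Im (u n)); lra.
Qed.

Lemma power_series_constant_term (a : nat -> C) (F : C -> C) (r : R) : 0 < r ->
  (forall z, 0 < Cmod z < r -> csum (fun n => z ^ n * a n)%C (F z)) ->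
  exists K d, 0 < d /\ 0 <= K /\
    forall z, 0 < Cmod z < d -> Cmod (F z - a O) <= K * Cmod z.
Proof.
intros Hr HF.
pose (q := r / 2); assert (Hq : 0 < q < r) by (unfold q; lra).
destruct (csum_terms_bounded _ _ (HF q ltac:(rewrite Cmod_R_pos; lra))) as [M HM].
assert (HM0 : 0 <= M) by (eapply Rle_trans; [apply Cmod_ge_0|apply (HM O)]).
exists (2 * (M / q * 2)), (q / 2); split; [lra|split].
{ assert (0 <= M / q) by (apply Rmult_le_pos; [lra|apply Rlt_le, Rinv_0_lt_compat; lra]).
  lra. }
intros z Hz; rewrite Rmult_assoc.
assert (HS := csum_shift _ _ (HF z ltac:(lra))).
replace (F z - _)%C with (F z - a O)%C in HS by (simpl; ring).
refine (csum_bound _ (fun n => (M / q * Cmod z) * (/ 2) ^ n) _ _ _ _ HS).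
- intros n; rewrite Cmod_mult, Cmod_pow.
  specialize (HM (S n)); rewrite Cmod_mult, Cmod_pow, Cmod_R_pos in HM by lra.
  assert (H0 := Cmod_ge_0 (a (S n))).
  assert (Hqn : 0 < q ^ n) by (apply pow_lt; lra).
  assert (Hzn : 0 <= Cmod z ^ n <= (q * / 2) ^ n)
    by (split; [apply pow_le; lra|apply pow_incr; lra]).
  rewrite Rpow_mult_distr in Hzn.
  simpl (Cmod z ^ S n); simpl (q ^ S n) in HM.
  replace (M / q * Cmod z * (/ 2) ^ n) with (Cmod z * (M / q * (/ 2) ^ n)) by ring.
  rewrite Rmult_assoc; apply Rmult_le_compat_l; [lra|].
  apply Rle_trans with (q ^ n * (/ 2) ^ n * Cmod (a (S n))).
  { apply Rmult_le_compat_r; [exact H0|apply Hzn]. }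
  replace (q ^ n * (/ 2) ^ n * Cmod (a (S n)))
    with (q * q ^ n * Cmod (a (S n)) * / q * (/ 2) ^ n) by (field; lra).
  apply Rmult_le_compat_r; [apply pow_le; lra|].
  apply Rmult_le_compat_r; [apply Rlt_le, Rinv_0_lt_compat; lra|exact HM].
- replace (M / q * 2 * Cmod z) with ((M / q * Cmod z) * / (1 - / 2)) by (field; lra).
  apply (is_series_scal (K := R_AbsRing) (V := R_NormedModule)), is_series_geom.
  rewrite Rabs_pos_eq; lra.
Qed.

Lemma power_series_zero (n : nat) : forall (a : nat -> C) (F : C -> C) (r : R) (v : C),
  0 < r -> v <> 0 ->
  (forall z, 0 < Cmod z < r -> csum (fun n => z ^ n * a n)%C (F z)) ->
  (exists e, 0 < e /\ forall s : R, 0 < s < e -> F (s * v)%C = 0) -> a n = 0.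
Proof.
assert (H0 : forall (a : nat -> C) (F : C -> C) (r : R) (v : C), 0 < r -> v <> 0 ->
  (forall z, 0 < Cmod z < r -> csum (fun n => z ^ n * a n)%C (F z)) ->
  (exists e, 0 < e /\ forall s : R, 0 < s < e -> F (s * v)%C = 0) -> a O = 0).
{ intros a F r v Hr Hv HF [e [He Hz]].
  destruct (power_series_constant_term a F r Hr HF) as [K [d [Hd [HK H]]]].
  apply Cmod_eq_0, Rle_antisym; [|apply Cmod_ge_0].
  apply Rnot_lt_le; intros Ha.
  assert (Hv0 := proj1 (Cmod_gt_0 v) Hv).
  pose (s := Rmin (e / 2) (Rmin (d / (2 * Cmod v)) (Cmod (a O) / (2 * (K + 1) * Cmod v)))).
  assert (Hs : 0 < s).
  { repeat apply Rmin_pos; [lra| |]; apply Rdiv_lt_0_compat; try assumption;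
      repeat apply Rmult_lt_0_compat; lra. }
  assert (Hs1 : s <= e / 2) by apply Rmin_l.
  assert (Hs2 : s * Cmod v <= d / 2).
  { apply Rle_trans with (d / (2 * Cmod v) * Cmod v); [|apply Req_le; field; lra].
    apply Rmult_le_compat_r; [lra|].
    eapply Rle_trans; [apply Rmin_r|apply Rmin_l]. }
  assert (Hs3 : (K + 1) * (s * Cmod v) <= Cmod (a O) / 2).
  { apply Rle_trans with
      ((K + 1) * (Cmod (a O) / (2 * (K + 1) * Cmod v) * Cmod v));
      [|apply Req_le; field; lra].
    apply Rmult_le_compat_l; [lra|]; apply Rmult_le_compat_r; [lra|].
    eapply Rle_trans; [apply Rmin_r|apply Rmin_r]. }
  assert (Hsv : 0 < s * Cmod v) by now apply Rmult_lt_0_compat.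
  assert (E : Cmod (s * v) = s * Cmod v) by (rewrite Cmod_mult, Cmod_R_pos; lra).
  specialize (H (s * v)%C); rewrite E in H; specialize (H ltac:(lra)).
  rewrite Hz in H by lra; replace (0 - a O)%C with (- a O)%C in H by ring.
  rewrite Cmod_opp in H; nra. }
induction n as [|n IH]; [exact H0|].
intros a F r v Hr Hv HF Hz.
assert (Ha := H0 a F r v Hr Hv HF Hz).
apply (IH (fun n => a (S n)) (fun z => / z * F z)%C r v Hr Hv).
- intros z Hzr; assert (Hz0 : z <> 0) by (apply Cmod_gt_0; lra).
  assert (H := csum_scal (/ z)%C _ _ (csum_shift _ _ (HF z Hzr))).
  cbv beta in H; rewrite Ha in H; replace (F z - z ^ 0 * 0)%C with (F z) in H by ring.
  refine (csum_ext _ _ _ _ H); intros k; rewrite Cpow_S; field; exact Hz0.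
- destruct Hz as [e [He Hz]]; exists e; split; [exact He|].
  intros s Hs; rewrite Hz by exact Hs; ring.
Qed.

Lemma off_cut_scal (t : R) (z : C) : 0 <= t <= 1 -> off_cut z -> off_cut (t * z).
Proof.
intros Ht Hz [H1 H2]; apply Hz; destruct z as [x y]; simpl in *.
assert (t <> 0) by (intros ->; lra).
split; [apply (Rmult_eq_reg_l t)|]; nra.
Qed.

Lemma analytic_on_off_cut_unique (f g : C -> C) :
  analytic_on off_cut f -> analytic_on off_cut g ->
  (forall z, Cmod z < 1 -> f z = g z) -> forall z, off_cut z -> f z = g z.
Proof.
intros Hf Hg Hfg z Hz.
destruct (excluded_middle_informative (z = 0)) as [->|Hz0];
  [apply Hfg; rewrite Cmod_0; lra|].
assert (Hz1 := proj1 (Cmod_gt_0 z) Hz0).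
pose (E := fun t => 0 <= t <= 1 /\ forall s : R, 0 <= s <= t -> f (s * z)%C = g (s * z)%C).
assert (Ht0 : E (/ (1 + Cmod z))).
{ assert (Hi : 0 < / (1 + Cmod z) <= 1).
  { split; [apply Rinv_0_lt_compat; lra|rewrite <- Rinv_1; apply Rinv_le_contravar; lra]. }
  split; [lra|]; intros s Hs; apply Hfg; rewrite Cmod_mult, Cmod_R_pos by lra.
  apply Rle_lt_trans with (/ (1 + Cmod z) * Cmod z); [apply Rmult_le_compat_r; lra|].
  apply (Rmult_lt_reg_l (1 + Cmod z)); [lra|].
  rewrite <- Rmult_assoc, Rinv_r; lra. }
destruct (completeness E) as [T [HT1 HT2]].
{ exists 1; intros t Ht; apply Ht. }
{ now exists (/ (1 + Cmod z)). }
assert (HT0 : 0 < T).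
{ eapply Rlt_le_trans; [|apply HT1, Ht0]; apply Rinv_0_lt_compat; lra. }
assert (HT : T <= 1) by (apply HT2; intros t Ht; apply Ht).
assert (Hlt : forall s : R, 0 <= s < T -> f (s * z)%C = g (s * z)%C).
{ intros s Hs; destruct (excluded_middle_informative (f (s * z)%C = g (s * z)%C)) as [|Hne]; [assumption|].
  exfalso; assert (T <= s); [|lra].
  apply HT2; intros t [Ht Hts]; apply Rnot_lt_le; intros Hst.
  apply Hne, Hts; lra. }
assert (HTz : off_cut (T * z)) by (apply off_cut_scal; [lra|exact Hz]).
destruct (Hf _ HTz) as [r1 [Hr1 [a Ha]]]; destruct (Hg _ HTz) as [r2 [Hr2 [b Hb]]].
pose (r := Rmin r1 r2); assert (Hr : 0 < r) by now apply Rmin_pos.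
assert (Hsum : forall w, Cmod w < r ->
  csum (fun n => w ^ n * (a n - b n))%C (f (T * z + w) - g (T * z + w))%C).
{ intros w Hw.
  assert (Hwz : (T * z + w - T * z)%C = w) by ring.
  assert (H1 := Ha (T * z + w)%C); assert (H2 := Hb (T * z + w)%C).
  rewrite Hwz in H1, H2.
  specialize (H1 (Rlt_le_trans _ _ _ Hw (Rmin_l _ _))).
  specialize (H2 (Rlt_le_trans _ _ _ Hw (Rmin_r _ _))).
  apply csum_is_pseries in H1; apply csum_is_pseries in H2.
  refine (csum_ext _ _ _ _ (csum_minus _ _ _ _ H1 H2)); intros n; ring. }
assert (Hab : forall n, (a n - b n)%C = 0).
{ intros n; apply (power_series_zero n (fun n => a n - b n)%C
    (fun w => f (T * z + w) - g (T * z + w))%C r (- z)%C Hr).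
  - intros E0; apply Hz0; replace z with (- - z)%C by ring; rewrite E0; ring.
  - intros w Hw; apply Hsum, Hw.
  - exists T; split; [exact HT0|]; intros s Hs.
    replace (T * z + s * - z)%C with ((T - s)%R * z)%C by (rewrite RtoC_minus; ring).
    rewrite Hlt by lra; ring. }
assert (Hnear : forall w, Cmod w < r -> f (T * z + w)%C = g (T * z + w)%C).
{ intros w Hw.
  assert (E0 : (f (T * z + w) - g (T * z + w) = 0 * (f (T * z + w) - g (T * z + w)))%C).
  { apply (csum_unique (fun n => w ^ n * (a n - b n))%C); [apply Hsum, Hw|].
    refine (csum_ext _ _ _ _ (csum_scal 0 _ _ (Hsum w Hw))).
    intros n; rewrite Hab; ring. }
  replace (f (T * z + w)%C) with (f (T * z + w) - g (T * z + w) + g (T * z + w))%C by ring.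
  rewrite E0; ring. }
assert (HT3 : E (Rmin 1 (T + r / (2 * Cmod z)))).
{ assert (Hrz : 0 < r / (2 * Cmod z)) by (apply Rdiv_lt_0_compat; lra).
  split; [split; [apply Rmin_glb; lra|apply Rmin_l]|].
  intros s Hs; destruct (Rlt_le_dec s T) as [HsT|HsT]; [apply Hlt; lra|].
  replace (s * z)%C with (T * z + (s - T)%R * z)%C by (rewrite RtoC_minus; ring).
  apply Hnear; rewrite Cmod_mult, Cmod_R_pos by lra.
  apply Rle_lt_trans with (r / (2 * Cmod z) * Cmod z).
  - apply Rmult_le_compat_r; [lra|].
    assert (H := Rmin_r 1 (T + r / (2 * Cmod z))); lra.
  - replace (r / (2 * Cmod z) * Cmod z) with (r / 2) by (field; lra); lra. }
assert (HT4 : T = 1).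
{ apply Rle_antisym; [exact HT|]; apply Rnot_lt_le; intros H.
  assert (H1 := HT1 _ HT3).
  assert (Hrz : 0 < r / (2 * Cmod z)) by (apply Rdiv_lt_0_compat; lra).
  revert H1; apply Rlt_not_le, Rmin_glb_lt; lra. }
replace z with (T * z + 0)%C by (rewrite HT4; ring).
apply Hnear; rewrite Cmod_0; exact Hr.
Qed.

(** * The dilogarithm and the trilogarithm *)

Lemma ln_nonpos (x : R) : x <= 0 -> ln x = 0.
Proof. intros H; unfold ln; destruct (Rlt_dec 0 x); [exfalso; lra|reflexivity]. Qed.

Lemma ln_fourth_root_bound (u : R) : 0 < u <= 1 ->
  0 <= - ln u <= 4 / sqrt (sqrt u).
Proof.
intros Hu.
assert (Hs : 0 < sqrt u) by (apply sqrt_lt_R0; lra).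
assert (Ht : 0 < sqrt (sqrt u)) by (apply sqrt_lt_R0; lra).
assert (E : u = sqrt (sqrt u) ^ 4).
{ replace (sqrt (sqrt u) ^ 4) with ((sqrt (sqrt u) * sqrt (sqrt u)) * (sqrt (sqrt u) * sqrt (sqrt u)))
    by ring.
  rewrite !sqrt_sqrt by lra; reflexivity. }
set (t := sqrt (sqrt u)) in *.
assert (El : - ln u = 4 * ln (/ t)).
{ rewrite ln_Rinv by exact Ht; rewrite E at 1; rewrite ln_pow by exact Ht; simpl; ring. }
assert (Hi : 0 < / t) by now apply Rinv_0_lt_compat.
split.
- destruct (Rle_lt_or_eq_dec _ _ (proj2 Hu)) as [H|H].
  + assert (ln u < ln 1) by (apply ln_increasing; lra); rewrite ln_1 in *; lra.
  + rewrite H, ln_1; lra.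
- rewrite El; unfold Rdiv; apply Rmult_le_compat_l; [lra|].
  assert (H := exp_ineq1_le (ln (/ t))); rewrite exp_ln in H by exact Hi; lra.
Qed.

Lemma u_ln_pow_bound (u : R) (j : nat) : (1 <= j <= 2)%nat -> u <= 1 ->
  Rabs (u * ln u ^ j) <= 16 * sqrt (Rabs u).
Proof.
intros Hj Hu; destruct (Rle_lt_dec u 0) as [Hu0|Hu0].
{ rewrite (ln_nonpos u Hu0), pow_i by lia; rewrite Rmult_0_r, Rabs_R0.
  assert (H := sqrt_pos (Rabs u)); lra. }
assert (Hl := ln_fourth_root_bound u (conj Hu0 Hu)).
rewrite Rabs_mult, <- RPow_abs, (Rabs_left1 (ln u)), (Rabs_pos_eq u) by lra.
assert (Hs : 0 < sqrt u) by (apply sqrt_lt_R0; lra).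
assert (Ht : 0 < sqrt (sqrt u)) by (apply sqrt_lt_R0; lra).
assert (Hs1 : sqrt u <= 1) by (rewrite <- sqrt_1; apply sqrt_le_1_alt; lra).
assert (Ht1 : sqrt (sqrt u) <= 1) by (rewrite <- sqrt_1; apply sqrt_le_1_alt; lra).
assert (E1 : sqrt u * sqrt u = u) by (apply sqrt_sqrt; lra).
assert (E2 : sqrt (sqrt u) * sqrt (sqrt u) = sqrt u) by (apply sqrt_sqrt; lra).
apply Rle_trans with (u * (4 / sqrt (sqrt u)) ^ j).
{ apply Rmult_le_compat_l; [lra|]; apply pow_incr; exact Hl. }
rewrite <- E1 at 1; set (t := sqrt (sqrt u)) in *; rewrite <- E2.
assert (Hj' : j = 1%nat \/ j = 2%nat) by lia; destruct Hj' as [-> | ->].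
- replace (t * t * (t * t) * (4 / t) ^ 1) with (4 * t * (t * t)) by (field; lra); nra.
- replace (t * t * (t * t) * (4 / t) ^ 2) with (16 * (t * t)) by (field; lra); lra.
Qed.

Lemma u_ln_pow_small (j : nat) (eps : R) : (1 <= j <= 2)%nat -> 0 < eps ->
  exists d, 0 < d /\ forall u, Rabs u < d -> Rabs (u * ln u ^ j) < eps.
Proof.
intros Hj Heps; pose (e := eps / 16); assert (He : 0 < e) by (unfold e; lra).
exists (Rmin 1 (e ^ 2)); split; [apply Rmin_pos; [lra|apply pow_lt, He]|].
intros u Hu.
assert (H1 : Rabs u < 1) by (eapply Rlt_le_trans; [exact Hu|apply Rmin_l]).
assert (H2 : Rabs u < e ^ 2) by (eapply Rlt_le_trans; [exact Hu|apply Rmin_r]).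
assert (H3 : u <= 1) by (assert (H := Rle_abs u); lra).
apply Rle_lt_trans with (1 := u_ln_pow_bound u j Hj H3).
assert (H4 : sqrt (Rabs u) < e); [|unfold e in H4; lra].
rewrite <- (sqrt_pow2 e) by lra; apply sqrt_lt_1_alt; split; [apply Rabs_pos|exact H2].
Qed.

(* Two-sided also at [u = 0]: the library's [ln] is 0 on nonpositive reals. *)
Lemma continuous_u_ln_pow (j : nat) (u : R) : (1 <= j <= 2)%nat -> 0 <= u ->
  continuous (fun u => u * ln u ^ j) u.
Proof.
intros Hj Hu; destruct (Rle_lt_or_eq_dec _ _ Hu) as [Hu0|<-].
- apply (ex_derive_continuous (V := R_NormedModule)); auto_derive; auto.
- intros P [eps HP].
  destruct (u_ln_pow_small j eps Hj (cond_pos eps)) as [d [Hd H]].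
  exists (mkposreal d Hd); intros y Hy; apply HP.
  unfold ball in *; simpl in *; unfold AbsRing_ball, abs, minus, plus, opp in *; simpl in *.
  rewrite Rmult_0_l, Ropp_0, Rplus_0_r; apply H.
  now rewrite Ropp_0, Rplus_0_r in Hy.
Qed.

Lemma is_derive_u2_ln_pow (j : nat) (u : R) : (1 <= j <= 2)%nat -> 0 <= u ->
  is_derive (fun u => u ^ 2 * ln u ^ j) u (2 * (u * ln u ^ j) + INR j * (u * ln u ^ pred j)).
Proof.
intros Hj Hu; destruct (Rle_lt_or_eq_dec _ _ Hu) as [Hu0|<-].
- auto_derive; [exact Hu0|].
  destruct j as [|j]; [lia|]; simpl pred; simpl (ln u ^ S j); field; lra.
- replace (2 * (0 * ln 0 ^ j) + INR j * (0 * ln 0 ^ pred j)) with 0 by ring.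
  apply is_derive_Reals; intros eps Heps.
  destruct (u_ln_pow_small j eps Hj Heps) as [d [Hd H]].
  exists (mkposreal d Hd); intros k Hk Hkd; simpl in Hkd.
  rewrite Rplus_0_l.
  replace ((k ^ 2 * ln k ^ j - 0 ^ 2 * ln 0 ^ j) / k - 0) with (k * ln k ^ j)
    by (field; exact Hk).
  apply H, Hkd.
Qed.

Lemma is_derive_u2_ln_pow_mult (j n : nat) (u : R) : (1 <= j <= 2)%nat -> 0 <= u ->
  is_derive (fun u => u ^ 2 * ln u ^ j * u ^ n) u
    ((INR n + 2) * (u * ln u ^ j) * u ^ n + INR j * (u * ln u ^ pred j) * u ^ n).
Proof.
intros Hj Hu.
evar_last; [apply (is_derive_mult (K := R_AbsRing) (fun u => u ^ 2 * ln u ^ j) (fun u => u ^ n));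
  [apply is_derive_u2_ln_pow; assumption|apply is_derive_pow, is_derive_id|exact Rmult_comm]|].
unfold plus, mult, one; simpl.
destruct n as [|n]; [simpl; ring|]; simpl pred; simpl (u ^ S n); ring.
Qed.

(* From [Li_p z = z / (p - 1)! * int_0^1 (- ln t) ^ (p - 1) / (1 - t z) dt]; the substitution
   [t = u ^ 2] makes the weight continuous at [0]. *)
Definition li2_weight (u : R) : R := -4 * (u * ln u ^ 1).
Definition li3_weight (u : R) : R := 4 * (u * ln u ^ 2).

Lemma continuous_li2_weight (u : R) : 0 <= u -> continuous li2_weight u.
Proof.
intros Hu; apply (continuous_scal_r (-4) (fun u => u * ln u ^ 1)).
apply continuous_u_ln_pow; [lia|exact Hu].
Qed.

Lemma continuous_li3_weight (u : R) : 0 <= u -> continuous li3_weight u.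
Proof.
intros Hu; apply (continuous_scal_r 4 (fun u => u * ln u ^ 2)).
apply continuous_u_ln_pow; [lia|exact Hu].
Qed.

Lemma continuous_mult_pow (rho : R -> R) (n : nat) (u : R) :
  continuous rho u -> continuous (fun u => rho u * u ^ n) u.
Proof.
intros H; apply (continuous_mult (K := R_AbsRing) rho (fun u => u ^ n)); [exact H|].
apply (ex_derive_continuous (V := R_NormedModule) (fun u => u ^ n)); auto_derive; auto.
Qed.

Lemma is_derive_pow_SS (n : nat) (u : R) :
  is_derive (fun u => u ^ 2 * u ^ n) u ((INR n + 2) * u * u ^ n).
Proof.
auto_derive; [auto|]; destruct n as [|n]; [simpl; ring|]; simpl pred; simpl (u ^ S n); ring.
Qed.

Lemma INR_2n (n : nat) : INR (2 * n) + 2 = 2 * INR (n + 1).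
Proof. rewrite mult_INR, plus_INR; simpl; ring. Qed.

Lemma polylog_weight_li2 : polylog_weight 2 li2_weight.
Proof.
split; [intros u Hu; apply continuous_li2_weight, Hu|split].
- intros u Hu; unfold li2_weight; rewrite pow_1.
  destruct (Rle_lt_or_eq_dec _ _ (proj1 Hu)) as [H|<-]; [|lra].
  assert (H1 := ln_fourth_root_bound u (conj H (proj2 Hu))); nra.
- intros n; set (N := INR (2 * n) + 2).
  assert (HN : 0 < N) by (unfold N; assert (H := pos_INR (2 * n)); lra).
  evar_last.
  + apply (is_RInt_derive (V := R_CompleteNormedModule) (fun u =>
      -4 * (/ N * (u ^ 2 * ln u ^ 1 * u ^ (2 * n)) - / N ^ 2 * (u ^ 2 * u ^ (2 * n)))));
      rewrite Rmin_left, Rmax_right by lra; intros u Hu.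
    * evar_last.
      { apply is_derive_scal, @is_derive_minus; apply is_derive_scal;
          [apply is_derive_u2_ln_pow_mult; [lia|apply Hu]|apply is_derive_pow_SS]. }
      fold N; unfold li2_weight, minus, plus, opp; simpl; field; lra.
    * apply continuous_mult_pow, continuous_li2_weight, Hu.
  + unfold minus, plus, opp; simpl; rewrite ln_1, !pow1; rewrite !Rmult_0_l.
    rewrite (INR_2n n : N = _); field; apply not_0_INR; lia.
Qed.

Lemma polylog_weight_li3 : polylog_weight 3 li3_weight.
Proof.
split; [intros u Hu; apply continuous_li3_weight, Hu|split].
- intros u Hu; unfold li3_weight; assert (0 <= ln u ^ 2) by apply pow2_ge_0; nra.
- intros n; set (N := INR (2 * n) + 2).
  assert (HN : 0 < N) by (unfold N; assert (H := pos_INR (2 * n)); lra).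
  evar_last.
  + apply (is_RInt_derive (V := R_CompleteNormedModule) (fun u =>
      4 * (/ N * (u ^ 2 * ln u ^ 2 * u ^ (2 * n)) -
        (2 / N ^ 2 * (u ^ 2 * ln u ^ 1 * u ^ (2 * n)) - 2 / N ^ 3 * (u ^ 2 * u ^ (2 * n))))));
      rewrite Rmin_left, Rmax_right by lra; intros u Hu.
    * evar_last.
      { apply is_derive_scal, @is_derive_minus; [|apply @is_derive_minus];
          apply is_derive_scal;
          [apply is_derive_u2_ln_pow_mult; [lia|apply Hu]
          |apply is_derive_u2_ln_pow_mult; [lia|apply Hu]|apply is_derive_pow_SS]. }
      fold N; unfold li3_weight, minus, plus, opp; simpl; field; lra.
    * apply continuous_mult_pow, continuous_li3_weight, Hu.
  + unfold minus, plus, opp; simpl; rewrite ln_1, !pow1; rewrite !Rmult_0_l.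
    rewrite (INR_2n n : N = _); field; apply not_0_INR; lia.
Qed.

Lemma curve_derive_1_sub (z : C) (u : R) :
  curve_derive (fun u => 1 - u * u * z)%C u (- (2) * u * z)%C.
Proof.
apply (curve_derive_ext (fun u => 1 + (- z) * (RtoC u * RtoC u))%C); [intros s; ring|].
assert (H : curve_derive (fun s => RtoC s) u 1)
  by exact (curve_derive_RtoC (fun s => s) u 1 (is_derive_id u)).
eapply curve_derive_eq.
- apply curve_derive_plus; [apply curve_derive_const|].
  apply curve_derive_mult; [apply curve_derive_const|apply curve_derive_mult; exact H].
- cbv beta; ring.
Qed.

Lemma curve_derive_u2_ln_kernel (j : nat) (z : C) (u : R) : (1 <= j <= 2)%nat ->
  off_cut z -> 0 <= u <= 1 ->
  curve_derive (fun u => RtoC (u ^ 2 * ln u ^ j) * (2 * z / (1 - u * u * z)))%C u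
    (z * (4 * RtoC (u * ln u ^ j) * (1 / (1 - u * u * z) ^ 2))
     + 2 * INR j * RtoC (u * ln u ^ pred j) * (z / (1 - u * u * z)))%C.
Proof.
intros Hj Hz Hu; assert (H0 := off_cut_neq_0 z u Hz Hu).
assert (H1 := is_derive_u2_ln_pow j u Hj (proj1 Hu)).
eapply curve_derive_eq.
- apply curve_derive_mult; [apply curve_derive_RtoC, H1|].
  apply curve_derive_mult; [apply curve_derive_const|].
  apply curve_derive_inv; [exact H0|apply curve_derive_1_sub].
- cbv beta.
  replace (RtoC (u ^ 2 * ln u ^ j)) with (u * RtoC (u * ln u ^ j))%C
    by (rewrite <- RtoC_mult; f_equal; ring).
  rewrite RtoC_plus, (RtoC_mult 2), (RtoC_mult (INR j)).
  field; exact H0.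
Qed.

Lemma polylog_kernel_coef_1 (p : nat) (rho : R -> R) (z : C) :
  polylog_weight p rho -> off_cut z ->
  cint (fun u => rho u * (1 / (1 - u * u * z) ^ 2))%C (polylog_kernel_coef rho z 1).
Proof.
intros Hrho Hz; apply (cint_weight rho (fun u => 1 / (1 - u * u * z) ^ 2)%C);
  [apply Hrho|]; intros u Hu; smooth.
apply Cpow_nz, off_cut_neq_0; assumption.
Qed.

Lemma cint_polylog_kernel (p : nat) (rho : R -> R) (z : C) :
  polylog_weight p rho -> off_cut z ->
  cint (fun u => rho u * (z / (1 - u * u * z)))%C (polylog_kernel rho z).
Proof.
intros Hrho Hz; apply cint_weight; [apply Hrho|]; intros u Hu; smooth.
apply off_cut_neq_0; assumption.
Qed.

Lemma ccontinuous_ext (f g : R -> C) (u : R) :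
  (forall s, f s = g s) -> ccontinuous f u -> ccontinuous g u.
Proof.
intros H [H1 H2]; split.
- apply (continuous_ext (fun s => Re (f s))); [intros s; now rewrite H|exact H1].
- apply (continuous_ext (fun s => Im (f s))); [intros s; now rewrite H|exact H2].
Qed.

(* Integration by parts: the boundary term [u ^ 2 * ln u ^ 2 * (2 * z / (1 - u ^ 2 * z))]
   vanishes at both ends. *)
Lemma li3_kernel_coef_1 (z : C) : off_cut z ->
  (z * polylog_kernel_coef li3_weight z 1)%C = polylog_kernel li2_weight z.
Proof.
intros Hz.
assert (H1 := cint_scal z _ _ (polylog_kernel_coef_1 3 _ z polylog_weight_li3 Hz)).
assert (H2 := cint_scal (- (1)) _ _ (cint_polylog_kernel 2 _ z polylog_weight_li2 Hz)).
assert (H3 := cint_plus _ _ _ _ H1 H2).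
assert (H4 : cint (fun u => z * (li3_weight u * (1 / (1 - u * u * z) ^ 2))
  + - (1) * (li2_weight u * (z / (1 - u * u * z))))%C
  (RtoC (1 ^ 2 * ln 1 ^ 2) * (2 * z / (1 - 1 * 1 * z))
   - RtoC (0 ^ 2 * ln 0 ^ 2) * (2 * z / (1 - 0 * 0 * z)))%C).
{ apply (cint_derive (fun u => RtoC (u ^ 2 * ln u ^ 2) * (2 * z / (1 - u * u * z)))%C).
  - intros u Hu; eapply curve_derive_eq;
      [apply curve_derive_u2_ln_kernel; [lia|exact Hz|exact Hu]|].
    unfold li3_weight, li2_weight; simpl pred; rewrite (RtoC_mult 4), (RtoC_mult (-4)).
    replace (RtoC (INR 2)) with (RtoC 2) by (simpl; f_equal; ring).
    replace (RtoC (-4)) with (- (4))%C by (rewrite <- RtoC_opp; f_equal; ring).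
    field; apply off_cut_neq_0; assumption.
  - intros u Hu; assert (H0 := off_cut_neq_0 z u Hz Hu).
    apply ccontinuous_plus.
    + apply (ccontinuous_ext (fun u => li3_weight u * (z * (1 / (1 - u * u * z) ^ 2)))%C);
        [intros s; ring|].
      apply ccontinuous_weight; [apply continuous_li3_weight, Hu|smooth].
      apply Cpow_nz, H0.
    + apply (ccontinuous_ext (fun u => li2_weight u * (- (1) * (z / (1 - u * u * z))))%C);
        [intros s; ring|].
      apply ccontinuous_weight; [apply continuous_li2_weight, Hu|smooth; exact H0]. }
assert (E := cint_unique _ _ _ H3 H4).
rewrite ln_1 in E; replace (1 ^ 2 * 0 ^ 2) with 0 in E by ring.
replace (0 ^ 2 * ln 0 ^ 2) with 0 in E by ring.
replace (z * polylog_kernel_coef li3_weight z 1)%C with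
  (z * polylog_kernel_coef li3_weight z 1 + - (1) * polylog_kernel li2_weight z
   + polylog_kernel li2_weight z)%C by ring.
rewrite E; unfold Cdiv; ring.
Qed.

Lemma log_defined_1_sub (z : C) : off_cut z -> log_defined (1 - z).
Proof.
intros Hz [H1 H2]; apply Hz; destruct z as [x y]; simpl in *; lra.
Qed.

Lemma li2_kernel_coef_1 (z : C) : off_cut z ->
  (z * polylog_kernel_coef li2_weight z 1)%C = (- Clog (1 - z))%C.
Proof.
intros Hz.
assert (H1 := cint_scal z _ _ (polylog_kernel_coef_1 2 _ z polylog_weight_li2 Hz)).
assert (H4 : cint (fun u => z * (li2_weight u * (1 / (1 - u * u * z) ^ 2)))%C
  ((- (1) * (RtoC (1 ^ 2 * ln 1 ^ 1) * (2 * z / (1 - 1 * 1 * z)))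
    + - (1) * Clog (1 - 1 * 1 * z))
   - (- (1) * (RtoC (0 ^ 2 * ln 0 ^ 1) * (2 * z / (1 - 0 * 0 * z)))
      + - (1) * Clog (1 - 0 * 0 * z)))%C).
{ apply (cint_derive (fun u => - (1) * (RtoC (u ^ 2 * ln u ^ 1) * (2 * z / (1 - u * u * z)))
    + - (1) * Clog (1 - u * u * z))%C).
  - intros u Hu; assert (H0 := off_cut_neq_0 z u Hz Hu).
    assert (Hl : log_defined (1 - u * u * z)).
    { rewrite <- RtoC_mult; apply log_defined_1_sub, off_cut_scal; [nra|exact Hz]. }
    eapply curve_derive_eq.
    + apply curve_derive_plus; (apply curve_derive_mult; [apply curve_derive_const|]).
      * apply curve_derive_u2_ln_kernel; [lia|exact Hz|exact Hu].
      * apply curve_derive_Clog; [exact Hl|apply curve_derive_1_sub].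
    + cbv beta; unfold li2_weight; simpl pred.
      replace (RtoC (INR 1)) with (RtoC 1) by reflexivity.
      replace (u * ln u ^ 0) with u by (simpl; ring).
      rewrite (RtoC_mult (-4)).
      replace (RtoC (-4)) with (- (4))%C by (rewrite <- RtoC_opp; f_equal; ring).
      field; exact H0.
  - intros u Hu; assert (H0 := off_cut_neq_0 z u Hz Hu).
    apply (ccontinuous_ext (fun u => li2_weight u * (z * (1 / (1 - u * u * z) ^ 2)))%C);
      [intros s; ring|].
    apply ccontinuous_weight; [apply continuous_li2_weight, Hu|smooth].
    apply Cpow_nz, H0. }
rewrite (cint_unique _ _ _ H1 H4).
rewrite ln_1; replace (1 ^ 2 * 0 ^ 1) with 0 by ring.
replace (0 ^ 2 * ln 0 ^ 1) with 0 by ring.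
replace (1 - 0 * 0 * z)%C with (RtoC 1) by ring.
rewrite Clog_R, ln_1 by lra; replace (1 - 1 * 1 * z)%C with (1 - z)%C by ring.
unfold Cdiv; ring.
Qed.

Lemma Li_off_cut (p : nat) (rho : R -> R) (z : C) : (2 <= p)%nat -> polylog_weight p rho ->
  off_cut z -> Li p z = polylog_kernel rho z.
Proof.
intros Hp Hrho Hz; destruct (polylog_exists p rho Hp Hrho) as [L [HL HLk]].
assert (HLi : is_polylog p (Li p))
  by exact (epsilon_spec (inhabits (fun _ => RtoC 0)) (is_polylog p) (ex_intro _ L HL)).
rewrite <- HLk by exact Hz.
apply analytic_on_off_cut_unique; [apply HLi|apply HL| |exact Hz].
intros w Hw; apply (csum_unique (fun n => w ^ (n + 1) / INR (n + 1) ^ p)%C);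
  apply csum_is_series; [apply HLi|apply HL]; lra.
Qed.

Lemma csum_Li (p : nat) (z : C) : (p = 2 \/ p = 3)%nat -> Cmod z <= 1 ->
  csum (fun n => z ^ (n + 1) / INR (n + 1) ^ p)%C (Li p z).
Proof.
intros Hp Hz.
assert (H : exists L, is_polylog p L).
{ destruct Hp as [-> | ->].
  - destruct (polylog_exists 2 _ (le_n 2) polylog_weight_li2) as [L [HL _]]; now exists L.
  - destruct (polylog_exists 3 _ (le_S _ _ (le_n 2)) polylog_weight_li3) as [L [HL _]];
      now exists L. }
apply csum_is_series; now apply (epsilon_spec (inhabits (fun _ => RtoC 0)) (is_polylog p) H).
Qed.

Lemma off_cut_cdiff (f g : C -> C) (z l : C) : (forall z, off_cut z -> f z = g z) ->
  off_cut z -> cdiff g z l -> cdiff f z l.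
Proof.
intros Hfg Hz Hg c t v E Hv.
apply (curve_derive_ext_loc (fun s => g (c s))); [|now apply Hg].
destruct (off_cut_lower_bound z Hz) as [d [Hd Hdz]].
generalize (curve_derive_locally c t d v Hv Hd); apply filter_imp; intros s Hs.
symmetry; apply Hfg, (off_cut_near z _ d Hdz); now rewrite <- E.
Qed.

Lemma cdiff_Li2 (z : C) : off_cut z -> z <> 0 -> cdiff (Li 2) z (- Clog (1 - z) / z)%C.
Proof.
intros Hz Hz0; apply (off_cut_cdiff _ (polylog_kernel li2_weight)); [|exact Hz|].
- intros w Hw; apply (Li_off_cut 2); [lia|exact polylog_weight_li2|exact Hw].
- eapply cdiff_eq; [apply (cdiff_polylog_kernel 2); [exact polylog_weight_li2|exact Hz]|].
  rewrite <- li2_kernel_coef_1 by exact Hz; field; exact Hz0.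
Qed.

Lemma cdiff_Li3 (z : C) : off_cut z -> z <> 0 -> cdiff (Li 3) z (Li 2 z / z)%C.
Proof.
intros Hz Hz0; apply (off_cut_cdiff _ (polylog_kernel li3_weight)); [|exact Hz|].
- intros w Hw; apply (Li_off_cut 3); [lia|exact polylog_weight_li3|exact Hw].
- eapply cdiff_eq; [apply (cdiff_polylog_kernel 3); [exact polylog_weight_li3|exact Hz]|].
  rewrite (Li_off_cut 2 li2_weight) by (lia || exact polylog_weight_li2 || exact Hz).
  rewrite <- li3_kernel_coef_1 by exact Hz; field; exact Hz0.
Qed.

(** * Functional equations on the doubly slit plane *)

Definition unslit (z : C) : Prop := Im z = 0 -> 0 < Re z < 1.

Lemma unslit_off_cut (z : C) : unslit z -> off_cut z.
Proof. intros H [H1 H2]; specialize (H H1); lra. Qed.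

Lemma unslit_log_defined (z : C) : unslit z -> log_defined z.
Proof. intros H [H1 H2]; specialize (H H1); lra. Qed.

Lemma off_cut_opp (z : C) : log_defined z -> off_cut (- z).
Proof. intros Hz [H1 H2]; apply Hz; destruct z as [x y]; simpl in *; lra. Qed.

Lemma log_defined_plus_1 (z : C) : log_defined z -> log_defined (1 + z).
Proof.
intros H; replace (1 + z)%C with (1 - - z)%C by ring.
now apply log_defined_1_sub, off_cut_opp.
Qed.

Lemma Copp_neq_0 (z : C) : z <> 0 -> (- z)%C <> 0.
Proof. intros H E; apply H; replace z with (- - z)%C by ring; rewrite E; ring. Qed.

Lemma unslit_neq_0 (z : C) : unslit z -> z <> 0 /\ (1 - z)%C <> 0 /\ (1 + z)%C <> 0.
Proof.
intros H; assert (H1 := unslit_log_defined z H).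
repeat split; apply log_defined_neq_0; auto using log_defined_plus_1.
now apply log_defined_1_sub, unslit_off_cut.
Qed.

Lemma unslit_cayley (z : C) : unslit z -> unslit (cayley z).
Proof.
intros Hz HI; destruct (unslit_neq_0 z Hz) as [_ [_ H1]].
destruct (Im_Re_cayley z H1) as [E1 E2].
rewrite HI in E1; assert (HIz : Im z = 0) by lra; specialize (Hz HIz).
rewrite !Cmod2_alt in E2; destruct z as [x y]; simpl in *; subst y.
set (v := Re (cayley (x, 0))) in *.
split; apply (Rmult_lt_reg_r ((1 + x) * (1 + x))); nra.
Qed.

Lemma cayley_cayley (z : C) : (1 + z)%C <> 0 -> cayley (cayley z) = z.
Proof.
intros H; unfold cayley; field; split; [exact H|].
replace (1 + z + (1 - z))%C with (RtoC 2) by (rewrite (RtoC_plus 1 1 : RtoC 2 = _); ring).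
intros E; apply RtoC_inj in E; lra.
Qed.

Lemma unslit_segment (z : C) (t : R) : 0 <= t <= 1 -> unslit z ->
  unslit (RtoC (/ 2) + t * (z - RtoC (/ 2)))%C.
Proof.
intros Ht Hz; destruct z as [x y]; unfold unslit in *; simpl in *; intros E.
destruct (Req_dec t 0) as [->|H]; [lra|].
assert (Hy : y = 0) by (apply (Rmult_eq_reg_l t); lra).
specialize (Hz Hy); nra.
Qed.

Lemma Cmod_segment_half (z : C) (t : R) : 0 <= t <= 1 -> Cmod z < 1 ->
  Cmod (RtoC (/ 2) + t * (z - RtoC (/ 2)))%C < 1.
Proof.
intros Ht Hz.
replace (RtoC (/ 2) + t * (z - RtoC (/ 2)))%C
  with (RtoC ((1 - t) * / 2) + t * z)%C by (rewrite RtoC_mult, RtoC_minus; ring).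
eapply Rle_lt_trans; [apply Cmod_triangle|].
rewrite Cmod_mult, !Cmod_R_pos by nra; assert (H := Cmod_ge_0 z); nra.
Qed.

Lemma Clog_cayley (z : C) : unslit z -> Clog (cayley z) = (Clog (1 - z) - Clog (1 + z))%C.
Proof.
intros Hz.
assert (E := cdiff_0_segment (fun z => Clog (cayley z) - Clog (1 - z) + Clog (1 + z))%C
  (RtoC (/ 2)) z).
assert (E0 : (Clog (cayley z) - Clog (1 - z) + Clog (1 + z) = 0)%C).
{ cbv beta in E; rewrite E.
  - unfold cayley; rewrite <- RtoC_plus, <- RtoC_minus, <- RtoC_div by lra.
    rewrite !Clog_R by lra; rewrite <- RtoC_minus, <- RtoC_plus; f_equal.
    rewrite ln_div by lra; ring.
  - intros t Ht; assert (Hw := unslit_segment z t Ht Hz); revert Hw.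
    generalize (RtoC (/ 2) + t * (z - RtoC (/ 2)))%C; clear; intros z Hz.
    destruct (unslit_neq_0 z Hz) as [H0 [H1 H2]].
    eapply cdiff_eq.
    + apply cdiff_plus; [apply cdiff_minus|].
      * apply (cdiff_comp Clog cayley); [|apply cdiff_cayley, H2].
        apply cdiff_Clog, unslit_log_defined, unslit_cayley, Hz.
      * apply (cdiff_comp Clog (fun z => 1 - z)%C);
          [|apply cdiff_minus; [apply cdiff_const|apply cdiff_id]].
        apply cdiff_Clog, log_defined_1_sub, unslit_off_cut, Hz.
      * apply (cdiff_comp Clog (fun z => 1 + z)%C);
          [|apply cdiff_plus; [apply cdiff_const|apply cdiff_id]].
        apply cdiff_Clog, log_defined_plus_1, unslit_log_defined, Hz.
    + cbv beta; unfold cayley; field; auto. }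
replace (Clog (cayley z)) with
  (Clog (cayley z) - Clog (1 - z) + Clog (1 + z) + (Clog (1 - z) - Clog (1 + z)))%C by ring.
rewrite E0; ring.
Qed.

Definition odd_Li (p : nat) (z : C) : C := (Li p z - Li p (- z))%C.

Lemma cdiff_odd_Li2 (z : C) : unslit z -> cdiff (odd_Li 2) z (- Clog (cayley z) / z)%C.
Proof.
intros Hz; destruct (unslit_neq_0 z Hz) as [H0 [H1 H2]].
eapply cdiff_eq.
- apply cdiff_minus.
  + apply cdiff_Li2; [apply unslit_off_cut, Hz|exact H0].
  + apply (cdiff_comp (Li 2) (fun z => - z)%C); [|apply cdiff_opp, cdiff_id].
    apply cdiff_Li2; [apply off_cut_opp, unslit_log_defined, Hz|apply Copp_neq_0, H0].
- rewrite Clog_cayley by exact Hz; replace (1 - - z)%C with (1 + z)%C by ring.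
  field; exact H0.
Qed.

Lemma cdiff_odd_Li3 (z : C) : unslit z -> cdiff (odd_Li 3) z (odd_Li 2 z / z)%C.
Proof.
intros Hz; destruct (unslit_neq_0 z Hz) as [H0 [H1 H2]].
eapply cdiff_eq.
- apply cdiff_minus.
  + apply cdiff_Li3; [apply unslit_off_cut, Hz|exact H0].
  + apply (cdiff_comp (Li 3) (fun z => - z)%C); [|apply cdiff_opp, cdiff_id].
    apply cdiff_Li3; [apply off_cut_opp, unslit_log_defined, Hz|apply Copp_neq_0, H0].
- unfold odd_Li; field; exact H0.
Qed.

Lemma cdiff_odd_Li2_cayley (z : C) : unslit z ->
  cdiff (fun z => odd_Li 2 (cayley z)) z
    (2 * Clog z / ((1 - z) * (1 + z)))%C.
Proof.
intros Hz; destruct (unslit_neq_0 z Hz) as [H0 [H1 H2]].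
eapply cdiff_eq.
- apply (cdiff_comp (odd_Li 2) cayley); [|apply cdiff_cayley, H2].
  apply cdiff_odd_Li2, unslit_cayley, Hz.
- rewrite cayley_cayley by exact H2; unfold cayley; field; auto.
Qed.

Lemma cdiff_odd_Li3_cayley (z : C) : unslit z ->
  cdiff (fun z => odd_Li 3 (cayley z)) z
    (- (2) * odd_Li 2 (cayley z) / ((1 - z) * (1 + z)))%C.
Proof.
intros Hz; destruct (unslit_neq_0 z Hz) as [H0 [H1 H2]].
eapply cdiff_eq.
- apply (cdiff_comp (odd_Li 3) cayley); [|apply cdiff_cayley, H2].
  apply cdiff_odd_Li3, unslit_cayley, Hz.
- generalize (odd_Li 2 (cayley z)); intros x; unfold cayley; field; auto.
Qed.

Lemma cdiff_Clog_cayley (z : C) : unslit z ->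
  cdiff (fun z => Clog (cayley z)) z (- (2) / ((1 - z) * (1 + z)))%C.
Proof.
intros Hz; destruct (unslit_neq_0 z Hz) as [H0 [H1 H2]].
eapply cdiff_eq.
- apply (cdiff_comp Clog cayley); [|apply cdiff_cayley, H2].
  apply cdiff_Clog, unslit_log_defined, unslit_cayley, Hz.
- unfold cayley; field; auto.
Qed.

Lemma Clog_polar (m t : R) : 0 < m -> - PI < t <= PI ->
  Clog (m * cos t, m * sin t) = (ln m, t).
Proof.
intros Hm Ht; unfold Clog; rewrite Arg_polar by assumption; do 2 f_equal.
replace (m * cos t, m * sin t) with (RtoC m * (cos t, sin t))%C
  by (apply C_eq; simpl; ring).
rewrite Cmod_mult, Cmod_R_pos by lra.
unfold Cmod; simpl; replace (cos t * (cos t * 1) + sin t * (sin t * 1)) with 1.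
- rewrite sqrt_1; ring.
- assert (H := sin2_cos2 t); unfold Rsqr in H; lra.
Qed.

(* The constant is read off at [z = i]: there [cayley z = - z], so that the two odd
   functions cancel and no value of zeta is involved. *)
Lemma odd_Li2_reflection (z : C) : unslit z ->
  (odd_Li 2 z + odd_Li 2 (cayley z) + Clog z * Clog (cayley z) = PI ^ 2 / 4)%C.
Proof.
intros Hz.
pose (f := fun z => (odd_Li 2 z + odd_Li 2 (cayley z) + Clog z * Clog (cayley z))%C).
assert (Hf : forall z, unslit z -> f z = f (RtoC (/ 2))).
{ clear; intros z Hz; apply cdiff_0_segment; intros t Ht.
  assert (Hw := unslit_segment z t Ht Hz); revert Hw.
  generalize (RtoC (/ 2) + t * (z - RtoC (/ 2)))%C; clear; intros z Hz.
  destruct (unslit_neq_0 z Hz) as [H0 [H1 H2]].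
  eapply cdiff_eq.
  - apply cdiff_plus; [apply cdiff_plus|].
    + apply cdiff_odd_Li2, Hz.
    + apply cdiff_odd_Li2_cayley, Hz.
    + apply cdiff_mult; [apply cdiff_Clog, unslit_log_defined, Hz|apply cdiff_Clog_cayley, Hz].
  - cbv beta; field; auto. }
assert (Hi : unslit Ci) by (unfold unslit; simpl; lra).
change (f z = (PI ^ 2 / 4)%C); rewrite (Hf z Hz), <- (Hf Ci Hi); unfold f.
assert (Ec : cayley Ci = (- Ci)%C) by (apply C_eq; unfold cayley; simpl; field).
assert (HPI := PI_RGT_0).
assert (El : Clog Ci = (0, PI / 2)).
{ rewrite <- ln_1, <- (Clog_polar 1) by lra; f_equal.
  rewrite cos_PI2, sin_PI2; apply C_eq; simpl; ring. }
assert (El' : Clog (- Ci) = (0, - (PI / 2))).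
{ rewrite <- ln_1, <- (Clog_polar 1) by lra; f_equal.
  rewrite cos_neg, sin_neg, cos_PI2, sin_PI2; apply C_eq; simpl; ring. }
rewrite Ec, El, El'; unfold odd_Li; replace (- - Ci)%C with Ci by ring.
replace (PI ^ 2 / 4)%C with (((0, (PI / 2)%R) : C) * ((0, (- (PI / 2))%R) : C))%C; [ring|].
apply C_eq; simpl; field.
Qed.

Lemma ramanujan_rhs_cayley (a : C) : ramanujan_rhs a =
  (1 / 2 * Clog a * (Clog (cayley a) * Clog (cayley a)) + odd_Li 2 (cayley a) * Clog (cayley a)
   - odd_Li 3 (cayley a) + 7 / 4 * zeta3)%C.
Proof.
unfold ramanujan_rhs, odd_Li.
replace ((a - 1) / (1 + a))%C with (- cayley a)%C by (unfold cayley, Cdiv; ring).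
fold (cayley a); simpl; ring.
Qed.

Lemma cdiff_ramanujan_rhs (z : C) : unslit z ->
  cdiff ramanujan_rhs z (Clog (cayley z) * Clog (cayley z) / (2 * z))%C.
Proof.
intros Hz; destruct (unslit_neq_0 z Hz) as [H0 [H1 H2]].
assert (Hext : forall l, cdiff (fun a =>
  (1 / 2 * Clog a * (Clog (cayley a) * Clog (cayley a)) + odd_Li 2 (cayley a) * Clog (cayley a)
   - odd_Li 3 (cayley a) + 7 / 4 * zeta3)%C) z l -> cdiff ramanujan_rhs z l).
{ intros l H c t v E Hv; refine (curve_derive_ext _ _ _ _ _ (H c t v E Hv)).
  intros s; symmetry; apply ramanujan_rhs_cayley. }
apply Hext; eapply cdiff_eq.
- apply cdiff_plus; [apply cdiff_minus; [apply cdiff_plus|]|apply cdiff_const].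
  + apply cdiff_mult; [apply cdiff_mult; [apply cdiff_const|]|].
    * apply cdiff_Clog, unslit_log_defined, Hz.
    * apply cdiff_mult; apply cdiff_Clog_cayley, Hz.
  + apply cdiff_mult; [apply cdiff_odd_Li2_cayley, Hz|apply cdiff_Clog_cayley, Hz].
  + apply cdiff_odd_Li3_cayley, Hz.
- cbv beta; field; auto.
Qed.

(** * Behaviour at the end points of [[0, 1]] *)

Definition li_coef (p n : nat) : C := RtoC (/ INR (n + 1) ^ p).

Lemma ex_series_li_coef (p : nat) : (2 <= p)%nat -> ex_series (fun n => Cmod (li_coef p n)).
Proof.
intros Hp; apply (ex_series_le (K := R_AbsRing) (V := R_CompleteNormedModule) _
  (fun n => / INR (n + 1) ^ 2)); [|exact ex_series_inv_square].
intros n; unfold norm; simpl norm; unfold abs; simpl abs; rewrite Rabs_pos_eq by apply Cmod_ge_0.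
unfold li_coef; rewrite Cmod_R_pos; [now apply inv_pow_le|].
apply Rlt_le, Rinv_0_lt_compat, pow_lt, lt_0_INR; lia.
Qed.

Lemma Li_power_sum (p : nat) (z : C) : (p = 2 \/ p = 3)%nat -> Cmod z <= 1 ->
  Li p z = (z * power_sum (li_coef p) z)%C.
Proof.
intros Hp Hz; apply (csum_unique _ _ _ (csum_Li p z Hp Hz)).
refine (csum_ext _ _ _ _ (csum_scal z _ _
  (csum_power_sum_closed (li_coef p) z (ex_series_li_coef p ltac:(lia)) Hz))).
intros n; unfold li_coef; rewrite RtoC_inv, RtoC_pow, Nat.add_1_r, Cpow_S;
  [unfold Cdiv; ring|].
apply pow_nonzero, not_0_INR; lia.
Qed.

Lemma power_sum_bounded (a : nat -> C) : ex_series (fun n => Cmod (a n)) ->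
  exists M, 0 <= M /\ forall z, Cmod z <= 1 -> Cmod (power_sum a z) <= M.
Proof.
intros [A HA]; exists (2 * A).
assert (H : forall z, Cmod z <= 1 -> Cmod (power_sum a z) <= 2 * A).
{ intros z Hz; refine (csum_bound _ (fun n => Cmod (a n)) _ _ _ HA
    (csum_power_sum_closed a z (ex_intro _ A HA) Hz)).
  intros n; rewrite Cmod_mult, Cmod_pow; rewrite <- (Rmult_1_r (Cmod (a n))) at 2.
  apply Rmult_le_compat_l; [apply Cmod_ge_0|].
  rewrite <- (pow1 n); apply pow_incr; split; [apply Cmod_ge_0|exact Hz]. }
split; [|exact H].
specialize (H 0); rewrite Cmod_0 in H.
eapply Rle_trans; [apply Cmod_ge_0|apply H; lra].
Qed.

Lemma Li_3_1 : Li 3 1 = RtoC zeta3.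
Proof.
apply (csum_unique (fun n => 1 ^ (n + 1) / INR (n + 1) ^ 3)%C);
  [apply csum_Li; [lia|rewrite Cmod_1; lra]|].
assert (H : is_series (fun n => 1 / INR (n + 1) ^ 3) zeta3).
{ apply Series_correct; apply (ex_series_ext (fun n => Cmod (li_coef 3 n)));
    [|now apply ex_series_li_coef; lia].
  intros n; unfold li_coef; rewrite Cmod_R_pos; [exact (eq_sym (Rmult_1_l _))|].
  apply Rlt_le, Rinv_0_lt_compat, pow_lt, lt_0_INR; lia. }
refine (csum_ext _ _ _ _ (csum_RtoC _ _ H)); intros n.
rewrite Cpow_1_l, RtoC_div, RtoC_pow; [reflexivity|].
apply pow_nonzero, not_0_INR; lia.
Qed.

Lemma Li_3_m1 : Li 3 (- (1)) = RtoC (- (3 / 4) * zeta3).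
Proof.
pose (A := fun n => / INR (n + 1) ^ 3); pose (B := fun n => (-1) ^ (n + 1) * A n).
assert (Hex : ex_series A).
{ apply (ex_series_ext (fun n => Cmod (li_coef 3 n))); [|now apply ex_series_li_coef; lia].
  intros n; unfold li_coef; rewrite Cmod_R_pos; [reflexivity|].
  apply Rlt_le, Rinv_0_lt_compat, pow_lt, lt_0_INR; lia. }
assert (HA : is_series A zeta3).
{ replace zeta3 with (Series A); [now apply Series_correct|].
  apply Series_ext; intros n; unfold A, Rdiv; ring. }
assert (HB : is_series B (Series B)).
{ apply Series_correct.
  apply (ex_series_le (K := R_AbsRing) (V := R_CompleteNormedModule) _ A); [|exact Hex].
  intros n; unfold norm; simpl norm; unfold abs; simpl abs; unfold B.
  rewrite Rabs_mult, pow_1_abs, Rmult_1_l, Rabs_pos_eq; [apply Rle_refl|].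
  apply Rlt_le, Rinv_0_lt_compat, pow_lt, lt_0_INR; lia. }
assert (HS : forall n, sum_n (fun k => A k + B k) (2 * n + 1) = / 4 * sum_n A n).
{ assert (Hstep : forall n, A (2 * n)%nat + B (2 * n)%nat
    + (A (2 * n + 1)%nat + B (2 * n + 1)%nat) = / 4 * A n).
  { intros n; unfold B, A; replace (2 * n + 1 + 1)%nat with (2 * (n + 1))%nat by lia.
    replace (2 * n + 1)%nat with (S (2 * n)) at 2 by lia.
    rewrite pow_1_odd, pow_1_even, (mult_INR 2 (n + 1)); simpl (INR 2).
    assert (INR (n + 1) <> 0) by (apply not_0_INR; lia).
    assert (INR (2 * n + 1) <> 0) by (apply not_0_INR; lia).
    field; auto. }
  induction n as [|n IH].
  - simpl (2 * 0 + 1)%nat; rewrite sum_Sn, !sum_O.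
    match goal with |- context [plus ?a ?b] => change (plus a b) with (a + b) end.
    exact (Hstep O).
  - replace (2 * S n + 1)%nat with (S (S (2 * n + 1))) by lia.
    rewrite !sum_Sn, IH.
    repeat match goal with |- context [plus ?a ?b] => change (plus a b) with (a + b) end.
    specialize (Hstep (S n)).
    replace (2 * S n + 1)%nat with (S (S (2 * n + 1))) in Hstep by lia.
    replace (2 * S n)%nat with (S (2 * n + 1)) in Hstep by lia.
    lra. }
assert (E : zeta3 + Series B = / 4 * zeta3).
{ assert (H1 : is_lim_seq (fun n => sum_n (fun k => A k + B k) (2 * n + 1))
    (zeta3 + Series B)).
  { apply (is_lim_seq_subseq (sum_n (fun k => A k + B k)) _ (fun n => (2 * n + 1)%nat)).
    - intros P [N HN]; exists N; intros n Hn; apply HN; lia.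
    - apply (is_series_plus _ _ _ _ HA HB). }
  assert (H2 : is_lim_seq (fun n => sum_n (fun k => A k + B k) (2 * n + 1)) (/ 4 * zeta3)).
  { apply (is_lim_seq_ext (fun n => / 4 * sum_n A n)); [intros n; now rewrite HS|].
    apply (is_lim_seq_scal_l _ (/ 4) zeta3 HA). }
  apply is_lim_seq_unique in H1; apply is_lim_seq_unique in H2.
  rewrite H1 in H2; now injection H2. }
apply (csum_unique (fun n => (- (1)) ^ (n + 1) / INR (n + 1) ^ 3)%C);
  [apply csum_Li; [lia|rewrite Cmod_opp, Cmod_1; lra]|].
replace (- (3 / 4) * zeta3) with (Series B) by lra.
refine (csum_ext _ _ _ _ (csum_RtoC _ _ HB)); intros n; unfold B, A.
rewrite RtoC_mult, RtoC_inv, !RtoC_pow;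
  [now replace (RtoC (-1)) with (- (1))%C by (rewrite <- RtoC_opp; f_equal; ring)|].
apply pow_nonzero, not_0_INR; lia.
Qed.

Definition tends_to_0 (F : (R -> Prop) -> Prop) (f : R -> C) : Prop :=
  forall eps, 0 < eps -> F (fun x => Cmod (f x) < eps).

Lemma tends_to_0_plus (F : (R -> Prop) -> Prop) {FF : Filter F} (f g : R -> C) :
  tends_to_0 F f -> tends_to_0 F g -> tends_to_0 F (fun x => f x + g x)%C.
Proof.
intros Hf Hg eps Heps; assert (H : 0 < eps / 2) by lra.
generalize (filter_and _ _ (Hf _ H) (Hg _ H)); apply filter_imp; intros x [H1 H2].
eapply Rle_lt_trans; [apply Cmod_triangle|lra].
Qed.

Lemma tends_to_0_le (F : (R -> Prop) -> Prop) {FF : Filter F} (f g : R -> C) (K : R) :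
  F (fun x => Cmod (f x) <= K * Cmod (g x)) -> tends_to_0 F g -> tends_to_0 F f.
Proof.
intros H Hg eps Heps.
assert (HK : 0 < Rabs K + 1) by (assert (H0 := Rabs_pos K); lra).
generalize (filter_and _ _ H (Hg (eps / (Rabs K + 1)) (Rdiv_lt_0_compat _ _ Heps HK))).
apply filter_imp; intros x [H1 H2].
apply (Rmult_lt_compat_l (Rabs K + 1)) in H2; [|exact HK].
replace ((Rabs K + 1) * (eps / (Rabs K + 1))) with eps in H2 by (field; lra).
assert (H3 := Cmod_ge_0 (g x)); assert (H4 := Rle_abs K); nra.
Qed.

Definition unit_filter (a : R) : (R -> Prop) -> Prop :=
  within (fun x => 0 < x < 1) (locally a).

Instance unit_filter_Filter (a : R) : Filter (unit_filter a).
Proof. apply within_filter, locally_filter. Qed.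

Lemma unit_filter_bounds (a : R) : unit_filter a (fun x => 0 < x < 1).
Proof. exists (mkposreal 1 Rlt_0_1); intros x _ Hx; exact Hx. Qed.

Lemma unit_filter_near (a d : R) : 0 < d -> unit_filter a (fun x => Rabs (x - a) < d).
Proof. intros Hd; exists (mkposreal d Hd); intros x Hx _; exact Hx. Qed.

Lemma unit_filter_ex (a : R) (P : R -> Prop) : a = 0 \/ a = 1 -> unit_filter a P ->
  exists x, P x.
Proof.
intros Ha [d Hd]; assert (Hd0 := cond_pos d).
pose (e := Rmin (/ 2) (d / 2)).
assert (He : 0 < e <= / 2 /\ e <= d / 2)
  by (unfold e; split; [split; [apply Rmin_pos; lra|apply Rmin_l]|apply Rmin_r]).
destruct Ha as [-> | ->].
- exists e; apply Hd; [|lra].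
  unfold ball; simpl; unfold AbsRing_ball, abs, minus, plus, opp; simpl.
  rewrite Rabs_pos_eq; lra.
- exists (1 - e); apply Hd; [|lra].
  unfold ball; simpl; unfold AbsRing_ball, abs, minus, plus, opp; simpl.
  rewrite Rabs_left1; lra.
Qed.

Lemma tends_to_0_const (a : R) (c : C) : a = 0 \/ a = 1 -> tends_to_0 (unit_filter a) (fun _ => c) -> c = 0.
Proof.
intros Ha H; apply Cmod_eq_0, Rle_antisym; [|apply Cmod_ge_0].
apply Rnot_lt_le; intros Hc.
destruct (unit_filter_ex a _ Ha (H _ Hc)) as [_ H0]; lra.
Qed.

Lemma tends_to_0_sub (a : R) : tends_to_0 (unit_filter a) (fun x => RtoC (x - a)).
Proof.
intros eps Heps; generalize (unit_filter_near a eps Heps); apply filter_imp.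
intros x Hx; now rewrite Cmod_R.
Qed.

Lemma tends_to_0_sqrt (f : R -> R) (F : (R -> Prop) -> Prop) {FF : Filter F} :
  tends_to_0 F (fun x => RtoC (f x)) -> tends_to_0 F (fun x => RtoC (sqrt (f x))).
Proof.
intros H eps Heps; generalize (H (eps ^ 2) (pow_lt _ 2 Heps)); apply filter_imp.
intros x Hx; rewrite Cmod_R in *; rewrite Rabs_pos_eq by apply sqrt_pos.
destruct (Rle_lt_dec (f x) 0) as [H0|H0]; [rewrite sqrt_neg_0; assumption|].
rewrite Rabs_pos_eq in Hx by lra.
rewrite <- (sqrt_pow2 eps) by lra; apply sqrt_lt_1_alt; lra.
Qed.

Lemma tends_to_0_power_sum (a : nat -> C) (F : (R -> Prop) -> Prop) {FF : Filter F}
  (f : R -> C) (c : C) : ex_series (fun n => Cmod (a n)) -> Cmod c <= 1 ->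
  F (fun x => Cmod (f x) <= 1) -> tends_to_0 F (fun x => f x - c)%C ->
  tends_to_0 F (fun x => power_sum a (f x) - power_sum a c)%C.
Proof.
intros Ha Hc H1 H2 eps Heps.
destruct (power_sum_uniformly_continuous a eps Ha Heps) as [d [Hd H]].
generalize (filter_and _ _ H1 (H2 d Hd)); apply filter_imp; intros x [H3 H4]; now apply H.
Qed.

Lemma filterlim_czero (a : R) (f : R -> C) (l : C) :
  tends_to_0 (unit_filter a) (fun x => f x - l)%C ->
  filterlim f (unit_filter a) (@locally C_UniformSpace l).
Proof.
intros H P [eps HP]; unfold filtermap; generalize (H eps (cond_pos eps)); apply filter_imp.
intros x Hx; apply HP, C_NormedModule_mixin_compat1, Hx.
Qed.

Lemma tends_to_0_ext (F : (R -> Prop) -> Prop) {FF : Filter F} (f g : R -> C) :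
  F (fun x => f x = g x) -> tends_to_0 F f -> tends_to_0 F g.
Proof.
intros H; refine (tends_to_0_le _ _ _ 1 (filter_imp _ _ _ H)); intros x ->.
rewrite Rmult_1_l; apply Rle_refl.
Qed.

Lemma tends_to_0_opp (F : (R -> Prop) -> Prop) {FF : Filter F} (f : R -> C) :
  tends_to_0 F f -> tends_to_0 F (fun x => - f x)%C.
Proof.
refine (tends_to_0_le _ _ _ 1 (filter_forall _ _)); intros x; rewrite Cmod_opp; lra.
Qed.

Lemma odd_Li_power_sum (p : nat) (z : C) : (p = 2 \/ p = 3)%nat -> Cmod z <= 1 ->
  odd_Li p z = (z * (power_sum (li_coef p) z + power_sum (li_coef p) (- z)))%C.
Proof.
intros Hp Hz; unfold odd_Li; rewrite !Li_power_sum by (assumption || now rewrite Cmod_opp).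
ring.
Qed.

Lemma odd_Li_bounded (p : nat) : (p = 2 \/ p = 3)%nat ->
  exists M, 0 <= M /\ forall z, Cmod z <= 1 -> Cmod (odd_Li p z) <= M * Cmod z.
Proof.
intros Hp; destruct (power_sum_bounded (li_coef p)) as [M [HM H]];
  [apply ex_series_li_coef; lia|].
exists (2 * M); split; [lra|]; intros z Hz; rewrite odd_Li_power_sum by assumption.
rewrite Cmod_mult, Rmult_comm; apply Rmult_le_compat_r; [apply Cmod_ge_0|].
eapply Rle_trans; [apply Cmod_triangle|].
assert (H1 := H z Hz); assert (H2 := H (- z)%C); rewrite Cmod_opp in H2.
specialize (H2 Hz); lra.
Qed.

Lemma tends_to_0_odd_Li (p : nat) (F : (R -> Prop) -> Prop) {FF : Filter F} (f : R -> C) (c : C) :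
  (p = 2 \/ p = 3)%nat -> Cmod c <= 1 -> F (fun x => Cmod (f x) <= 1) ->
  tends_to_0 F (fun x => f x - c)%C -> tends_to_0 F (fun x => odd_Li p (f x) - odd_Li p c)%C.
Proof.
intros Hp Hc H1 H2.
assert (Hex : ex_series (fun n => Cmod (li_coef p n))) by (apply ex_series_li_coef; lia).
set (P := power_sum (li_coef p)).
assert (H3 : tends_to_0 F (fun x => P (f x) - P c)%C) by now apply tends_to_0_power_sum.
assert (H4 : tends_to_0 F (fun x => P (- f x) - P (- c))%C).
{ apply (tends_to_0_power_sum _ F (fun x => - f x)%C); [exact Hex|now rewrite Cmod_opp| |].
  - revert H1; apply filter_imp; intros x Hx; now rewrite Cmod_opp.
  - refine (tends_to_0_ext _ _ _ (filter_forall _ _) (tends_to_0_opp F _ H2)); intros x; ring. }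
apply (tends_to_0_ext F (fun x => f x * ((P (f x) - P c) + (P (- f x) - P (- c)))
  + (P c + P (- c)) * (f x - c))%C).
{ revert H1; apply filter_imp; intros x Hx.
  rewrite !odd_Li_power_sum by assumption; unfold P; ring. }
refine (tends_to_0_plus _ _ _ _ _).
- refine (tends_to_0_le _ _ _ (1) _ (tends_to_0_plus F _ _ H3 H4)).
  revert H1; apply filter_imp; intros x Hx; rewrite Cmod_mult.
  apply Rmult_le_compat_r; [apply Cmod_ge_0|exact Hx].
- refine (tends_to_0_le _ _ _ (Cmod (P c + P (- c)%C)) _ H2).
  apply filter_forall; intros x; rewrite Cmod_mult; apply Rle_refl.
Qed.

Lemma neg_ln_bounds (v : R) : 0 < v <= 1 -> 0 <= - ln v <= / v - 1.
Proof.
intros Hv; assert (Hi : 0 < / v) by (apply Rinv_0_lt_compat; lra).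
rewrite <- ln_Rinv by lra; split.
- rewrite <- ln_1; destruct (Rle_lt_or_eq_dec _ _ (proj2 Hv)) as [H|H].
  + apply Rlt_le, ln_increasing; [lra|].
    rewrite <- Rinv_1; apply Rinv_lt_contravar; lra.
  + rewrite H, Rinv_1; apply Rle_refl.
- assert (H := exp_ineq1_le (ln (/ v))); rewrite exp_ln in H by exact Hi; lra.
Qed.

Lemma cayley_R (x : R) : 0 < x < 1 -> cayley x = RtoC ((1 - x) / (1 + x)).
Proof.
intros Hx; unfold cayley; rewrite RtoC_div, RtoC_minus, RtoC_plus by lra; reflexivity.
Qed.

Lemma cayley_R_bounds (x : R) : 0 < x < 1 ->
  0 < (1 - x) / (1 + x) <= 1 - x /\ (1 - x) / 2 <= (1 - x) / (1 + x) /\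
  1 - (1 - x) / (1 + x) <= 2 * x.
Proof.
intros Hx; assert (Hi : / 2 <= / (1 + x) <= 1).
{ split; [apply Rinv_le_contravar; lra|].
  rewrite <- Rinv_1; apply Rinv_le_contravar; lra. }
assert (E : / (1 + x) * (1 + x) = 1) by (apply Rinv_l; lra).
unfold Rdiv; set (i := / (1 + x)) in *; repeat split; nra.
Qed.

Lemma ramanujan_rhs_R (x : R) : 0 < x < 1 -> let v := (1 - x) / (1 + x) in
  ramanujan_rhs x = (RtoC (/ 2 * (ln x * ln v ^ 2)) + odd_Li 2 v * RtoC (ln v)
    - odd_Li 3 v + 7 / 4 * zeta3)%C.
Proof.
intros Hx v; assert (Hv := cayley_R_bounds x Hx); fold v in Hv.
rewrite ramanujan_rhs_cayley, cayley_R by exact Hx; fold v.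
rewrite !Clog_R by lra.
rewrite !RtoC_mult, RtoC_inv, RtoC_pow by lra; simpl Cpow; unfold Cdiv; ring.
Qed.

Lemma ramanujan_rhs_0 : ramanujan_rhs 0 = 0.
Proof.
rewrite ramanujan_rhs_cayley.
replace (cayley 0) with (RtoC 1) by (unfold cayley; field; rewrite Cplus_0_r; exact C1_nz).
rewrite (Clog_R 1), ln_1 by lra; unfold odd_Li at 2; rewrite Li_3_1, Li_3_m1.
apply C_eq; simpl; field.
Qed.

Lemma ramanujan_rhs_1 : ramanujan_rhs 1 = (- odd_Li 3 0 + 7 / 4 * zeta3)%C.
Proof.
rewrite ramanujan_rhs_cayley.
replace (cayley 1) with (RtoC 0) by (unfold cayley, Cdiv; ring).
rewrite (Clog_R 1), ln_1 by lra.
rewrite (odd_Li_power_sum 2 0) by (lia || (rewrite Cmod_0; lra)); ring.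
Qed.

Lemma tends_to_0_ramanujan_rhs_0 : tends_to_0 (unit_filter 0) (fun x => ramanujan_rhs x - ramanujan_rhs 0)%C.
Proof.
set (v := fun x => (1 - x) / (1 + x)).
assert (Hb := unit_filter_bounds 0).
assert (Hhalf : unit_filter 0 (fun x => 0 < x < / 2)).
{ generalize (filter_and _ _ Hb (unit_filter_near 0 (/ 2) ltac:(lra))).
  apply filter_imp; intros x [H1 H2]; rewrite Rminus_0_r, Rabs_pos_eq in H2; lra. }
assert (Hln : forall x, 0 < x < / 2 -> 0 <= - ln (v x) <= 4 * x).
{ intros x Hx; assert (Hv := cayley_R_bounds x ltac:(lra)); fold (v x) in Hv.
  assert (H := neg_ln_bounds (v x) ltac:(lra)); split; [lra|].
  apply Rle_trans with (1 := proj2 H); unfold v.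
  replace (/ ((1 - x) / (1 + x)) - 1) with (2 * x * / (1 - x)) by (field; lra).
  assert (/ (1 - x) <= 2); [|nra].
  rewrite <- (Rinv_inv 2); apply Rinv_le_contravar; lra. }
destruct (odd_Li_bounded 2 ltac:(lia)) as [M [HM HX]].
apply (tends_to_0_ext _ (fun x => RtoC (/ 2 * (ln x * ln (v x) ^ 2)) + odd_Li 2 (v x) * RtoC (ln (v x))
  + - (odd_Li 3 (v x) - odd_Li 3 1))%C).
{ revert Hb; apply filter_imp; intros x Hx; rewrite ramanujan_rhs_R by exact Hx.
  rewrite ramanujan_rhs_0; fold (v x).
  replace (odd_Li 3 1) with (7 / 4 * zeta3)%C; [ring|].
  unfold odd_Li; rewrite Li_3_1, Li_3_m1; apply C_eq; simpl; field. }
refine (tends_to_0_plus _ _ _ (tends_to_0_plus _ _ _ _ _) (tends_to_0_opp _ _ _)).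
- refine (tends_to_0_le _ _ _ (128) _ (tends_to_0_sub 0)).
  revert Hhalf; apply filter_imp; intros x Hx.
  rewrite !Cmod_R, Rminus_0_r, !Rabs_mult, (Rabs_pos_eq x), (Rabs_pos_eq (/ 2)) by lra.
  specialize (Hln x Hx); rewrite (Rabs_pos_eq (ln (v x) ^ 2)) by apply pow2_ge_0.
  assert (H := u_ln_pow_bound x 1 ltac:(lia) ltac:(lra)).
  rewrite pow_1, Rabs_mult, (Rabs_pos_eq x) in H by lra.
  assert (Hs : sqrt x <= 1) by (rewrite <- sqrt_1; apply sqrt_le_1_alt; lra).
  assert (Hl2 : ln (v x) ^ 2 <= 16 * (x * x)) by nra.
  assert (H0 := Rabs_pos (ln x)).
  apply Rle_trans with (/ 2 * (Rabs (ln x) * (16 * (x * x)))); nra.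
- refine (tends_to_0_le _ _ _ (4 * M) _ (tends_to_0_sub 0)).
  revert Hhalf; apply filter_imp; intros x Hx.
  assert (Hv := cayley_R_bounds x ltac:(lra)); fold (v x) in Hv.
  rewrite Cmod_mult, !Cmod_R, Rminus_0_r, (Rabs_pos_eq x) by lra.
  specialize (Hln x Hx); rewrite (Rabs_left1 (ln (v x))) by lra.
  specialize (HX (v x)); rewrite Cmod_R_pos in HX by lra; specialize (HX ltac:(lra)).
  assert (H0 := Cmod_ge_0 (odd_Li 2 (v x))).
  assert (HXM : Cmod (odd_Li 2 (v x)) <= M) by nra; nra.
- apply (tends_to_0_odd_Li 3 _ (fun x => RtoC (v x)) 1); [lia|rewrite Cmod_1; lra| |].
  + revert Hb; apply filter_imp; intros x Hx.
    assert (Hv := cayley_R_bounds x Hx); fold (v x) in Hv; rewrite Cmod_R_pos; lra.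
  + refine (tends_to_0_le _ _ _ (2) _ (tends_to_0_sub 0)).
    revert Hb; apply filter_imp; intros x Hx.
    assert (Hv := cayley_R_bounds x Hx); fold (v x) in Hv.
    rewrite <- RtoC_minus, !Cmod_R, Rminus_0_r, (Rabs_pos_eq x), Rabs_left1; lra.
Qed.

Lemma tends_to_0_ramanujan_rhs_1 : tends_to_0 (unit_filter 1) (fun x => ramanujan_rhs x - ramanujan_rhs 1)%C.
Proof.
set (v := fun x => (1 - x) / (1 + x)).
assert (Hb := unit_filter_bounds 1).
assert (Hhalf : unit_filter 1 (fun x => / 2 < x < 1)).
{ generalize (filter_and _ _ Hb (unit_filter_near 1 (/ 2) ltac:(lra))).
  apply filter_imp; intros x [H1 H2]; rewrite Rabs_left1 in H2; lra. }
assert (Hv0 : tends_to_0 (unit_filter 1) (fun x => RtoC (v x))).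
{ refine (tends_to_0_le _ _ _ (1) _ (tends_to_0_sub 1)).
  revert Hb; apply filter_imp; intros x Hx.
  assert (Hv := cayley_R_bounds x Hx); fold (v x) in Hv.
  rewrite !Cmod_R, Rabs_pos_eq, Rabs_left1; lra. }
assert (Hsq := tends_to_0_sqrt v (unit_filter 1) Hv0).
destruct (odd_Li_bounded 2 ltac:(lia)) as [M [HM HX]].
apply (tends_to_0_ext _ (fun x => RtoC (/ 2 * (ln x * ln (v x) ^ 2)) + odd_Li 2 (v x) * RtoC (ln (v x))
  + - (odd_Li 3 (v x) - odd_Li 3 0))%C).
{ revert Hb; apply filter_imp; intros x Hx; rewrite ramanujan_rhs_R by exact Hx.
  rewrite ramanujan_rhs_1; fold (v x); ring. }
refine (tends_to_0_plus _ _ _ (tends_to_0_plus _ _ _ _ _) (tends_to_0_opp _ _ _)).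
- refine (tends_to_0_le _ _ _ (32) _ Hsq).
  revert Hhalf; apply filter_imp; intros x Hx.
  assert (Hv := cayley_R_bounds x ltac:(lra)); fold (v x) in Hv.
  rewrite !Cmod_R, (Rabs_pos_eq (sqrt (v x))) by apply sqrt_pos.
  rewrite !Rabs_mult, (Rabs_pos_eq (/ 2)), (Rabs_pos_eq (ln (v x) ^ 2))
    by (lra || apply pow2_ge_0).
  assert (Hl := neg_ln_bounds x ltac:(lra)); rewrite (Rabs_left1 (ln x)) by lra.
  assert (Hx4 : - ln x <= 4 * v x).
  { assert (/ x - 1 <= 2 * (1 - x)); [|lra].
    replace (/ x - 1) with ((1 - x) * / x) by (field; lra).
    assert (/ x <= 2) by (rewrite <- (Rinv_inv 2); apply Rinv_le_contravar; lra); nra. }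
  assert (H := u_ln_pow_bound (v x) 2 ltac:(lia) ltac:(lra)).
  assert (H2 := pow2_ge_0 (ln (v x))).
  rewrite !Rabs_pos_eq in H by nra.
  apply Rle_trans with (/ 2 * (4 * v x * ln (v x) ^ 2)); nra.
- refine (tends_to_0_le _ _ _ (16 * M) _ Hsq).
  revert Hb; apply filter_imp; intros x Hx.
  assert (Hv := cayley_R_bounds x Hx); fold (v x) in Hv.
  rewrite Cmod_mult, !Cmod_R, (Rabs_pos_eq (sqrt (v x))) by apply sqrt_pos.
  specialize (HX (v x)); rewrite Cmod_R_pos in HX by lra; specialize (HX ltac:(lra)).
  assert (H := u_ln_pow_bound (v x) 1 ltac:(lia) ltac:(lra)).
  rewrite pow_1, Rabs_mult, !(Rabs_pos_eq (v x)) in H by lra.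
  assert (H0 := Rabs_pos (ln (v x))).
  apply Rle_trans with (M * v x * Rabs (ln (v x))); [nra|].
  replace (M * v x * Rabs (ln (v x))) with (M * (v x * Rabs (ln (v x)))) by ring.
  replace (16 * M * sqrt (v x)) with (M * (16 * sqrt (v x))) by ring.
  now apply Rmult_le_compat_l.
- apply (tends_to_0_odd_Li 3 _ (fun x => RtoC (v x)) 0); [lia|rewrite Cmod_0; lra| |].
  + revert Hb; apply filter_imp; intros x Hx.
    assert (Hv := cayley_R_bounds x Hx); fold (v x) in Hv; rewrite Cmod_R_pos; lra.
  + refine (tends_to_0_ext _ _ _ (filter_forall _ _) Hv0); intros x; ring.
Qed.

Lemma tends_to_0_ramanujan_sum (a : R) : 0 <= a <= 1 ->
  tends_to_0 (unit_filter a) (fun x => ramanujan_sum x - ramanujan_sum a)%C.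
Proof.
intros Ha; assert (Hb := unit_filter_bounds a).
assert (Hsq : tends_to_0 (unit_filter a) (fun x : R => x * x - a * a)%C).
{ refine (tends_to_0_le _ _ _ (2) _ (tends_to_0_sub a)).
  revert Hb; apply filter_imp; intros x Hx.
  replace (x * x - a * a)%C with (RtoC (x + a) * RtoC (x - a))%C
    by (rewrite RtoC_plus, RtoC_minus; ring).
  rewrite Cmod_mult, (Cmod_R_pos (x + a)) by lra.
  apply Rmult_le_compat_r; [apply Cmod_ge_0|lra]. }
assert (Hs : forall x : R, 0 <= x <= 1 -> Cmod (x * x) <= 1)
  by (intros x Hx; rewrite <- RtoC_mult, Cmod_R_pos; nra).
set (P := power_sum harm2).
assert (HP : tends_to_0 (unit_filter a) (fun x : R => P (x * x)%C - P (a * a)%C)%C).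
{ apply (tends_to_0_power_sum harm2 _ (fun x : R => x * x)%C); [exact ex_series_harm2| | |exact Hsq].
  - apply Hs, Ha.
  - revert Hb; apply filter_imp; intros x Hx; apply Hs; lra. }
apply (tends_to_0_ext _ (fun x : R => x * x * (P (x * x) - P (a * a)) + P (a * a) * (x * x - a * a))%C).
{ apply filter_forall; intros x; unfold ramanujan_sum, P; ring. }
refine (tends_to_0_plus _ _ _ _ _).
- refine (tends_to_0_le _ _ _ (1) _ HP).
  revert Hb; apply filter_imp; intros x Hx; rewrite Cmod_mult.
  apply Rmult_le_compat_r; [apply Cmod_ge_0|apply Hs; lra].
- refine (tends_to_0_le _ _ _ (Cmod (P (a * a)%C)) _ Hsq).
  apply filter_forall; intros x; rewrite Cmod_mult; apply Rle_refl.
Qed.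

Lemma ramanujan_rhs_sum (z : C) : unslit z -> Cmod z < 1 -> ramanujan_rhs z = ramanujan_sum z.
Proof.
pose (f := fun z => (ramanujan_rhs z - ramanujan_sum z)%C).
assert (Hf : forall z, unslit z -> Cmod z < 1 -> f z = f (RtoC (/ 2))).
{ intros w Hw Hw1; apply cdiff_0_segment; intros t Ht.
  assert (H1 := unslit_segment w t Ht Hw); assert (H2 := Cmod_segment_half w t Ht Hw1).
  revert H1 H2; generalize (RtoC (/ 2) + t * (w - RtoC (/ 2)))%C; clear; intros z H1 H2.
  eapply cdiff_eq.
  - apply cdiff_minus; [apply cdiff_ramanujan_rhs, H1|].
    apply cdiff_ramanujan_sum_log; [exact H2|apply unslit_neq_0, H1].
  - ring. }
assert (H0 : f (RtoC (/ 2)) = 0).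
{ apply (tends_to_0_const 0); [now left|].
  apply (tends_to_0_ext _ (fun x : R => (ramanujan_rhs x - ramanujan_rhs 0)
    + - (ramanujan_sum x - ramanujan_sum 0))%C).
  - generalize (unit_filter_bounds 0); apply filter_imp; intros x Hx.
    rewrite <- (Hf x); [|intros _; simpl; lra|rewrite Cmod_R_pos; lra].
    rewrite ramanujan_rhs_0; unfold f, ramanujan_sum; ring.
  - refine (tends_to_0_plus _ _ _ tends_to_0_ramanujan_rhs_0 (tends_to_0_opp _ _ _)).
    apply tends_to_0_ramanujan_sum; lra. }
intros Hz Hz1.
replace (ramanujan_rhs z) with (f z + ramanujan_sum z)%C by (unfold f; ring).
rewrite Hf, H0 by assumption; ring.
Qed.

Lemma ramanujan_rhs_sum_R (a : R) : 0 <= a <= 1 -> ramanujan_rhs a = ramanujan_sum a.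
Proof.
intros Ha.
assert (Hin : forall x : R, 0 < x < 1 -> ramanujan_rhs x = ramanujan_sum x).
{ intros x Hx; apply ramanujan_rhs_sum; [intros _; simpl; lra|rewrite Cmod_R_pos; lra]. }
destruct (Req_dec a 0) as [->|H0]; [rewrite ramanujan_rhs_0; unfold ramanujan_sum; ring|].
destruct (Req_dec a 1) as [->|H1]; [|apply Hin; lra].
assert (E : (ramanujan_rhs 1 - ramanujan_sum 1)%C = 0).
{ apply (tends_to_0_const 1); [now right|].
  apply (tends_to_0_ext _ (fun x : R => (ramanujan_sum x - ramanujan_sum 1)
    + - (ramanujan_rhs x - ramanujan_rhs 1))%C).
  - generalize (unit_filter_bounds 1); apply filter_imp; intros x Hx.
    rewrite Hin by exact Hx; ring.
  - refine (tends_to_0_plus _ _ _ _ (tends_to_0_opp _ _ tends_to_0_ramanujan_rhs_1)).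
    apply tends_to_0_ramanujan_sum; lra. }
replace (ramanujan_rhs 1) with (ramanujan_rhs 1 - ramanujan_sum 1 + ramanujan_sum 1)%C by ring.
rewrite E; ring.
Qed.

(** * The alternating series *)

Lemma Ci_mult_Ci : (Ci * Ci = - (1))%C.
Proof. apply C_eq; simpl; ring. Qed.

Lemma Cmod_Ci_mult (z : C) : Cmod (Ci * z) = Cmod z.
Proof. rewrite Cmod_mult, Cmod_Ci; ring. Qed.

Lemma RtoC_m1 : RtoC (-1) = (- (1))%C.
Proof. rewrite <- RtoC_opp; f_equal; ring. Qed.

Lemma Cpow_Ci_mult_sqr (z : C) (n : nat) :
  ((Ci * z * (Ci * z)) ^ n)%C = ((RtoC (-1)) ^ n * z ^ (2 * n))%C.
Proof.
rewrite Cpow_mult_r, <- Cpow_mult_l; f_equal; rewrite RtoC_m1, <- Ci_mult_Ci; simpl; ring.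
Qed.

Lemma arctanh_Ci (z : C) : Cmod z < 1 -> arctanh (Ci * z) = (Ci * Carctan z)%C.
Proof.
intros Hz.
assert (Hy : Cmod (Ci * z * (Ci * z)) < 1)
  by (apply Cmod_sqr_lt_1; now rewrite Cmod_Ci_mult).
assert (E : Carctan z = (z * power_sum odd_inv (Ci * z * (Ci * z)))%C).
{ apply csum_CSeries.
  refine (csum_ext _ _ _ _ (csum_scal z _ _ (csum_power_sum _ _ Cmod_odd_inv Hy))).
  intros n; rewrite Cpow_Ci_mult_sqr; unfold odd_inv, Cdiv.
  rewrite (Nat.add_1_r (2 * n)), Cpow_S; ring. }
rewrite E; unfold arctanh; ring.
Qed.

Lemma csum_ramanujan_sum_Ci (a : C) : Cmod a < 1 ->
  csum (fun n => (-1) ^ n * (h (n + 1) / INR (n + 1) ^ 2) * a ^ (2 * (n + 1)))%C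
    (- ramanujan_sum (Ci * a))%C.
Proof.
intros Ha.
assert (Hz : Cmod (Ci * a) <= 1) by (rewrite Cmod_Ci_mult; lra).
replace (- ramanujan_sum (Ci * a))%C with (- (1) * ramanujan_sum (Ci * a))%C by ring.
refine (csum_ext _ _ _ _ (csum_scal (- (1)) _ _ (csum_ramanujan_sum _ Hz))).
intros n; rewrite Cpow_mult_r.
replace ((Ci * a) ^ 2)%C with (Ci * a * (Ci * a))%C by (simpl; ring).
rewrite Cpow_Ci_mult_sqr, Nat.add_1_r, (Cpow_S (RtoC (-1)) n), RtoC_m1; unfold Cdiv; ring.
Qed.

Lemma Carctan_sqr (a : C) (x : R) : Cmod a < 1 -> 0 < x < 1 ->
  (Carctan (a * x) ^ 2 / x)%C =
  (- (Ci * a) * (Ci * a * x * power_sum harm1 (Ci * a * x * (Ci * a * x))))%C.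
Proof.
intros Ha Hx.
assert (Hx0 : RtoC x <> 0) by (intros E; apply RtoC_inj in E; lra).
assert (Hax : Cmod (a * x) < 1)
  by (rewrite Cmod_mult, Cmod_R_pos by lra; assert (H := Cmod_ge_0 a); nra).
assert (E := arctanh_sqr (Ci * (a * x))).
rewrite Cmod_Ci_mult in E; specialize (E Hax); rewrite arctanh_Ci in E by exact Hax.
replace (Ci * (a * x))%C with (Ci * a * x)%C in E by ring.
set (P := power_sum harm1 _) in *; set (T := Carctan _) in *.
replace (T ^ 2)%C with (- ((Ci * Ci) * (T * T)))%C by (rewrite Ci_mult_Ci; simpl; ring).
replace (Ci * Ci * (T * T))%C with (Ci * T * (Ci * T))%C by ring.
rewrite E; field; exact Hx0.
Qed.

Lemma is_RInt_Carctan_sqr (a : C) : Cmod a < 1 ->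
  @is_RInt C_R_NormedModule (fun x : R => Carctan (a * x) ^ 2 / x)%C 0 1
    (- / 2 * ramanujan_sum (Ci * a))%C.
Proof.
intros Ha; set (b := (Ci * a)%C).
assert (Hb : forall x : R, 0 <= x <= 1 -> Cmod (b * x) < 1).
{ intros x Hx; unfold b; rewrite Cmod_mult, Cmod_Ci_mult, Cmod_R_pos by lra.
  assert (H := Cmod_ge_0 a); nra. }
assert (Hline : forall x, curve_derive (fun s : R => b * s)%C x b).
{ intros x; apply (curve_derive_ext (fun s : R => 0 + s * b)%C); [intros s; ring|].
  apply curve_derive_line. }
assert (H : cint (fun x : R => - b * (b * x * power_sum harm1 (b * x * (b * x))))%C
  (- / 2 * ramanujan_sum (b * 1) - - / 2 * ramanujan_sum (b * 0))%C).
{ apply (cint_derive (fun x : R => - / 2 * ramanujan_sum (b * x))%C).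
  - intros x Hx; eapply curve_derive_eq.
    + apply curve_derive_mult; [apply curve_derive_const|].
      apply (cdiff_ramanujan_sum (b * x)%C (Hb x Hx) (fun s : R => b * s)%C x b eq_refl (Hline x)).
    + cbv beta; field; intros E; apply RtoC_inj in E; lra.
  - intros x Hx; apply ccontinuous_derive.
    apply (ex_curve_derive_mult (fun _ => - b)%C); [apply ex_curve_derive_const|].
    apply (ex_curve_derive_mult (fun x : R => b * x)%C); [exists b; apply Hline|].
    eexists; apply (cdiff_power_sum_sqr harm1 (b * x)%C Cmod_harm1 (Hb x Hx)
      (fun s : R => b * s)%C x b eq_refl (Hline x)). }
replace (- / 2 * ramanujan_sum (b * 1) - - / 2 * ramanujan_sum (b * 0))%C
  with (- / 2 * ramanujan_sum b)%C in H.
2:{ replace (b * 1)%C with b by ring; unfold ramanujan_sum at 3; ring. }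
assert (H' : cint (fun x : R => Carctan (a * x) ^ 2 / x)%C (- / 2 * ramanujan_sum b)%C).
{ refine (cint_ext _ _ _ _ H); intros x Hx; symmetry; now apply Carctan_sqr. }
destruct H' as [H1 H2].
exact (is_RInt_fct_extend_pair (U := R_NormedModule) (V := R_NormedModule) _ _ _ _ _ H1 H2).
Qed.

Lemma unslit_Ci_mult (a : C) : closed_form_domain a -> unslit (Ci * a).
Proof.
intros [Ha [Ha0 HA]]; assert (Hm := Cmod2_alt a); assert (H0 := Cmod_ge_0 a).
destruct a as [x y]; intros HI; simpl in HI.
assert (Hx : x = 0) by lra; subst x; unfold Arg in HA; simpl in *.
destruct (Rle_dec 0 y) as [Hy|Hy]; [|split; nra].
unfold Rdiv at 1 in HA; rewrite Rmult_0_l, acos_0 in HA; lra.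
Qed.

Lemma Clog_Ci_mult (a : C) : a <> 0 -> Arg a < PI / 2 ->
  Clog (Ci * a) = (PI / 2 * Ci + Clog a)%C.
Proof.
intros Ha HA; destruct (Arg_spec a Ha) as [H1 H2].
assert (Hm := proj1 (Cmod_gt_0 a) Ha); assert (HPI := PI_RGT_0).
replace (Ci * a)%C with
  (Cmod a * cos (Arg a + PI / 2), Cmod a * sin (Arg a + PI / 2)).
- rewrite Clog_polar by lra; unfold Clog; apply C_eq; simpl; field.
- rewrite cos_plus, sin_plus, cos_PI2, sin_PI2.
  transitivity (Ci * (Cmod a * (cos (Arg a), sin (Arg a))))%C;
    [apply C_eq; simpl; ring|now rewrite <- H2].
Qed.

Lemma closed_form_ramanujan_rhs (a : C) : closed_form_domain a ->
  closed_form a = (- ramanujan_rhs (Ci * a))%C.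
Proof.
intros Hd; assert (Hz := unslit_Ci_mult a Hd); destruct Hd as [Ha [Ha0 HA]].
assert (Hz1 : Cmod (Ci * a) < 1) by now rewrite Cmod_Ci_mult.
assert (HR := odd_Li2_reflection _ Hz).
assert (Hl := Clog_cayley_arctanh _ Hz1); rewrite arctanh_Ci in Hl by exact Ha.
rewrite ramanujan_rhs_cayley; unfold closed_form.
replace ((Ci * a - 1) / (1 + Ci * a))%C with (- cayley (Ci * a))%C
  by (unfold cayley, Cdiv; ring).
fold (cayley (Ci * a)); fold (odd_Li 3 (cayley (Ci * a))); fold (odd_Li 2 (Ci * a)).
rewrite <- Clog_Ci_mult by assumption.
set (z := (Ci * a)%C) in *; set (w := cayley z) in *; set (T := Carctan a) in *.
rewrite <- HR, Hl.
transitivity (odd_Li 3 w + 2 * (Ci * T) * odd_Li 2 w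
  - 4 * (Ci * Ci) * (T * T) * Clog z - 2 * Clog z * (T * T) - 7 / 4 * zeta3)%C;
  [simpl; ring|].
rewrite Ci_mult_Ci.
transitivity (odd_Li 3 w + 2 * (Ci * T) * odd_Li 2 w
  - 2 * (Ci * Ci) * (T * T) * Clog z - 7 / 4 * zeta3)%C;
  [rewrite Ci_mult_Ci; ring|].
field; intros E; apply RtoC_inj in E; lra.
Qed.

Theorem mainTheorem8 :
  (* Ramanujan's formula on [0, 1]; at the two endpoints, where a logarithm of 0
     occurs, the right-hand side is moreover the limit from inside (0, 1) *)
  (forall a : R, 0 <= a <= 1 ->
     @is_series C_AbsRing C_NormedModule
       (fun n => h (n + 1) / INR (n + 1) ^ 2 * a ^ (2 * (n + 1)))%C
       (ramanujan_rhs a) /\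
     (a = 0 \/ a = 1 ->
      filterlim (fun x : R => ramanujan_rhs x)
        (within (fun x : R => 0 < x < 1) (locally a))
        (@locally C_UniformSpace (ramanujan_rhs a)))) /\
  (* its extension to the disc *)
  (forall a : C, ramanujan_domain a ->
     @is_series C_AbsRing C_NormedModule
       (fun n => h (n + 1) / INR (n + 1) ^ 2 * a ^ (2 * (n + 1)))%C
       (ramanujan_rhs a)) /\
  (* the alternating series, the integral and the closed form *)
  (forall a : C, Cmod a < 1 ->
     exists I : C,
       @is_RInt C_R_NormedModule
         (fun x : R => Carctan (a * x) ^ 2 / x)%C 0 1 I /\
       @is_series C_AbsRing C_NormedModule
         (fun n => (-1) ^ n * (h (n + 1) / INR (n + 1) ^ 2)
                   * a ^ (2 * (n + 1)))%C
         (2 * I)%C /\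
       (closed_form_domain a -> (2 * I)%C = closed_form a)).
Proof.
split; [|split].
- intros a Ha; split.
  + apply csum_is_series; rewrite ramanujan_rhs_sum_R by exact Ha.
    apply csum_ramanujan_sum; rewrite Cmod_R_pos; lra.
  + intros [-> | ->]; apply filterlim_czero;
      [exact tends_to_0_ramanujan_rhs_0|exact tends_to_0_ramanujan_rhs_1].
- intros a [Ha [Hl _]]; apply csum_is_series.
  assert (Hu : unslit a).
  { intros HI; assert (H := re_le_Cmod a); assert (H1 := Rle_abs (Re a)).
    split; [apply Rnot_le_lt; intros H2; now apply Hl|lra]. }
  rewrite ramanujan_rhs_sum by assumption.
  apply csum_ramanujan_sum; lra.
- intros a Ha; exists (- / 2 * ramanujan_sum (Ci * a))%C.
  assert (E : (2 * (- / 2 * ramanujan_sum (Ci * a)))%C = (- ramanujan_sum (Ci * a))%C)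
    by (field; intros E; apply RtoC_inj in E; lra).
  rewrite E; split; [now apply is_RInt_Carctan_sqr|split].
  + apply csum_is_series, csum_ramanujan_sum_Ci, Ha.
  + intros Hd; rewrite closed_form_ramanujan_rhs by exact Hd.
    rewrite ramanujan_rhs_sum; [reflexivity|now apply unslit_Ci_mult|].
    now rewrite Cmod_Ci_mult.
Qed.
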